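(* Let $(M,\theta)$ be a pair such that $\dim M\le 2$, $M_0=M\setminus M_\theta$ is dense in $M$, $\mathrm H^2(M_0/\theta,\mathbb Z)\cong 0$ and $\mathrm H^2(\chi(M_0/\theta),\mathbb Z)\cong 0$. Let $(M',\theta')$ be another pair (with the same $p$). If $(M,\theta)$ and $(M',\theta')$ are orbit equivalent, that is, there is a homeomorphism $F\colon M\to M'$ such that $F(O_\theta(x))=O_{\theta'}(F(x))$ for all $x\in M$, then $C(M)\times_\theta\mathbb Z_p$ and $C(M')\times_{\theta'}\mathbb Z_p$ are $*$-isomorphic.
   Context: Throughout, $p$ is a fixed prime number. A pair $(M,\theta)$ consists of a separable compact Hausdorff space $M$ and a homeomorphism $\theta\colon M\to M$ of period $p$ (that is, $\theta^p=\mathrm{id}$ and $\theta\neq\mathrm{id}$) such that the fixed point set $M_\theta=\{x\in M\mid \theta(x)=x\}$ is non-empty. Put $M_0=M\setminus M_\theta$, and let $O_\theta(x)=\{x,\theta(x),\dots,\theta^{p-1}(x)\}$ be the orbit of $x$. $M_0/\theta$ denotes the orbit space of $\theta$ on $M_0$ with the quotient topology. The homeomorphism $\theta$ acts on $C(M)$ by $\theta(f)(x)=f(\theta(x))$, which gives an action of $\mathbb Z_p=\mathbb Z/p\mathbb Z$, and $C(M)\times_\theta\mathbb Z_p$ is the corresponding crossed product $C^*$-algebra. The same notation is used for $(M',\theta')$. $\dim$ is covering dimension. For a locally compact Hausdorff space $X$, $X^+$ is its one-point compactification, $\beta(X)$ its Stone–Čech compactification, and $\chi(X)=\beta(X)\setminus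 X$ its corona set. $\mathrm H^2(\cdot,\mathbb Z)$ is Čech cohomology, with the convention that $\mathrm H^2(X,\mathbb Z)=\mathrm H^2(X^+,\mathbb Z)$ for locally compact Hausdorff $X$ (so $\mathrm H^2(M_0/\theta,\mathbb Z)$ means $\mathrm H^2((M_0/\theta)^+,\mathbb Z)$).
   Formalization: ''Separable'' is read as: C(M) is norm-separable, i.e. the compact Hausdorff spaces M and M' are second countable (metrizable); with only a countable dense subset the claim fails (covers of Mrówka's psi-space with one-point corona). *)

(* Defs.v *)
From HB Require Import structures.
From mathcomp Require Import all_boot all_order all_algebra.
From mathcomp Require Import generic_quotient complex.
From mathcomp Require Import ring.
From mathcomp Require Import all_classical all_reals topology normedtype.

Set Implicit Arguments.
Unset Strict Implicit.
Unset Printing Implicit Defensive.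

Import Order.TTheory GRing.Theory Num.Theory.
Import numFieldNormedType.Exports.

Local Open Scope classical_set_scope.
Local Open Scope ring_scope.
Local Open Scope card_scope.
Local Open Scope quotient_scope.

Definition open_cover (X : topologicalType) (U : set (set X)) :=
  U `<=` open /\ \bigcup_(A in U) A = [set: X].

Definition finer (X : Type) (V U : set (set X)) :=
  forall A, V A -> exists B, U B /\ A `<=` B.

Definition covering_dim_le (X : topologicalType) (n : nat) :=
  forall U : set (set X), open_cover U -> finite_set U ->
  exists V : set (set X),
    [/\ open_cover V, finite_set V, finer V U &
        forall x, [set A | V A /\ A x] #<= `I_n.+1].

(* Cech cohomology: an n-simplex of the nerve of a cover U is a sequence s of n.+1 members of U
   (repetitions allowed) with a common point.  A cochain is a function on all
   sequences; only its values on the nerve matter. *)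

Section Cochains.
Variable T : Type.
Implicit Types (s t : seq T) (c d : seq T -> int).

Definition face (i : nat) s := take i s ++ drop i.+1 s.

Definition coboundary c s : int := \sum_(i < size s) (-1) ^+ i * c (face i s).

Lemma coboundary_nil c : coboundary c [::] = 0.
Proof. by rewrite /coboundary big_ord0. Qed.

Lemma coboundary_cons c x s :
  coboundary c (x :: s) = c s - coboundary (c \o cons x) s.
Proof.
rewrite /coboundary /= big_ord_recl /= expr0 mul1r /face /= drop0; congr (_ + _).
by rewrite -sumrN; apply: eq_bigr => i _; rewrite exprS mulN1r mulNr.
Qed.

Lemma eq_coboundary c d s : c =1 d -> coboundary c s = coboundary d s.
Proof. by move=> cd; apply: eq_bigr => i _; rewrite cd. Qed.

Lemma coboundaryD c d s :
  coboundary (fun t => c t + d t) s = coboundary c s + coboundary d s.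
Proof. by rewrite -big_split; apply: eq_bigr => i _; rewrite mulrDr. Qed.

Lemma coboundaryN c s : coboundary (fun t => - c t) s = - coboundary c s.
Proof. by rewrite -sumrN; apply: eq_bigr => i _; rewrite mulrN. Qed.

Lemma coboundary0 s : coboundary (fun=> 0) s = 0.
Proof. by rewrite /coboundary big1 // => i _; rewrite mulr0. Qed.

End Cochains.

Lemma coboundary_map (S T : Type) (r : S -> T) (c : seq T -> int) s :
  coboundary c (map r s) = coboundary (c \o map r) s.
Proof.
rewrite /coboundary size_map; apply: eq_bigr => i _.
by rewrite /face /= map_cat map_take map_drop.
Qed.

(* The prism operator: two refining maps induce cochain homotopic maps. *)
Section Prism.
Variables (S T : Type) (r q : S -> T).

Fixpoint prism (c : seq T -> int) (s : seq S) : int :=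
  if s is x :: s' then c [:: r x, q x & map q s'] - prism (c \o cons (r x)) s'
  else 0.

Lemma eq_prism c d s : c =1 d -> prism c s = prism d s.
Proof.
elim: s c d => //= x s IH c d cd; rewrite cd; congr (_ - _).
by apply: IH => t /=; rewrite cd.
Qed.

Lemma prismB c d s : prism (fun t => c t - d t) s = prism c s - prism d s.
Proof.
elim: s c d => [|x s IH] c d /=; first by rewrite subr0.
rewrite (eq_prism (d := fun t => (c \o cons (r x)) t - (d \o cons (r x)) t)) //.
by rewrite IH !opprB addrACA [RHS]addrACA; congr (_ + _); rewrite addrC.
Qed.

Lemma prismP c s :
  coboundary (prism c) s + prism (coboundary c) s = c (map q s) - c (map r s).
Proof.
elim: s c => [|x s IH] c; first by rewrite coboundary_nil /= addr0 subrr.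
rewrite coboundary_cons /=.
have -> : prism (coboundary c \o cons (r x)) s =
          prism c s - prism (coboundary (c \o cons (r x))) s.
  by rewrite -prismB; apply: eq_prism => t /=; rewrite coboundary_cons.
have -> : coboundary (prism c \o cons x) s =
    coboundary (c \o cons (r x) \o cons (q x)) (map q s)
    - coboundary (prism (c \o cons (r x))) s.
  by rewrite coboundary_map -coboundaryN -coboundaryD.
rewrite !coboundary_cons.
have : coboundary (prism (c \o cons (r x))) s
       + prism (coboundary (c \o cons (r x))) s
     = c (r x :: map q s) - c (r x :: map r s) := IH (c \o cons (r x)).
rewrite /=.
set A := coboundary (prism (c \o _)) s.
set B := prism (coboundary (c \o _)) s.
set D := coboundary _ (map q s).
by move=> /(canRL (addrK _)) ->; ring.
Qed.

End Prism.

Lemma prism_eq0 (S T : eqType) (r q : S -> T) (c : seq T -> int) s :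
  (forall t, size t = (size s).+1 -> {subset t <= map r s ++ map q s} ->
    c t = 0) ->
  prism r q c s = 0.
Proof.
elim: s c => //= x s IH c c0.
rewrite (c0 [:: r x, q x & map q s]) /= ?size_map //; last first.
  move=> i; rewrite !(inE, mem_cat) => /or3P[->|->|->] //; by rewrite !orbT.
rewrite IH ?subr0 // => t ts tin /=; apply: c0; first by rewrite /= ts.
move=> i; rewrite !(inE, mem_cat) => /predU1P[->|/tin]; first by rewrite eqxx.
by rewrite mem_cat => /orP[] ->; rewrite !orbT.
Qed.

Section Cech.
Variable X : topologicalType.
Implicit Types (U V W : set (set X)) (s t : seq (set X)).
Implicit Types (r q : set X -> set X) (c d : seq (set X) -> int).

Definition nerve U s :=
  (forall A, A \in s -> U A) /\ exists x, forall A, A \in s -> A x.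

(* r is a choice, for each member of V, of a member of U containing it *)
Definition refining V U r := forall A, V A -> U (r A) /\ A `<=` r A.

(* The condition e [::] = 0 keeps the degree 0 part unreduced. *)
Definition cohomologous n U c d :=
  exists2 e : seq (set X) -> int, e [::] = 0 &
    forall s, size s = n.+1 -> nerve U s -> c s - d s = coboundary e s.

Record cech_cocycle (n : nat) := CechCocycle {
  cc_cover : set (set X);
  cc_fun :> seq (set X) -> int;
  cc_open : open_cover cc_cover;
  cc_closed : forall s, size s = n.+2 -> nerve cc_cover s ->
    coboundary cc_fun s = 0
}.

(* Equality in the direct limit, over all open covers ordered by refinement, of
   the cohomology groups of the nerves. *)
Definition cech_equiv n (a b : cech_cocycle n) :=
  exists W r q, [/\ open_cover W, refining W (cc_cover a) r,
    refining W (cc_cover b) q & cohomologous n W (a \o map r) (b \o map q)].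

Lemma cohom_eq n U c d : c =1 d -> cohomologous n U c d.
Proof.
move=> cd; exists (fun=> 0) => // s _ _.
by rewrite coboundary0 cd subrr.
Qed.

Lemma cohom_sym n U c d : cohomologous n U c d -> cohomologous n U d c.
Proof.
move=> [e e0 ecd]; exists (fun s => - e s); first by rewrite e0 oppr0.
by move=> s ss Us; rewrite coboundaryN -ecd // opprB.
Qed.

Lemma cohomD n U c d c' d' : cohomologous n U c d -> cohomologous n U c' d' ->
  cohomologous n U (fun s => c s + c' s) (fun s => d s + d' s).
Proof.
move=> [e e0 ecd] [f f0 fcd]; exists (fun s => e s + f s).
  by rewrite e0 f0 addr0.
by move=> s ss Us; rewrite coboundaryD -ecd // -fcd // opprD addrACA.
Qed.

Lemma cohomN n U c d : cohomologous n U c d ->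
  cohomologous n U (fun s => - c s) (fun s => - d s).
Proof.
move=> [e e0 ecd]; exists (fun s => - e s); first by rewrite e0 oppr0.
by move=> s ss Us; rewrite coboundaryN -ecd // opprD.
Qed.

Lemma cohom_trans n U d c c' : cohomologous n U c d -> cohomologous n U d c' ->
  cohomologous n U c c'.
Proof.
move=> [e e0 ecd] [f f0 fcd]; exists (fun s => e s + f s).
  by rewrite e0 f0 addr0.
by move=> s ss Us; rewrite coboundaryD -ecd // -fcd // addrA subrK.
Qed.

Lemma nerve_map V U r s : refining V U r -> nerve V s -> nerve U (map r s).
Proof.
move=> rVU [sV [x sx]]; split=> [A|].
  by move=> /mapP[B /sV/rVU[? _] ->].
exists x => A /mapP[B Bs ->].
by have [_] := rVU _ (sV _ Bs); apply; exact: sx.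
Qed.

Lemma cohom_pull n V U r c d : refining V U r -> cohomologous n U c d ->
  cohomologous n V (c \o map r) (d \o map r).
Proof.
move=> rVU [e e0 ecd]; exists (e \o map r) => // s ss Vs.
by rewrite /= ecd ?size_map ?coboundary_map //; exact: nerve_map Vs.
Qed.

Lemma cohom_refining n (a : cech_cocycle n) V r q :
  refining V (cc_cover a) r -> refining V (cc_cover a) q ->
  cohomologous n V (a \o map r) (a \o map q).
Proof.
move=> rV qV; apply: cohom_sym; exists (prism r q a) => // s ss Vs.
rewrite /= -(prismP r q a s) [X in _ + X]prism_eq0 ?addr0 // => t ts tin.
apply: cc_closed; first by rewrite ts ss.
case: Vs => sV [x sx]; split=> [A /tin|].
  by rewrite mem_cat => /orP[]/mapP[B /sV Bs ->]; [case: (rV _ Bs)|case: (qV _ Bs)].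
exists x => A /tin; rewrite mem_cat => /orP[]/mapP[B Bs ->].
  by have [_] := rV _ (sV _ Bs); apply; exact: sx.
by have [_] := qV _ (sV _ Bs); apply; exact: sx.
Qed.

Definition refine U (A : set X) : set X := xget setT [set B | U B /\ A `<=` B].

Lemma refineP V U : finer V U -> refining V U (refine U).
Proof. by move=> VU A /VU[B UB]; rewrite /refine; case: xgetP => // /(_ B). Qed.

Lemma refining_comp W V U r q :
  refining W V q -> refining V U r -> refining W U (r \o q).
Proof. by move=> qW rV A /qW[/rV[? ?] ?]; split=> //; apply: subset_trans; eassumption. Qed.

Definition cover_meet U V : set (set X) := [set A `&` B | A in U & B in V].

Lemma cover_meet_open U V :
  open_cover U -> open_cover V -> open_cover (cover_meet U V).
Proof.
move=> [oU cU] [oV cV]; split=> [_ [A UA [B VB <-]]|].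
  by apply: openI; [exact: oU|exact: oV].
rewrite -subTset => x _.
have [A UA Ax] : (\bigcup_(A in U) A) x by rewrite cU.
have [B VB Bx] : (\bigcup_(A in V) A) x by rewrite cV.
by exists (A `&` B) => //; exists A => //; exists B.
Qed.

Lemma cover_meetl U V : finer (cover_meet U V) U.
Proof. by move=> _ [A UA [B VB <-]]; exists A; split. Qed.

Lemma cover_meetr U V : finer (cover_meet U V) V.
Proof. by move=> _ [A UA [B VB <-]]; exists B; split. Qed.

Lemma finer_refl U : finer U U.
Proof. by move=> A UA; exists A; split. Qed.

Lemma finer_meet W U V : finer W U -> finer W V -> finer W (cover_meet U V).
Proof.
move=> WU WV A WA; have [B [UB AB]] := WU _ WA; have [C [VC AC]] := WV _ WA.
exists (B `&` C); split; first by exists B => //; exists C.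
by move=> x Ax; split; [exact: AB|exact: AC].
Qed.

Lemma finer_trans V W U : finer W V -> finer V U -> finer W U.
Proof.
move=> WV VU A /WV[B [/VU[C [UC BC]] AB]].
by exists C; split=> //; exact: subset_trans BC.
Qed.

Lemma refining_finer V U r : refining V U r -> finer V U.
Proof. by move=> rVU A /rVU ?; exists (r A). Qed.

Lemma cech_equiv_strong n (a b : cech_cocycle n) : cech_equiv a b ->
  exists W0, [/\ open_cover W0, finer W0 (cc_cover a), finer W0 (cc_cover b) &
    forall W r q, finer W W0 ->
    refining W (cc_cover a) r -> refining W (cc_cover b) q ->
    cohomologous n W (a \o map r) (b \o map q)].
Proof.
move=> [W0 [r0 [q0 [W0o r0P q0P ab]]]]; exists W0; split=> //.
- exact: refining_finer r0P.
- exact: refining_finer q0P.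
move=> W r q WW0 rP qP.
have tP := refineP WW0; set t := refine W0 in tP.
apply: (cohom_trans (d := a \o map (r0 \o t))).
  by apply: cohom_refining => //; exact: refining_comp tP r0P.
apply: (cohom_trans (d := b \o map (q0 \o t))).
  apply: (cohom_trans (d := (a \o map r0) \o map t)).
    by apply: cohom_eq => s /=; rewrite map_comp.
  apply: (cohom_trans (cohom_pull tP ab)).
  by apply: cohom_eq => s /=; rewrite map_comp.
by apply: cohom_refining => //; exact: refining_comp tP q0P.
Qed.

Lemma cech_equiv_refl n (a : cech_cocycle n) : cech_equiv a a.
Proof.
have idP : refining (cc_cover a) (cc_cover a) id by move=> A UA; split.
exists (cc_cover a), id, id; split=> //; first exact: cc_open.
exact: cohom_eq.
Qed.

Lemma cech_equiv_sym n (a b : cech_cocycle n) :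
  cech_equiv a b -> cech_equiv b a.
Proof.
by move=> [W [r [q [? ? ? ?]]]]; exists W, q, r; split=> //; exact: cohom_sym.
Qed.

Lemma cech_equiv_trans n (b a c : cech_cocycle n) :
  cech_equiv a b -> cech_equiv b c -> cech_equiv a c.
Proof.
move=> /cech_equiv_strong[V [oV Va Vb abP]].
move=> /cech_equiv_strong[W [oW Wb Wc bcP]].
have VWV := @cover_meetl V W; have VWW := @cover_meetr V W.
have raP := refineP (finer_trans VWV Va).
have rbP := refineP (finer_trans VWV Vb).
have rcP := refineP (finer_trans VWW Wc).
exists (cover_meet V W), (refine (cc_cover a)), (refine (cc_cover c)).
split=> //; first exact: cover_meet_open.
by apply: cohom_trans (bcP _ _ _ VWW rbP rcP); exact: abP.
Qed.

Lemma cover_setT_open : open_cover [set [set: X]].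
Proof.
by split=> [_ ->|]; [exact: openT|rewrite bigcup_set1].
Qed.

Section Group.
Variable n : nat.
Implicit Types a b : cech_cocycle n.

Definition cech_zero : cech_cocycle n :=
  CechCocycle cover_setT_open (fun s _ _ => coboundary0 s).

Lemma cech_opp_closed a s : size s = n.+2 -> nerve (cc_cover a) s ->
  coboundary (fun t => - a t) s = 0.
Proof. by move=> ss sN; rewrite coboundaryN cc_closed ?oppr0. Qed.

Definition cech_opp a : cech_cocycle n :=
  CechCocycle (cc_open a) (@cech_opp_closed a).

Definition cech_add_fun a b s : int :=
  a (map (refine (cc_cover a)) s) + b (map (refine (cc_cover b)) s).

Lemma cech_add_closed a b s :
  size s = n.+2 -> nerve (cover_meet (cc_cover a) (cc_cover b)) s ->
  coboundary (cech_add_fun a b) s = 0.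
Proof.
move=> ss sN; rewrite coboundaryD -!coboundary_map !cc_closed ?addr0 ?size_map //.
  by apply: nerve_map sN; apply: refineP; exact: cover_meetr.
by apply: nerve_map sN; apply: refineP; exact: cover_meetl.
Qed.

Definition cech_add a b : cech_cocycle n :=
  CechCocycle (cover_meet_open (cc_open a) (cc_open b)) (@cech_add_closed a b).

(* On any finer cover, a sum is the sum of arbitrary restrictions. *)
Lemma cech_addE a b W r p q : refining W (cc_cover (cech_add a b)) r ->
  refining W (cc_cover a) p -> refining W (cc_cover b) q ->
  cohomologous n W (cech_add a b \o map r) (fun s => a (map p s) + b (map q s)).
Proof.
move=> rP pP qP.
apply: (cohom_trans (d := fun s =>
  a (map (refine (cc_cover a) \o r) s) + b (map (refine (cc_cover b) \o r) s))).
  by apply: cohom_eq => s; congr (_ + _); rewrite -map_comp.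
apply: cohomD; apply: cohom_refining => //; apply: refining_comp rP _.
  by apply: refineP; exact: cover_meetl.
by apply: refineP; exact: cover_meetr.
Qed.

Lemma cech_equivI a b W : open_cover W ->
  finer W (cc_cover a) -> finer W (cc_cover b) ->
  (forall r q, refining W (cc_cover a) r -> refining W (cc_cover b) q ->
    cohomologous n W (a \o map r) (b \o map q)) ->
  cech_equiv a b.
Proof.
move=> oW Wa Wb ab; have [aP bP] := (refineP Wa, refineP Wb).
by exists W, (refine (cc_cover a)), (refine (cc_cover b)); split=> //; exact: ab.
Qed.

Lemma cech_add_equiv a a' b b' : cech_equiv a a' -> cech_equiv b b' ->
  cech_equiv (cech_add a b) (cech_add a' b').
Proof.
move=> /cech_equiv_strong[V [oV Va Va' aP]].
move=> /cech_equiv_strong[W [oW Wb Wb' bP]].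
have VWV := @cover_meetl V W; have VWW := @cover_meetr V W.
have [Ma Ma'] := (finer_trans VWV Va, finer_trans VWV Va').
have [Mb Mb'] := (finer_trans VWW Wb, finer_trans VWW Wb').
apply: (@cech_equivI _ _ (cover_meet V W)); first exact: cover_meet_open.
- exact: finer_meet.
- exact: finer_meet.
move=> r q rP qP.
apply: cohom_trans (cech_addE rP (refineP Ma) (refineP Mb)) _.
apply: cohom_trans (cohom_sym (cech_addE qP (refineP Ma') (refineP Mb'))).
by apply: cohomD; [apply: aP|apply: bP] => //; exact: refineP.
Qed.

Lemma cech_opp_equiv a b :
  cech_equiv a b -> cech_equiv (cech_opp a) (cech_opp b).
Proof.
by move=> [W [r [q [oW rP qP ab]]]]; exists W, r, q; split=> //; exact: cohomN.
Qed.

Lemma cech_addA a b (c : cech_cocycle n) :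
  cech_equiv (cech_add a (cech_add b c)) (cech_add (cech_add a b) c).
Proof.
pose W := cc_cover (cech_add a (cech_add b c)).
have Wa : finer W (cc_cover a) by exact: cover_meetl.
have Wbc : finer W (cc_cover (cech_add b c)) by exact: cover_meetr.
have Wb : finer W (cc_cover b) by apply: finer_trans Wbc _; exact: cover_meetl.
have Wc : finer W (cc_cover c) by apply: finer_trans Wbc _; exact: cover_meetr.
have Wab : finer W (cc_cover (cech_add a b)) by exact: finer_meet.
apply: (@cech_equivI _ _ W); first exact: cc_open.
- exact: finer_refl.
- exact: finer_meet.
move=> r q rP qP; have [aP bP cP] := And3 (refineP Wa) (refineP Wb) (refineP Wc).
apply: cohom_trans (cech_addE rP aP (refineP Wbc)) _.
apply: cohom_trans (cohom_sym (cech_addE qP (refineP Wab) cP)).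
apply: cohom_trans (cohomD (cohom_eq n W (frefl _))
  (cech_addE (refineP Wbc) bP cP)) _.
apply: cohom_sym.
apply: cohom_trans (cohomD (cech_addE (refineP Wab) aP bP)
  (cohom_eq n W (frefl _))) _.
by apply: cohom_eq => s; rewrite addrA.
Qed.

Lemma cech_addC a b : cech_equiv (cech_add a b) (cech_add b a).
Proof.
pose W := cc_cover (cech_add a b).
have Wa : finer W (cc_cover a) by exact: cover_meetl.
have Wb : finer W (cc_cover b) by exact: cover_meetr.
apply: (@cech_equivI _ _ W); first exact: cc_open.
- exact: finer_refl.
- exact: finer_meet.
move=> r q rP qP; have [aP bP] := (refineP Wa, refineP Wb).
apply: cohom_trans (cech_addE rP aP bP) _.
apply: cohom_trans (cohom_sym (cech_addE qP bP aP)).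
by apply: cohom_eq => s; rewrite addrC.
Qed.

Lemma cech_add0 a : cech_equiv (cech_add cech_zero a) a.
Proof.
pose W := cc_cover (cech_add cech_zero a).
have W0 : finer W (cc_cover cech_zero) by exact: cover_meetl.
have Wa : finer W (cc_cover a) by exact: cover_meetr.
apply: (@cech_equivI _ _ W) => //; first exact: cc_open.
  exact: finer_refl.
move=> r q rP qP; apply: cohom_trans (cech_addE rP (refineP W0) qP) _.
by apply: cohom_eq => s; rewrite add0r.
Qed.

Lemma cech_addN a : cech_equiv (cech_add (cech_opp a) a) cech_zero.
Proof.
pose W := cc_cover (cech_add (cech_opp a) a).
have Wa : finer W (cc_cover a) by exact: cover_meetr.
apply: (@cech_equivI _ _ W); first exact: cc_open.
- exact: finer_refl.
- by move=> A _; exists setT; split.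
move=> r q rP qP.
apply: cohom_trans (cech_addE rP (refineP (Wa : finer W (cc_cover (cech_opp a)))) (refineP Wa)) _.
by apply: cohom_eq => s /=; rewrite addNr.
Qed.

HB.instance Definition _ := gen_eqMixin (cech_cocycle n).
HB.instance Definition _ := gen_choiceMixin (cech_cocycle n).

Definition cech_rel : rel (cech_cocycle n) := fun a b => `[< cech_equiv a b >].

Lemma cech_rel_refl : reflexive cech_rel.
Proof. by move=> a; apply/asboolP; exact: cech_equiv_refl. Qed.

Lemma cech_rel_sym : symmetric cech_rel.
Proof. by move=> a b; apply/asboolP/asboolP; exact: cech_equiv_sym. Qed.

Lemma cech_rel_trans : transitive cech_rel.
Proof.
by move=> b a c /asboolP ab /asboolP bc; apply/asboolP; exact: cech_equiv_trans bc.
Qed.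

Canonical cech_equiv_rel :=
  EquivRel cech_rel cech_rel_refl cech_rel_sym cech_rel_trans.

Definition cech_cohomology := {eq_quot cech_equiv_rel}.
HB.instance Definition _ := Quotient.on cech_cohomology.
HB.instance Definition _ := Choice.on cech_cohomology.

Lemma cech_piP a b :
  \pi_cech_cohomology a = \pi_cech_cohomology b <-> cech_equiv a b.
Proof.
by split=> [/eqquotP/asboolP|ab] //; apply/eqquotP/asboolP.
Qed.

Lemma cech_repr_pi a : cech_equiv (repr (\pi_cech_cohomology a)) a.
Proof. by apply/cech_piP; rewrite reprK. Qed.

Definition cech_class_add (x y : cech_cohomology) : cech_cohomology :=
  \pi_cech_cohomology (cech_add (repr x) (repr y)).
Definition cech_class_opp (x : cech_cohomology) : cech_cohomology :=
  \pi_cech_cohomology (cech_opp (repr x)).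

Lemma cech_class_addA : associative cech_class_add.
Proof.
move=> x y z; apply/cech_piP.
apply: cech_equiv_trans (cech_add_equiv (cech_equiv_refl _) (cech_repr_pi _)) _.
apply: cech_equiv_trans (cech_addA _ _ _) _; apply: cech_equiv_sym.
exact: cech_add_equiv (cech_repr_pi _) (cech_equiv_refl _).
Qed.

Lemma cech_class_addC : commutative cech_class_add.
Proof. by move=> x y; apply/cech_piP; exact: cech_addC. Qed.

Lemma cech_class_add0 : left_id (\pi_cech_cohomology cech_zero) cech_class_add.
Proof.
move=> x; rewrite -[RHS]reprK; apply/cech_piP.
apply: cech_equiv_trans (cech_add_equiv (cech_repr_pi _) (cech_equiv_refl _)) _.
exact: cech_add0.
Qed.

Lemma cech_class_addN :
  left_inverse (\pi_cech_cohomology cech_zero) cech_class_opp cech_class_add.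
Proof.
move=> x; apply/cech_piP.
apply: cech_equiv_trans (cech_add_equiv (cech_repr_pi _) (cech_equiv_refl _)) _.
exact: cech_addN.
Qed.

HB.instance Definition _ := GRing.isZmodule.Build cech_cohomology
  cech_class_addA cech_class_addC cech_class_add0 cech_class_addN.

End Group.
End Cech.

(* The Stone-Cech compactification of X is the closure of the image of X in the cube [0, 1]^C(X, [0, 1]).
   The cube is taken inside a power of R, where it is closed. *)

Section StoneCech.
Variables (R : realType) (X : topologicalType).

Definition unit_fun : set (X -> R) :=
  [set f : X -> R | continuous f /\ forall x, 0 <= f x <= 1].

Definition cube := {ptws unit_fun -> R}.

Definition cube_eval (x : X) : cube := fun f => set_val f x.

Definition stone_cech := set_type (closure (range cube_eval)).

Definition to_stone_cech (x : X) : stone_cech :=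
  exist _ (cube_eval x) (mem_set (subset_closure (imageT cube_eval x))).

Definition corona := set_type (~` range to_stone_cech).

End StoneCech.

Definition homeomorphism (X Y : topologicalType) (f : X -> Y) :=
  continuous f /\ exists g, [/\ continuous g, cancel f g & cancel g f].

(* "Separable" is used as in the theory of operator algebras: C(M) is
   norm-separable, i.e. the compact space M is second countable (a countable dense
   subset is not enough). *)
Record Zp_space (p : nat) := ZpSpace {
  zp_space :> topologicalType;
  zp_act : zp_space -> zp_space;
  zp_prime : prime p;
  zp_compact : compact [set: zp_space];
  zp_hausdorff : hausdorff_space zp_space;
  zp_separable : @second_countable zp_space;
  zp_homeo : homeomorphism zp_act;
  zp_iter : iter p zp_act = id;
  zp_neq_id : zp_act <> id;
  zp_fixed : exists x : zp_space, zp_act x = x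
}.

Section Orbits.
Variables (p : nat) (M : Zp_space p).

Definition orbit (x : M) : set M := [set iter k (@zp_act p M) x | k in `I_p].

Definition free_part : set M := [set x | zp_act x <> x].

Definition orbit_rel : rel free_part :=
  fun x y => `[< orbit (set_val x) = orbit (set_val y) >].

Lemma orbit_rel_refl : reflexive orbit_rel.
Proof. by move=> x; apply/asboolP. Qed.

Lemma orbit_rel_sym : symmetric orbit_rel.
Proof. by move=> x y; apply/asboolP/asboolP. Qed.

Lemma orbit_rel_trans : transitive orbit_rel.
Proof.
by move=> y x z /asboolP xy /asboolP yz; apply/asboolP; rewrite xy.
Qed.

Definition orbit_equiv :=
  EquivRel orbit_rel orbit_rel_refl orbit_rel_sym orbit_rel_trans.

Definition orbit_space := quotient_topology {eq_quot orbit_equiv}.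
HB.instance Definition _ := Topological.on orbit_space.

End Orbits.

Arguments free_part {p} M.

Definition orbit_equivalent (p : nat) (M M' : Zp_space p) :=
  exists2 F : M -> M', homeomorphism F &
    forall x, F @` orbit x = orbit (F x).

Definition complexes (R : realType) : numClosedFieldType := R[i].

Section ContinuousFunctions.
Variables (R : realType) (M : topologicalType).
Let C := complexes R.

Definition continuous_pred : pred (M -> C) := fun f => `[< continuous f >].

Lemma continuous_predP (f : M -> C) :
  reflect (continuous f) (f \in continuous_pred).
Proof. exact: asboolP. Qed.

Lemma continuous_subring : subring_closed continuous_pred.
Proof.
split=> [|f g /continuous_predP cf /continuous_predP cg|
          f g /continuous_predP cf /continuous_predP cg]; apply/continuous_predP.
- by move=> x; exact: cvg_cst.
- by move=> x; apply: cvgB; [exact: cf|exact: cg].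
- by move=> x; apply: cvgM; [exact: cf|exact: cg].
Qed.

HB.instance Definition _ :=
  GRing.isSubringClosed.Build (M -> C) continuous_pred continuous_subring.

Lemma continuous_scale : GRing.scaler_closed continuous_pred.
Proof.
move=> k f /continuous_predP cf; apply/continuous_predP => x.
by apply: cvgZr; exact: cf.
Qed.

HB.instance Definition _ :=
  GRing.isScaleClosed.Build C (M -> C) continuous_pred continuous_scale.

Record cfun := CFun { cfun_val : M -> C; _ : cfun_val \in continuous_pred }.
HB.instance Definition _ := [isSub for cfun_val].
HB.instance Definition _ := [Choice of cfun by <:].
HB.instance Definition _ := GRing.SubChoice_isSubComPzRing.Build
  (M -> C) continuous_pred cfun continuous_subring.
HB.instance Definition _ := 
  [SubZmodule_isSubLmodule of cfun by <:].

Lemma cfunP (f g : cfun) : (forall x, cfun_val f x = cfun_val g x) -> f = g.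
Proof. by move=> fg; apply/val_inj/funext. Qed.

Lemma conj_continuous : continuous (Num.conj : C -> C).
Proof.
move=> z; apply/(cvgrPdist_lt (Num.conj : C -> C) (F := nbhs z)) => e e0.
near=> w.
rewrite -rmorphB norm_conjC; near: w.
by apply: (iffLR (cvgrPdist_lt (id : C -> C) z (F := nbhs z))).
Unshelve. all: by end_near. Qed.

Lemma cfun_conj_subproof (f : cfun) :
  (fun x => Num.conj (cfun_val f x)) \in continuous_pred.
Proof.
apply/continuous_predP => x; apply: continuous_comp (@conj_continuous _).
by case: f => f /= /continuous_predP; exact.
Qed.

Definition cfun_conj (f : cfun) : cfun := CFun (cfun_conj_subproof f).

End ContinuousFunctions.

(* For the finite group Z_p, the algebra of all functions a : Z_p -> C(M), i.e.
   of the formal sums \sum_g a_g u_g with u_g f u_g^* = f \o theta^g, is already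
   complete for its unique C*-norm, so it is the crossed product C*-algebra.  Its
   elements, operations and *-isomorphisms do not involve the norm. *)

Section CrossedProduct.
Variables (R : realType) (p : nat) (M : Zp_space p).
Let C := complexes R.
Implicit Types (f g : cfun R M) (k l : 'Z_p).

Lemma zp_act_continuous : continuous (@zp_act p M).
Proof. by have [] := zp_homeo M. Qed.

Lemma zp_act_iterD k l (x : M) :
  iter (k + l)%R (@zp_act p M) x = iter k (@zp_act p M) (iter l (@zp_act p M) x).
Proof.
have p2 := Zp_cast (prime_gt1 (zp_prime M)).
have iterM n y : iter (n * p) (@zp_act p M) y = y.
  by elim: n => // n IH; rewrite mulSn iterD IH zp_iter.
have modE n y : iter (n %% p) (@zp_act p M) y = iter n (@zp_act p M) y.
  by rewrite [in RHS](divn_eq n p) iterD iterM.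
have -> : nat_of_ord (k + l)%R = ((k + l) %% p)%N by congr modn.
by rewrite modE iterD.
Qed.

Lemma cfun_shift_subproof k f :
  (fun x => cfun_val f (iter k (@zp_act p M) x)) \in @continuous_pred R M.
Proof.
apply/continuous_predP; case: f => f /= /continuous_predP cf.
elim: (nat_of_ord k) => [|n IH] x /=; first exact: cf.
have -> : (fun y => f (iter n.+1 (@zp_act p M) y)) =
    (fun y => f (iter n (@zp_act p M) y)) \o @zp_act p M.
  by apply/funext => y; congr (f _); exact: iterSr.
by apply: continuous_comp; [exact: zp_act_continuous|exact: IH].
Qed.

Definition cfun_shift k f : cfun R M := CFun (cfun_shift_subproof k f).

Definition crossed_product := {ffun 'Z_p -> cfun R M}.
HB.instance Definition _ := GRing.Lmodule.on crossed_product.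
Implicit Types a b c : crossed_product.

Definition cp_one : crossed_product := [ffun k => (k == 0)%:R].
Definition cp_mul a b : crossed_product :=
  [ffun k => \sum_l a l * cfun_shift l (b (k - l))].
Definition cp_star a : crossed_product :=
  [ffun k => cfun_shift k (cfun_conj (a (- k)))].

Lemma cfun_shiftM k f g :
  cfun_shift k (f * g) = cfun_shift k f * cfun_shift k g.
Proof. exact: cfunP. Qed.

Lemma cfun_shiftD k f g :
  cfun_shift k (f + g) = cfun_shift k f + cfun_shift k g.
Proof. exact: cfunP. Qed.

Lemma cfun_shift0 k : cfun_shift k 0 = 0.
Proof. exact: cfunP. Qed.

Lemma cfun_shift1 k : cfun_shift k 1 = 1.
Proof. exact: cfunP. Qed.

Lemma cfun_shiftZ k (z : C) f : cfun_shift k (z *: f) = z *: cfun_shift k f.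
Proof. exact: cfunP. Qed.

Lemma cfun_shift_id f : cfun_shift 0 f = f.
Proof. exact: cfunP. Qed.

Lemma cfun_shift_comp k l f :
  cfun_shift k (cfun_shift l f) = cfun_shift (k + l) f.
Proof.
rewrite addrC; apply: cfunP => x; congr (cfun_val f _).
by rewrite zp_act_iterD.
Qed.

Lemma cfun_shift_sum k (F : 'Z_p -> cfun R M) :
  cfun_shift k (\sum_l F l) = \sum_l cfun_shift k (F l).
Proof.
apply: (big_morph (cfun_shift k)); [exact: cfun_shiftD|exact: cfun_shift0].
Qed.

Lemma cp_mulA : associative cp_mul.
Proof.
move=> a b c; apply/ffunP => k; rewrite !ffunE.
under eq_bigr => h _.
  rewrite ffunE cfun_shift_sum mulr_sumr.
  rewrite (reindex_inj (addIr (- h))) /=.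
  under eq_bigr => l _ do rewrite cfun_shiftM cfun_shift_comp mulrA
    [h + _]addrC subrK opprB addrA subrK.
  over.
rewrite exchange_big /=; apply: eq_bigr => l _.
by rewrite ffunE mulr_suml.
Qed.

Lemma cp_mul1l : left_id cp_one cp_mul.
Proof.
move=> a; apply/ffunP => k; rewrite ffunE (bigD1 0) //= ffunE eqxx mul1r.
rewrite cfun_shift_id subr0 big1 ?addr0 // => l /negPf l0.
by rewrite ffunE l0 mul0r.
Qed.

Lemma cp_mul1r : right_id cp_one cp_mul.
Proof.
move=> a; apply/ffunP => k; rewrite ffunE (bigD1 k) //= ffunE subrr eqxx.
rewrite cfun_shift1 mulr1 big1 ?addr0 // => l.
rewrite ffunE subr_eq0 eq_sym => /negPf ->.
by rewrite cfun_shift0 mulr0.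
Qed.

Lemma cp_mulDl : left_distributive cp_mul +%R.
Proof.
move=> a b c; apply/ffunP => k; rewrite !ffunE -big_split.
by apply: eq_bigr => l _; rewrite ffunE mulrDl.
Qed.

Lemma cp_mulDr : right_distributive cp_mul +%R.
Proof.
move=> a b c; apply/ffunP => k; rewrite !ffunE -big_split.
by apply: eq_bigr => l _; rewrite ffunE cfun_shiftD mulrDr.
Qed.

HB.instance Definition _ := GRing.Zmodule_isPzRing.Build crossed_product
  cp_mulA cp_mul1l cp_mul1r cp_mulDl cp_mulDr.

Lemma cp_one_neq0 : cp_one != 0.
Proof.
have [x _] := zp_fixed M.
apply/eqP => /ffunP/(_ 0); rewrite !ffunE eqxx.
move=> /(congr1 (fun f => cfun_val f x))/eqP.
by apply/negP; exact: oner_neq0.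
Qed.

HB.instance Definition _ :=
  GRing.PzSemiRing_isNonZero.Build crossed_product cp_one_neq0.

Lemma cfunZ_mulAl (z : C) f g : z *: (f * g) = z *: f * g.
Proof. by apply: cfunP => x; exact: mulrA. Qed.

Lemma cfunZ_mulAr (z : C) f g : z *: (f * g) = f * (z *: g).
Proof. by apply: cfunP => x; exact: mulrCA. Qed.

Lemma cp_scaleAl (z : C) a b : z *: (a * b) = z *: a * b.
Proof.
apply/ffunP => k; rewrite !ffunE scaler_sumr.
by apply: eq_bigr => l _; rewrite ffunE cfunZ_mulAl.
Qed.

HB.instance Definition _ :=
  GRing.LSemiModule_isLSemiAlgebra.Build C crossed_product cp_scaleAl.

Lemma cp_scaleAr (z : C) a b : z *: (a * b) = a * (z *: b).
Proof.
apply/ffunP => k; rewrite !ffunE scaler_sumr.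
by apply: eq_bigr => l _; rewrite ffunE cfun_shiftZ cfunZ_mulAr.
Qed.

HB.instance Definition _ :=
  GRing.LSemiAlgebra_isSemiAlgebra.Build C crossed_product cp_scaleAr.

Lemma cfun_conjM f g : cfun_conj (f * g) = cfun_conj f * cfun_conj g.
Proof. by apply: cfunP => x; exact: rmorphM. Qed.

Lemma cfun_conjD f g : cfun_conj (f + g) = cfun_conj f + cfun_conj g.
Proof. by apply: cfunP => x; exact: rmorphD. Qed.

Lemma cfun_conj0 : cfun_conj (0 : cfun R M) = 0.
Proof. by apply: cfunP => x; exact: rmorph0. Qed.

Lemma cfun_conj_shift k f :
  cfun_conj (cfun_shift k f) = cfun_shift k (cfun_conj f).
Proof. exact: cfunP. Qed.

Lemma cp_starK : involutive cp_star.
Proof.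
move=> a; apply/ffunP => k; rewrite !ffunE opprK cfun_conj_shift.
rewrite cfun_shift_comp subrr cfun_shift_id.
by apply: cfunP => x; exact: conjCK.
Qed.

Lemma cp_starM a b : cp_star (a * b) = cp_star b * cp_star a.
Proof.
apply/ffunP => k; rewrite !ffunE.
rewrite (big_morph _ (@cfun_conjD) cfun_conj0) cfun_shift_sum.
rewrite (reindex_inj (addIr (- k))) /=.
apply: eq_bigr => l _; rewrite !ffunE cfun_conjM cfun_conj_shift.
rewrite cfun_shiftM !cfun_shift_comp mulrC.
rewrite [k + (l - k)]addrC [l + (k - l)]addrC !subrK opprB.
by rewrite addrA addNr sub0r opprB.
Qed.

End CrossedProduct.

Definition star_isomorphic (R : realType) (p : nat) (M M' : Zp_space p) :=
  exists2 Phi : {lrmorphism crossed_product R M -> crossed_product R M'},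
    bijective Phi & {morph Phi : a / cp_star a}.

(* Main.v *)
(* Write w = exp(2 pi i / p), M_0 for the free part and Y for its orbit space.

   Let tau be an action of Z_p on M with the same orbits as theta.  The heart of the proof is
   that there is a continuous u : M_0 -> S^1 with u (tau x) = w u x, in other words that the
   flat line bundle on Y attached to the covering M_0 -> Y is trivial.
   Since dim M <= 2, finitely many equivariant functions v_r on M_0 have no common zero
   (bumps of bounded order on a sequence of annuli exhausting M_0, recombined with Vandermonde
   coefficients).  So the bundle is the range of the rank one projection (v_r v_s^* ), which is
   bounded and thus extends to the Stone-Cech compactification.  On a compact Hausdorff space
   with H^2 = 0 every such projection has a unit section: the logarithms of the transition
   functions yield an integral Cech 2-cocycle, and splitting it turns the logarithms into a real
   1-cocycle, which a partition of unity splits.  Applied to the corona, and extended by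
   Tietze, this gives an equivariant function without zeros outside a compact subset of Y;
   that function trivializes the bundle at infinity, so that the same argument applies on the
   one-point compactification.

   In the basis of eigenvectors of the shift on l^2 of an orbit, an element a of the crossed
   product becomes a continuous function T from M to p x p matrices with
   T (theta x)_jl = w^(j-l) T(x)_jl, and every such T arises.  By equivariance T is diagonal on
   the fixed points.  If u and u' belong to theta and theta', conjugation by the diagonal matrix
   of the (u'/u)^j turns the condition for theta into that for theta' and is continuous on all
   of M. *)
Require Import Defs.
From HB Require Import structures.
From mathcomp Require Import all_boot all_order all_algebra.
From mathcomp Require Import generic_quotient complex ring lra zify finmap.
From mathcomp Require Import all_classical all_reals topology normedtype.
From mathcomp Require Import trigo realfun numfun.

Set Implicit Arguments.
Unset Strict Implicit.
Unset Printing Implicit Defensive.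

Import Order.TTheory GRing.Theory Num.Theory.
Import numFieldNormedType.Exports.

Local Open Scope classical_set_scope.
Local Open Scope ring_scope.

(** * Complex numbers and local logarithms *)

Section ComplexTopology.
Variable R : realType.
Local Notation C := (complexes R).
Implicit Types (x y : C) (a b : R).

Definition ofR a : C := (a%:C)%C.
Definition cRe (z : C) : R := complex.Re (z : R[i]).
Definition cIm (z : C) : R := complex.Im (z : R[i]).

Lemma cReD : {morph cRe : x y / x + y}. Proof. by move=> [a b] [c d]. Qed.
Lemma cImD : {morph cIm : x y / x + y}. Proof. by move=> [a b] [c d]. Qed.
Lemma cReN : {morph cRe : x / - x}. Proof. by move=> [a b]. Qed.
Lemma cImN : {morph cIm : x / - x}. Proof. by move=> [a b]. Qed.
Lemma cReM x y : cRe (x * y) = cRe x * cRe y - cIm x * cIm y.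
Proof. by case: x y => [a b] [c d]. Qed.
Lemma cImM x y : cIm (x * y) = cRe x * cIm y + cIm x * cRe y.
Proof. by case: x y => [a b] [c d]. Qed.
Lemma cReJ x : cRe (x^*) = cRe x. Proof. by case: x. Qed.
Lemma cImJ x : cIm (x^*) = - cIm x. Proof. by case: x. Qed.
Lemma cRe1 : cRe 1 = 1. Proof. by []. Qed.
Lemma cIm1 : cIm 1 = 0. Proof. by []. Qed.
Lemma complex_eq x y : cRe x = cRe y -> cIm x = cIm y -> x = y.
Proof. by case: x y => [a b] [c d] /= -> ->. Qed.

Lemma ofRD : {morph ofR : a b / a + b}.
Proof. by move=> a b; apply: complex_eq => //=; rewrite addr0. Qed.
Lemma ofRM : {morph ofR : a b / a * b}.
Proof. by move=> a b; apply: complex_eq => /=; rewrite ?(cReM, cImM) /cRe /cIm/=; ring. Qed.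
Lemma ofRJ a : (ofR a)^* = ofR a.
Proof. by apply: complex_eq => //=; rewrite oppr0. Qed.

Lemma sqr_norm x : x * x^* = ofR (cRe x ^+ 2 + cIm x ^+ 2).
Proof.
by apply: complex_eq; rewrite ?(cReM, cImM) cReJ cImJ /cRe /cIm /=; ring.
Qed.

Lemma normE x : `|x| = ofR (Num.sqrt (cRe x ^+ 2 + cIm x ^+ 2)).
Proof. exact: normc_def. Qed.

Lemma ofR_lt a b : (ofR a < ofR b) = (a < b). Proof. exact: ltcR. Qed.
Lemma ofR_le a b : (ofR a <= ofR b) = (a <= b). Proof. exact: lecR. Qed.

Lemma norm_ofR a : `|ofR a| = ofR `|a|.
Proof. by rewrite normE /cRe/cIm/= expr0n addr0 sqrtr_sqr. Qed.

Lemma norm_cRe x : ofR `|cRe x| <= `|x|.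
Proof. exact: normc_ge_Re. Qed.

Lemma norm_cIm x : ofR `|cIm x| <= `|x|.
Proof.
rewrite normE ofR_le -[leLHS]sqrtr_sqr ler_sqrt ?addr_ge0 ?sqr_ge0//.
by rewrite lerDr sqr_ge0.
Qed.

Lemma continuous_ofR : continuous ofR.
Proof.
move=> a; apply/(cvgrPdist_lt ofR (F := nbhs a)) => e.
(* In the order of [R[i]], [0 < e] forces [e] to be real, so the radius comes from [R]. *)
rewrite ltcE /= => /andP[/eqP ei e0]; near=> b.
have -> : e = ofR (complex.Re e) by apply: complex_eq.
rewrite -[- _]/(- ofR b) (_ : ofR a - ofR b = ofR (a - b)).
  rewrite norm_ofR ofR_lt; near: b.
  exact: (cvgrPdist_lt (id : R -> R) a (F := nbhs a)).1.
by apply: complex_eq => //=; rewrite subr0.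
Unshelve. all: by end_near. Qed.

Lemma continuous_cRe : continuous cRe.
Proof.
move=> z; apply/(cvgrPdist_lt cRe (F := nbhs z)) => e e0; near=> w.
rewrite -cReN -cReD -ofR_lt (le_lt_trans (norm_cRe _))//; near: w.
by apply: (cvgrPdist_lt (id : C -> C) z (F := nbhs z)).1 => //; rewrite ofR_lt.
Unshelve. all: by end_near. Qed.

Lemma continuous_cIm : continuous cIm.
Proof.
move=> z; apply/(cvgrPdist_lt cIm (F := nbhs z)) => e e0; near=> w.
rewrite -cImN -cImD -ofR_lt (le_lt_trans (norm_cIm _))//; near: w.
by apply: (cvgrPdist_lt (id : C -> C) z (F := nbhs z)).1 => //; rewrite ofR_lt.
Unshelve. all: by end_near. Qed.

Section AtPoint.
Variables (X : topologicalType) (x : X).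

Lemma cvg_ofR (f : X -> R) : f @ x --> f x -> (ofR \o f) @ x --> ofR (f x).
Proof. by move=> fx; apply: continuous_comp => //; exact: continuous_ofR. Qed.

Lemma cvg_cRe (f : X -> C) : f @ x --> f x -> (cRe \o f) @ x --> cRe (f x).
Proof. by move=> fx; apply: continuous_comp => //; exact: continuous_cRe. Qed.

Lemma cvg_cIm (f : X -> C) : f @ x --> f x -> (cIm \o f) @ x --> cIm (f x).
Proof. by move=> fx; apply: continuous_comp => //; exact: continuous_cIm. Qed.

Lemma cvg_conj (f : X -> C) : f @ x --> f x -> (fun t => (f t)^*) @ x --> (f x)^*.
Proof.
move=> fx; apply: (@continuous_comp _ _ _ f (Num.conj : C -> C) x fx).
exact: conj_continuous.
Qed.
End AtPoint.

Definition cis a : C := (cos a +i* sin a)%C.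

Lemma cisD a b : cis (a + b) = cis a * cis b.
Proof.
apply: complex_eq; rewrite ?(cReM, cImM) /cRe /cIm /= ?cosD ?sinD //.
by rewrite addrC.
Qed.

Lemma cis_unit a : cis a * (cis a)^* = 1.
Proof. by rewrite sqr_norm /cRe/cIm/= cos2Dsin2. Qed.

Lemma continuous_cis : continuous cis.
Proof.
have -> : cis = (fun a => ofR (cos a) + ofR (sin a) * (0 +i* 1)%C).
  apply/funext => a; apply: complex_eq;
  by rewrite ?(cReD, cImD, cReM, cImM) /cRe/cIm/=; ring.
move=> a; apply: cvgD.
  by apply: cvg_ofR; exact: continuous_cos.
apply: cvgM; last exact: cvg_cst.
by apply: cvg_ofR; exact: continuous_sin.
Qed.

Lemma unit_sqr x : x * x^* = 1 -> cRe x ^+ 2 + cIm x ^+ 2 = 1.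
Proof. by rewrite sqr_norm => -[]. Qed.

Lemma cis_asin x : x * x^* = 1 -> 0 < cRe x -> cis (asin (cIm x)) = x.
Proof.
move=> /unit_sqr x1 x0.
have xi : -1 <= cIm x <= 1.
  by rewrite -ler_norml -(@expr_le1 _ 2)// -normrX ger0_norm ?sqr_ge0// -x1 lerDr sqr_ge0.
apply: complex_eq; rewrite /= /cRe/cIm /=.
  rewrite cos_asin // (_ : 1 - _ = cRe x ^+ 2); last by rewrite -x1 addrK.
  by rewrite sqrtr_sqr ger0_norm ?ltW.
by rewrite asinK.
Qed.

Lemma cis_surj x : x * x^* = 1 -> exists a, cis a = x.
Proof.
move=> /unit_sqr x1.
have xi : -1 <= cRe x <= 1.
  by rewrite -ler_norml -(@expr_le1 _ 2)// -normrX ger0_norm ?sqr_ge0// -x1 lerDl sqr_ge0.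
have aux : cos (acos (cRe x)) = cRe x by rewrite acosK.
have aus : sin (acos (cRe x)) = `|cIm x|.
  by rewrite sin_acos // -x1 addrAC subrr add0r sqrtr_sqr.
have [i0|i0] := leP 0 (cIm x).
  by exists (acos (cRe x)); apply: complex_eq => //=; rewrite /cIm/= aus ger0_norm.
exists (- acos (cRe x)); apply: complex_eq; rewrite /cRe /cIm /=.
  by rewrite cosN.
by rewrite sinN aus ltr0_norm ?opprK.
Qed.

Lemma cis_int (n : int) : cis (n%:~R * (pi *+ 2)) = 1.
Proof.
have cisT : cis (pi *+ 2) = 1.
  by apply: complex_eq; rewrite /cRe/cIm/= ?cos2pi ?sin2pi.
have cisN k : cis (k%:R * (pi *+ 2)) = 1.
  elim: k => [|k IH].
    by rewrite mul0r; apply: complex_eq; rewrite /cRe/cIm/= ?cos0 ?sin0.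
  by rewrite -natr1 mulrDl cisD IH mul1r mul1r.
case: n => n; first exact: cisN.
rewrite NegzE mulrNz mulNr; apply: (mulIf (oner_neq0 C)).
by rewrite -{1}(cisN n.+1) -cisD addNr mulr1 -(cisN 0%N) mul0r.
Qed.

(** After reduction to [0 <= b < 2 pi], injectivity of the cosine on [[0, pi]] settles [b <= pi];
    for larger [b], applied to [2 pi - b], it contradicts [b < 2 pi]. *)
Lemma cis_eq1 a : cis a = 1 -> exists n : int, a = n%:~R * (pi *+ 2).
Proof.
move=> ca; pose T : R := pi *+ 2.
have T0 : 0 < T by rewrite pmulrn_lgt0// pi_gt0.
pose n := Num.floor (a / T); exists n.
have n1 : n%:~R * T <= a by rewrite -ler_pdivlMr// floor_le.
have n2 : a < n%:~R * T + T.
  by rewrite -[X in _ + X]mul1r -mulrDl -ltr_pdivrMr// -intrD1 floorD1_gt.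
pose b := a - n%:~R * T.
have : cis b = 1.
  by have := ca; rewrite -(subrK (n%:~R * T) a) cisD cis_int mulr1.
move=> [cb sb]; suff : b = 0 by move/eqP; rewrite subr_eq0 => /eqP.
have b0 : 0 <= b by rewrite subr_ge0.
have bT : b < T by rewrite ltrBlDl.
have cos_eq1 (x : R) : 0 <= x <= pi -> cos x = 1 -> x = 0.
  move=> x0 cx; apply: cos_inj; rewrite ?cos0// in_itv //=.
  by rewrite lexx pi_ge0.
have [bp|bp] := leP b pi; first by apply: cos_eq1 => //; rewrite b0.
suff : T - b = 0 by move=> h; move: bT; rewrite -subr_gt0 h ltxx.
apply: cos_eq1.
  rewrite subr_ge0 (ltW bT)/= lerBlDr /T mulr2n lerD2l; exact: ltW.
by rewrite cosB cos2pi sin2pi mul0r addr0 mul1r.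
Qed.

(* The bound 1 makes three values of [l] vary by less than 4 <= 2 pi. *)
Lemma local_log : exists2 d : R, 0 < d &
  forall (Z : topologicalType) (D : set Z) (g : Z -> C),
    (forall z, D z -> g z * (g z)^* = 1) ->
    (forall z z', D z -> D z' -> `|g z - g z'| < ofR d) ->
  exists l : Z -> R, [/\
    forall z, D z -> cis (l z) = g z,
    forall z z', D z -> D z' -> `|l z - l z'| < 1 &
    forall z, D z -> g @ z --> g z -> l @ z --> l z].
Proof.
have : {for 0, continuous (@asin R)}.
  by apply: continuous_asin; rewrite ltr01 ltrN10.
have asin0 : asin (0 : R) = 0.
  by rewrite -{1}sin0 sinK// in_itv/= oppr_le0 divr_ge0 ?pi_ge0.
move=> /(cvgrPdist_lt (@asin R) (F := nbhs 0))/(_ (1/2)).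
rewrite asin0 => /(_ _)[|e /= e0 He]; first by rewrite divr_gt0.
(* The bound [e] keeps the arcsine below 1/2, so that two logarithms differ by less than 1; the
   bound 1 keeps [h] in the right half plane, where [cis_asin] applies. *)
exists (Num.min e 1); first by rewrite lt_min e0 ltr01.
move=> Z D g g1 gd.
have [[z0 Dz0]|nD] := pselect (exists z, D z); last first.
  exists (fun=> 0); split=> [z Dz|z z' Dz|z Dz]; by exfalso; apply: nD; exists z.
have [t0 t0E] := cis_surj (g1 _ Dz0).
(* Dividing by the value at a base point moves all values of [g] on [D] close to 1. *)
pose h : Z -> C := fun z => g z * (g z0)^*.
have h1 z : D z -> h z * (h z)^* = 1.
  by move=> Dz; rewrite /h rmorphM /= mulrACA g1 // mul1r conjCK mulrC g1.
have hd z : D z -> `|h z - 1| < ofR (Num.min e 1).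
  move=> Dz; rewrite -(g1 _ Dz0) /h -mulrBl normrM.
  have -> : `|(g z0)^*| = 1.
    have /unit_sqr g2 := g1 _ Dz0.
    by rewrite normE cReJ cImJ sqrrN g2 sqrtr1.
  by rewrite mulr1 gd.
have hre z : D z -> 0 < cRe (h z).
  move=> Dz; have := le_lt_trans (norm_cRe _) (hd _ Dz).
  rewrite ofR_lt lt_min => /andP[_].
  by rewrite cReD cReN cRe1 ltr_norml ltrBrDl subrr => /andP[].
have him z : D z -> `|cIm (h z)| < e /\ `|cIm (h z)| < 1.
  move=> Dz; have := le_lt_trans (norm_cIm _) (hd _ Dz).
  by rewrite ofR_lt lt_min cImD cImN cIm1 subr0 => /andP[].
have has z : D z -> `|asin (cIm (h z))| < 1/2.
  move=> Dz; have [he _] := him _ Dz.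
  by have := He (cIm (h z)); rewrite /ball_/= !sub0r !normrN; exact.
exists (fun z => t0 + asin (cIm (h z))); split => [z Dz|z z' Dz Dz'|z Dz gz].
- rewrite cisD t0E cis_asin; [|exact: h1|exact: hre].
  by rewrite /h mulrCA g1 // mulr1.
- rewrite opprD addrACA subrr add0r (le_lt_trans (ler_normB _ _))//.
  by rewrite [ltRHS]splitr ltrD ?has.
apply: cvgD; first exact: cvg_cst.
have hz : h @ z --> h z by apply: cvgM; [exact: gz|exact: cvg_cst].
apply: (@continuous_comp _ _ _ (cIm \o h) (@asin R) z (cvg_cIm hz)).
apply: continuous_asin; have [_] := him _ Dz.
by rewrite ltr_norml.
Qed.

End ComplexTopology.

(** * Cech 2-cocycles with real logarithms *)

Lemma cvg_bigsum (K : numFieldType) (X : topologicalType) (x : X) (I : Type)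
    (r : seq I) (P : pred I) (F : I -> X -> K) :
  (forall i, P i -> F i @ x --> F i x) ->
  (fun t => \sum_(i <- r | P i) F i t) @ x --> \sum_(i <- r | P i) F i x.
Proof.
move=> Fx; elim: r => [|i r IH].
  rewrite big_nil (_ : (fun t => _) = fun=> 0); first exact: cvg_cst.
  by apply/funext => t; rewrite big_nil.
rewrite big_cons (_ : (fun t => _) = fun t =>
  if P i then F i t + \sum_(j <- r | P j) F j t else \sum_(j <- r | P j) F j t).
  by case: (boolP (P i)) => [Pi|_] //; apply: cvgD; [exact: Fx|exact: IH].
by apply/funext => t; rewrite big_cons.
Qed.

(** This serves for a bump [f] vanishing at [x]: there [g] may be discontinuous, as long as it is
    bounded where [f] is nonzero. *)
Lemma cvg_mul_bounded (R : realType) (X : topologicalType) (x : X) (A : set X)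
    (f g : X -> R) (b : R) :
  nbhs x A -> f @ x --> (0 : R) -> (forall y, A y -> f y != 0 -> `|g y| <= b) ->
  (fun y => f y * g y) @ x --> (0 : R).
Proof.
move=> xA f0 gb; apply: norm_cvg0.
have fb : (fun y => `|f y| * `|b|) @ x --> (0 : R).
  rewrite -[X in _ --> X](mul0r `|b|); apply: cvgM; last exact: cvg_cst.
  by rewrite -(@normr0 _ R); exact: cvg_norm.
apply: (squeeze_cvgr _ (cvg_cst 0) fb); near=> y.
rewrite normr_ge0 normrM /=; have [->|fy] := eqVneq (f y) 0.
  by rewrite normr0 !mul0r.
rewrite ler_wpM2l// (le_trans (gb y _ fy))//; last exact: ler_norm.
by near: y.
Unshelve. all: by end_near. Qed.

(** [compact_cover] concerns pointed spaces: a point of [A] serves as base point, and an empty [A]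
    is covered by no members at all. *)
Lemma compact_subcover (T : topologicalType) (A : set T) :
  compact A -> cover_compact A.
Proof.
move=> cA; have [[x0 _]|A0] := pselect (A !=set0); last first.
  by move=> I D f _ _; exists fset0 => // x Ax; exfalso; apply: A0; exists x.
pose T' : ptopologicalType := HB.pack T (isPointed.Build T x0).
by have : @compact T' A := cA; rewrite compact_cover.
Qed.

Section CompactCover.
Variables (R : realType) (Z : topologicalType).
Hypothesis Zc : compact [set: Z].
Hypothesis Zh : hausdorff_space Z.

(** Urysohn functions equal to 1 at one point are positive nearby, and compactness selects finitely
    many of them. They vanish outside the sets [B i], but their closed supports may be larger. *)
Lemma open_cover_bumps (W : set (set Z)) : open_cover W ->
  exists (D : seq Z) (B : Z -> set Z) (f : Z -> Z -> R), [/\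
    forall i, W (B i), forall i, continuous (f i), forall i z, 0 <= f i z,
    forall i z, f i z != 0 -> B i z & forall z, 0 < \sum_(i <- D) f i z].
Proof.
move=> [oW cW].
have /choice[B BP] : forall z : Z, exists B, W B /\ B z.
  by move=> z; have : setT z by []; rewrite -cW => -[B WB Bz]; exists B.
have sep z : @uniform_separator Z (~` B z) [set z].
  have [WB Bz] := BP z.
  apply: (@normal_separatorP R Z).1; first exact: compact_normal.
  - by apply: open_closedC; exact: oW.
  - by apply: accessible_closed_set1; exact: hausdorff_accessible.
  - by apply/disjoints_subset => x nB xz; apply: nB; rewrite xz.
pose f z : Z -> R := Urysohn (~` B z) [set z].
have fc z : continuous (f z) by exact: Urysohn_continuous.
have f01 z x : 0 <= f z x.
  have : range (f z) (f z x) by exists x.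
  by move=> /Urysohn_range/=; rewrite in_itv => /andP[].
have f0 z x : f z x != 0 -> B z x.
  apply: contra_neqP => nB.
  by apply: (@Urysohn_sub0 _ R _ _ (sep z)); exists x.
have f1 z : f z z = 1.
  by apply: (@Urysohn_sub1 _ R _ _ (sep z)); exists z.
have /(_ Z setT (fun z => f z @^-1` [set x | 0 < x])) := compact_subcover Zc.
case=> [z _|z _|D _ cD].
- by apply: open_comp => [x _|]; [exact: fc|exact: open_gt].
- by exists z => //=; rewrite f1.
exists D, B, f; split=> // [i|z]; first by case: (BP i).
have [i /= iD fi] := cD z Logic.I.
rewrite (perm_big _ (perm_to_rem iD)) big_cons ltr_pwDl// sumr_ge0//.
Qed.

End CompactCover.

Section CechSplitting.
Variables (R : realType) (Z : topologicalType) (T : R).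
Hypothesis T0 : T != 0.
Hypothesis Zc : compact [set: Z].
Hypothesis Zh : hausdorff_space Z.
Hypothesis H2 : forall c : cech_cohomology Z 2, c = 0.
Variables (U : set (set Z)) (l : set Z -> set Z -> Z -> R).
Hypothesis oU : open_cover U.
Hypothesis lc : forall A B z, U A -> U B -> A z -> B z -> l A B @ z --> l A B z.
Hypothesis lb : forall A B, U A -> U B ->
  exists b, forall z, A z -> B z -> `|l A B z| <= b.
Hypothesis ln : forall A B C, U A -> U B -> U C ->
  exists n : int, forall z, A z -> B z -> C z ->
    l A B z + l B C z - l A C z = n%:~R * T.

(** The Cech coboundary of [l / T] is an integral 2-cocycle on [U]. Its class vanishes by [H2], so
    it becomes a coboundary on some refinement. *)
Lemma cech_integral_cocycle : exists n : set Z -> set Z -> set Z -> int,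
  (forall A B C z, U A -> U B -> U C -> A z -> B z -> C z ->
    l A B z + l B C z - l A C z = (n A B C)%:~R * T) /\
  exists W r (e : set Z -> set Z -> int), [/\ open_cover W, refining W U r &
    forall A B C z, W A -> W B -> W C -> A z -> B z -> C z ->
      n (r A) (r B) (r C) = e B C - e A C + e A B].
Proof.
have /choice[n nP] : forall ABC : set Z * set Z * set Z, exists n : int,
    U ABC.1.1 -> U ABC.1.2 -> U ABC.2 ->
    forall z, ABC.1.1 z -> ABC.1.2 z -> ABC.2 z ->
    l ABC.1.1 ABC.1.2 z + l ABC.1.2 ABC.2 z - l ABC.1.1 ABC.2 z = n%:~R * T.
  move=> [[A B] C] /=; case: (pselect (U A /\ U B /\ U C)) => [[UA [UB UC]]|nU].
    by have [n nP] := ln UA UB UC; exists n.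
  by exists 0 => UA UB UC; exfalso; apply: nU.
have {}nP A B C z : U A -> U B -> U C -> A z -> B z -> C z ->
    l A B z + l B C z - l A C z = (n (A, B, C))%:~R * T.
  by move=> UA UB UC; apply: (nP (A, B, C)).
exists (fun A B C => n (A, B, C)); split=> //.
pose c s : int := if s is [:: A; B; C] then n (A, B, C) else 0.
have cc s : size s = 4 -> nerve U s -> coboundary c s = 0.
  case: s => [//|A [//|B [//|C [//|D [|//]]]]] _ [sU [z sz]].
  rewrite !coboundary_cons coboundary_nil /= /c.
  have [UA Az] : U A /\ A z by split; [apply: sU|apply: sz]; rewrite !inE eqxx.
  have [UB Bz] : U B /\ B z.
    by split; [apply: sU|apply: sz]; rewrite !inE eqxx ?orbT.
  have [UC Cz] : U C /\ C z.
    by split; [apply: sU|apply: sz]; rewrite !inE eqxx ?orbT.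
  have [UD Dz] : U D /\ D z.
    by split; [apply: sU|apply: sz]; rewrite !inE eqxx ?orbT.
  (* The cocycle identity is checked in [R] at the common point [z], where the values of [l]
     cancel. *)
  apply: (@intr_inj R); apply: (mulIf T0).
  rewrite !rmorphB /= rmorph0 !mulrBl -!(nP _ _ _ z)//.
  by ring.
pose a := @CechCocycle Z 2 U c oU cc.
have /cech_piP[W [r [q [oW rP qP [e _ eP]]]]] :
    \pi_(cech_cohomology Z 2)%qT a = \pi_(cech_cohomology Z 2)%qT (cech_zero Z 2).
  by rewrite (H2 (\pi_(cech_cohomology Z 2)%qT a)).
exists W, r, (fun A B => e [:: A; B]); split=> // A B C z WA WB WC Az Bz Cz.
have sN : nerve W [:: A; B; C].
  split=> [X|]; first by rewrite !inE => /or3P[] /eqP ->.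
  by exists z => X; rewrite !inE => /or3P[] /eqP ->.
have := eP [:: A; B; C] erefl sN; rewrite /= subr0 => ->.
by rewrite !coboundary_cons !coboundary_nil /=; ring.
Qed.

(** Removing the integers [e] from [l / T] leaves a real 1-cocycle, which the bumps split; [m] is
    the integer removed. *)
Lemma cech_splitting : exists W r (t : set Z -> Z -> R),
  [/\ open_cover W, refining W U r,
    forall A z, W A -> A z -> t A @ z --> t A z &
    forall A B z, W A -> W B -> A z -> B z ->
      exists m : int, l (r A) (r B) z = t A z - t B z + m%:~R * T].
Proof.
have [n [nP [W [r [e [oW rP eP]]]]]] := cech_integral_cocycle.
have [D [B [f [WB fc f0 fB fD]]]] := open_cover_bumps R Zc Zh oW.
have rU A : W A -> U (r A) by case/rP.
have rs A z : W A -> A z -> r A z by move=> /rP[_]; apply.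
pose k A C z := l (r A) (r C) z - (e A C)%:~R * T.
(* Averaging the additive functions [k A B] over [B]. *)
pose t A z := (\sum_(i <- D) f i z * k A (B i) z) / \sum_(i <- D) f i z.
exists W, r, t; split=> // [A z WA Az|A C z WA WC Az Cz].
  apply: cvgM; last first.
    apply: cvgV; first by rewrite gt_eqF.
    by apply: cvg_bigsum => i _; exact: fc.
  apply: cvg_bigsum => i _.
  (* If [f i] vanishes at [z], then [z] may lie outside [B i], where continuity of [l] is not known;
     the bound [lb] on overlaps takes its place. *)
  have [fi0|fi] := eqVneq (f i z) 0; last first.
    apply: cvgM; first exact: fc.
    apply: cvgB; last exact: cvg_cst.
    by apply: lc; [exact: rU|exact/rU/WB|exact: rs|apply: rs => //; exact: fB].
  have [b' lb'] := lb (rU _ WA) (rU _ (WB i)).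
  rewrite fi0 mul0r; apply: (@cvg_mul_bounded _ _ _ A _ _ (b' + `|(e A (B i))%:~R * T|)).
  - by apply: open_nbhs_nbhs; split=> //; exact: oW.1.
  - by rewrite -fi0; exact: fc.
  move=> y Ay fy; rewrite (le_trans (ler_normB _ _))// lerD2r lb' //.
    exact: rs.
  by apply: rs => //; exact: fB.
exists (e A C); have s0 := fD z; have {}s0 : \sum_(i <- D) f i z != 0 by rewrite gt_eqF.
rewrite /t -mulrBl -sumrB.
(* By the cocycle identity, [k A (B i) - k C (B i)] equals [k A C] wherever [f i] is nonzero. *)
have -> : \sum_(i <- D) (f i z * k A (B i) z - f i z * k C (B i) z) =
    \sum_(i <- D) f i z * (l (r A) (r C) z - (e A C)%:~R * T).
  apply: eq_bigr => i _; rewrite -mulrBr.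
  have [->|/fB Bz] := eqVneq (f i z) 0; first by rewrite !mul0r.
  congr (_ * _); rewrite /k.
  have Wi := WB i.
  have := nP _ _ _ z (rU _ WA) (rU _ WC) (rU _ Wi)
    (rs _ _ WA Az) (rs _ _ WC Cz) (rs _ _ Wi Bz).
  rewrite (eP _ _ _ z)// intrD intrB => h.
  by lra.
by rewrite -mulr_suml mulrAC divff// mul1r subrK.
Qed.

End CechSplitting.

(** * Rank one projections *)

Lemma cvg_eq_near (X Y : topologicalType) (x : X) (A : set X) (f g : X -> Y) :
  nbhs x A -> (forall y, A y -> f y = g y) -> g @ x --> g x -> f @ x --> f x.
Proof.
move=> xA fg gx; rewrite (fg x (nbhs_singleton xA)).
apply: cvg_trans gx; apply: near_eq_cvg.
by apply: filterS xA => y /fg.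
Qed.

Section RankOne.
Variables (R : realType) (Z : topologicalType) (m : nat).
Local Notation C := (complexes R).

(** Vanishing of all 2 by 2 minors and trace one make a Hermitian matrix a rank one projection. In
    this form the conditions are identities between entries, which pass to limits. *)
Definition rank_one (P : 'I_m -> 'I_m -> Z -> C) := [/\
  forall r s, continuous (P r s), forall r s z, (P r s z)^* = P s r z,
  forall r s t u z, P r s z * P t u z = P r u z * P t s z &
  forall z, \sum_r P r r z = 1].

Variable P : 'I_m -> 'I_m -> Z -> C.
Hypothesis rkP : rank_one P.

Let Pc : forall r s, continuous (P r s). Proof. by case: rkP. Qed.
Let PJ : forall r s z, (P r s z)^* = P s r z. Proof. by case: rkP. Qed.
Let PP : forall r s t u z, P r s z * P t u z = P r u z * P t s z.
Proof. by case: rkP. Qed.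
Let P1 : forall z, \sum_r P r r z = 1. Proof. by case: rkP. Qed.

(* [f] is a unit section over [A] of the line bundle given by the ranges of [P]. *)
Definition frame_on (A : set Z) (f : 'I_m -> Z -> C) :=
  (forall r z, A z -> f r @ z --> f r z) /\
  (forall r s z, A z -> f r z * (f s z)^* = P r s z).

Lemma frame_le1 A f r z : frame_on A f -> A z -> `|f r z| <= 1.
Proof.
move=> [_ fP] Az; rewrite -(@expr_le1 _ 2)// normCK fP // -(P1 z) (bigD1 r) //=.
by rewrite lerDl sumr_ge0 // => s _; rewrite -fP // mul_conjC_ge0.
Qed.

(** As the trace is 1, some [P r r] is nonzero at [z0]; near [z0] the [r]-th column divided by the
    square root of [P r r] is a unit section. Continuity makes its oscillation small. *)
Lemma frame_near d z0 : 0 < d -> exists A f, [/\ open A, A z0, frame_on A f &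
  forall r z z', A z -> A z' -> `|f r z - f r z'| < ofR d].
Proof.
move=> d0.
have [r rz0] : exists r, P r r z0 != 0.
  apply/existsP; rewrite -negb_forall; apply/negP => /forallP P0.
  have := P1 z0; rewrite big1 => [/eqP|r _]; first by rewrite eq_sym oner_eq0.
  exact/eqP.
pose q z := cRe (P r r z).
have qE z : P r r z = ofR (q z).
  apply: complex_eq => //.
  by have := congr1 (@cIm R) (PJ r r z); rewrite cImJ /cIm/=; lra.
have q0 : 0 < q z0.
  rewrite -ofR_lt -qE lt0r rz0 /=.
  (* By the trace and the minors, [P r r] is the sum over [s] of the squared moduli of [P r s]. *)
  rewrite -[leRHS]mulr1 -(P1 z0) mulr_sumr sumr_ge0 // => s _.
  by rewrite PP -PJ mulrC mul_conjC_ge0.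
pose f s z : C := P s r z / ofR (Num.sqrt (q z)).
pose A0 := [set z | 0 < q z].
have qc : continuous q by move=> z; apply: cvg_cRe; exact: Pc.
have sq0 z : A0 z -> ofR (Num.sqrt (q z)) != 0.
  by move=> z0'; rewrite gt_eqF // ofR_lt sqrtr_gt0.
have fF : frame_on A0 f.
  split=> [s z Az|s t z Az].
    apply: cvgM; first exact: Pc.
    apply: cvgV; first exact: sq0.
    apply: (@cvg_ofR _ _ z (fun z => Num.sqrt (q z))).
    by apply: (@continuous_comp _ _ _ q Num.sqrt z (qc z)); exact: sqrt_continuous.
  rewrite /f rmorphM fmorphV /= ofRJ PJ mulrACA PP -invfM -ofRM.
  have -> : Num.sqrt (q z) * Num.sqrt (q z) = q z.
    by rewrite -expr2 sqr_sqrtr // ltW.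
  by rewrite -qE mulfK // qE gt_eqF // ofR_lt.
have d2 : 0 < ofR (d / 2) by rewrite ofR_lt divr_gt0.
have : nbhs z0 (A0 `&` [set z | forall s, `|f s z0 - f s z| < ofR (d / 2)]).
  apply: filterI; first by apply: (@cvgr_gt _ _ _ _ q (q z0)) => //; exact: qc.
  apply: filter_forall => s.
  apply: (@cvgr_dist_lt _ _ _ _ _ (f s) (f s z0)) => //.
  by case: fF => fc _; exact: fc.
rewrite nbhsE => -[A [oA Az0] Asub]; exists A, f; split=> //.
  by split=> [s z /Asub[Az _]|s t z /Asub[Az _]]; [exact: fF.1|exact: fF.2].
move=> s z z' /Asub[_ /(_ s) h] /Asub[_ /(_ s) h'].
have -> : ofR d = ofR (d / 2) + ofR (d / 2) by rewrite -ofRD -splitr.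
rewrite (_ : f s z - f s z' = (f s z0 - f s z') - (f s z0 - f s z)).
  by rewrite (le_lt_trans (ler_normB _ _)) // ltrD.
by rewrite opprB [RHS]addrC addrA subrK.
Qed.

(** The transition function between two unit sections, written as their scalar product. *)
Definition frame_ratio (f g : 'I_m -> Z -> C) z : C :=
  \sum_r f r z * (g r z)^*.

Lemma frame_ratioE A B f g r z : frame_on A f -> frame_on B g -> A z -> B z ->
  f r z = frame_ratio f g z * g r z.
Proof.
move=> [_ fP] [_ gP] Az Bz; rewrite mulr_suml.
under eq_bigr => s _.
  rewrite -mulrA [_^* * _]mulrC gP // -(fP r s) // mulrCA fP //.
  over.
by rewrite -mulr_sumr P1 mulr1.
Qed.

Lemma frame_ratio_unit A B f g z : frame_on A f -> frame_on B g -> A z -> B z ->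
  frame_ratio f g z * (frame_ratio f g z)^* = 1.
Proof.
move=> fF gF Az Bz; rewrite {1}/frame_ratio mulr_suml -[RHS](P1 z).
apply: eq_bigr => r _; case: (fF) => [_ <-] //.
by rewrite {3}(frame_ratioE r fF gF Az Bz) rmorphM -mulrA [_^* * _]mulrC.
Qed.

Lemma frame_ratio_comp A B D f g h z :
  frame_on A f -> frame_on B g -> frame_on D h -> A z -> B z -> D z ->
  frame_ratio f g z * frame_ratio g h z = frame_ratio f h z.
Proof.
move=> fF gF hF Az Bz Dz; rewrite {2}/frame_ratio mulr_sumr.
by apply: eq_bigr => r _; rewrite (frame_ratioE r fF gF Az Bz) mulrA.
Qed.

Lemma frame_ratio_cvg A B f g z : frame_on A f -> frame_on B g -> A z -> B z ->
  frame_ratio f g @ z --> frame_ratio f g z.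
Proof.
move=> fF gF Az Bz; apply: cvg_bigsum => r _.
apply: cvgM; first exact: fF.1.
by apply: cvg_conj; exact: gF.1 Bz.
Qed.

Lemma frame_ratio_dist d A B f g z z' : frame_on A f -> frame_on B g ->
  (forall r z z', A z -> A z' -> `|f r z - f r z'| < ofR d) ->
  (forall r z z', B z -> B z' -> `|g r z - g r z'| < ofR d) ->
  A z -> B z -> A z' -> B z' ->
  `|frame_ratio f g z - frame_ratio f g z'| <= (ofR d *+ 2) *+ m.
Proof.
move=> fF gF fd gd Az Bz Az' Bz'; rewrite -sumrB.
rewrite (le_trans (ler_norm_sum _ _ _)) // -[X in _ <= _ *+ X]card_ord.
rewrite -sumr_const ler_sum // => r _.
rewrite (_ : _ - _ = (f r z - f r z') * (g r z)^* + f r z' * (g r z - g r z')^*).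
  rewrite mulr2n (le_trans (ler_normD _ _)) // !normrM !norm_conjC lerD //.
    rewrite -[leRHS]mulr1 ler_pM // ?(frame_le1 _ gF) //.
    exact/ltW/fd.
  rewrite -[leRHS]mul1r ler_pM // ?(frame_le1 _ fF) //.
  exact/ltW/gd.
by rewrite rmorphB /= mulrBl mulrBr addrA subrK.
Qed.

Hypothesis Zc : compact [set: Z].
Hypothesis Zh : hausdorff_space Z.
Hypothesis H2 : forall c : cech_cohomology Z 2, c = 0.

(** The unit sections [S A] over small sets have transition functions [cis (l (A, B))]. Splitting
    [l] modulo [2 pi] by functions [t A] makes the products [cis (- t A) * S (r A)] agree on
    overlaps. *)
Lemma rank_one_section : exists f, frame_on setT f.
Proof.
have [d d0 dlog] := local_log R.
(* By [frame_ratio_dist] a transition function varies by at most [2 m d']; [m.+1] makes this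
   strictly less than [d], also for [m = 0]. *)
pose d' := d / (2 * m.+1%:R).
have d'0 : 0 < d' by rewrite divr_gt0 // mulr_gt0.
pose small A f := [/\ open A, frame_on A f &
  forall r z z', A z -> A z' -> `|f r z - f r z'| < ofR d'].
pose U := [set A | exists f, small A f].
have /choice[S SP] : forall A, exists f, U A -> small A f.
  move=> A; have [[f fA]|nA] := pselect (U A); first by exists f.
  by exists (fun _ _ => 0).
have SF A : U A -> frame_on A (S A) by case/SP.
have oU : open_cover U.
  split=> [A [f []//]|]; rewrite -subTset => z _.
  have [A [f [oA Az fF fd]]] := frame_near z d'0.
  by exists A => //; exists f.
pose g A B := frame_ratio (S A) (S B).
have /choice[l lP] : forall AB : set Z * set Z, exists l : Z -> R,
    U AB.1 -> U AB.2 -> [/\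
    forall z, AB.1 z -> AB.2 z -> cis (l z) = g AB.1 AB.2 z,
    forall z z', (AB.1 `&` AB.2) z -> (AB.1 `&` AB.2) z' -> `|l z - l z'| < 1 &
    forall z, AB.1 z -> AB.2 z -> l @ z --> l z].
  move=> [A B] /=; have [[UA UB]|nU] := pselect (U A /\ U B); last first.
    by exists (fun=> 0) => UA UB; exfalso; apply: nU.
  have [|z z' [Az Bz] [Az' Bz']|l [l1 l2 l3]] := dlog Z (A `&` B) (g A B).
  - by move=> z [Az Bz]; apply: frame_ratio_unit Az Bz; exact: SF.
  - have [_ _ dA] := SP _ UA; have [_ _ dB] := SP _ UB.
    apply: le_lt_trans (frame_ratio_dist (SF _ UA) (SF _ UB) dA dB Az Bz Az' Bz') _.
    rewrite -mulrnA (_ : _ *+ _ = ofR (d' *+ (2 * m))).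
      rewrite ofR_lt -mulr_natr natrM /d' mulrAC ltr_pdivrMr ?mulr_gt0 //.
      by rewrite ltr_pM2l // ltr_pM2l // ltr_nat.
    by elim: (2 * m)%N => [|k IH]; rewrite ?mulr0n // !mulrS ofRD IH.
  exists l => _ _; split=> // z Az Bz; first exact: l1.
  by apply: l3 => //; apply: frame_ratio_cvg Az Bz; exact: SF.
pose T : R := pi *+ 2.
have T0 : 0 < T by rewrite pmulrn_lgt0 // pi_gt0.
have T4 : 3 < T by rewrite /T mulr2n; have := pi_ge2 R; lra.
(* Triple overlaps need not be connected. At each point the defect is an integral multiple of [T],
   and it varies by less than [3 < T], so it is constant. *)
have ln A B D : U A -> U B -> U D -> exists n : int, forall z, A z -> B z -> D z ->
    l (A, B) z + l (B, D) z - l (A, D) z = n%:~R * T.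
  move=> UA UB UD; have [ab abd _] := lP (A, B) UA UB.
  have [bd bdd _] := lP (B, D) UB UD; have [ad add _] := lP (A, D) UA UD.
  have ex z : A z -> B z -> D z -> exists n : int,
      l (A, B) z + l (B, D) z - l (A, D) z = n%:~R * T.
    move=> Az Bz Dz; apply: cis_eq1.
    have h := frame_ratio_comp (SF _ UA) (SF _ UB) (SF _ UD) Az Bz Dz.
    have /= E1 := ab z Az Bz; have /= E2 := bd z Bz Dz; have /= E3 := ad z Az Dz.
    apply: (mulIf (x := cis (l (A, D) z))).
      apply/eqP => c0; have := cis_unit (l (A, D) z).
      by rewrite c0 mul0r => /eqP; rewrite eq_sym oner_eq0.
    by rewrite -cisD subrK cisD mul1r E1 E2 E3.
  have [[z0 [[Az0 Bz0] Dz0]]|nABD] := pselect ((A `&` B `&` D) !=set0); last first.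
    by exists 0 => z Az Bz Dz; exfalso; apply: nABD; exists z.
  have [n nE] := ex _ Az0 Bz0 Dz0; exists n => z Az Bz Dz.
  have [k kE] := ex _ Az Bz Dz; rewrite kE; congr (_%:~R * _).
  have /ltr_normlP/=[h1 h1'] := abd z z0 (conj Az Bz) (conj Az0 Bz0).
  have /ltr_normlP/=[h2 h2'] := bdd z z0 (conj Bz Dz) (conj Bz0 Dz0).
  have /ltr_normlP/=[h3 h3'] := add z z0 (conj Az Dz) (conj Az0 Dz0).
  have : `|(k - n)%:~R * T| < T.
    by rewrite intrB mulrBl -kE -nE ltr_norml; apply/andP; split; lra.
  rewrite normrM (gtr0_norm T0) gtr_pMl // -intr_norm -[X in _ < X]/(1%:~R) ltr_int.
  by move=> kn; clear -kn; lia.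
have [||W [r [t [oW rP tc tE]]]] := @cech_splitting R Z T (lt0r_neq0 T0) Zc Zh H2
    U (fun A B => l (A, B)) oU _ _ ln.
- by move=> A B z UA UB Az Bz; have [_ _] := lP (A, B) UA UB; exact.
- move=> A B UA UB; have [_ ld _] := lP (A, B) UA UB.
  have [[z0 ABz0]|nAB] := pselect ((A `&` B) !=set0); last first.
    by exists 0 => z Az Bz; exfalso; apply: nAB; exists z.
  exists (`|l (A, B) z0| + 1) => z Az Bz.
  rewrite -[l _ z](subrK (l (A, B) z0)) (le_trans (ler_normD _ _)) // addrC lerD2l.
  by apply/ltW/ld.
have /choice[pA pAP] : forall z : Z, exists A, W A /\ A z.
  by move=> z; have : setT z by []; rewrite -oW.2 => -[A WA Az]; exists A.
pose f A s z : C := cis (- t A z) * S (r A) s z.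
have rU A : W A -> U (r A) by case/rP.
have rs A z : W A -> A z -> r A z by move=> /rP[_]; apply.
have fE A B s z : W A -> W B -> A z -> B z -> f A s z = f B s z.
  move=> WA WB Az Bz; rewrite /f.
  have [k kE] := tE _ _ _ WA WB Az Bz.
  have [/= ab _ _] := lP (r A, r B) (rU _ WA) (rU _ WB).
  have gE := ab z (rs _ _ WA Az) (rs _ _ WB Bz).
  rewrite (frame_ratioE s (SF _ (rU _ WA)) (SF _ (rU _ WB)) (rs _ _ WA Az) (rs _ _ WB Bz)).
  rewrite -[frame_ratio _ _ _]gE kE cisD cis_int mulr1 mulrA -cisD.
  by rewrite addrA addNr add0r.
exists (fun s z => f (pA z) s z); split=> [s z _|s s' z _]; last first.
  have [Wz Az] := pAP z.
  rewrite /f rmorphM mulrACA cis_unit mul1r.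
  by apply: (SF _ (rU _ Wz)).2; exact: rs.
have [Wz Az] := pAP z.
apply: (@cvg_eq_near _ _ z (pA z) _ (f (pA z) s)).
- by apply: open_nbhs_nbhs; split=> //; exact: oW.1.
- by move=> y Ay; have [Wy Ay'] := pAP y; exact: fE.
apply: cvgM; last by apply: (SF _ (rU _ Wz)).1; exact: rs.
apply: (@continuous_comp _ _ _ (fun z' => - t (pA z) z') (@cis R) z); last exact: continuous_cis.
by apply: cvgN; exact: tc.
Qed.

End RankOne.

(** * Functions on the free part *)

Section Cozero.
Variables (R : realType) (X : topologicalType).
Hypothesis Xc : compact [set: X].
Hypothesis Xh : hausdorff_space X.
Hypothesis Xs : @second_countable X.

(** The weights [1 / (n + 1)] make all but finitely many terms at most [e], so continuity of the
    supremum involves finitely many [f n] at a time. *)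
Lemma continuous_weighted_sup (f : nat -> X -> R) :
  (forall n, continuous (f n)) -> (forall n x, 0 <= f n x <= 1) ->
  exists phi : X -> R, [/\ continuous phi, forall x, 0 <= phi x <= 1 &
    forall x, (0 < phi x) <-> exists n, 0 < f n x].
Proof.
move=> fc f01; pose a n x : R := f n x / n.+1%:R.
have n0 n : 0 < (n.+1%:R : R) by [].
have a0 n x : 0 <= a n x by have /andP[? _] := f01 n x; rewrite divr_ge0.
have an n x : a n x <= n.+1%:R^-1.
  by have /andP[_ ?] := f01 n x; rewrite /a ler_piMl // invr_ge0.
have a1 n x : a n x <= 1.
  by rewrite (le_trans (an n x)) // invf_le1 // ler1n.
pose S x := [set a n x | n in [set: nat]].
have Sne x : S x !=set0 by exists (a 0%N x), 0%N.
have Sub x : ubound (S x) 1 by move=> _ [n _ <-].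
have supS x : has_sup (S x) by split=> //; exists 1.
have le_phi n x : a n x <= sup (S x) by apply: sup_upper_bound => //; exists n.
have phi_le x b : (forall n, a n x <= b) -> sup (S x) <= b.
  by move=> h; apply: ge_sup => // _ [n _ <-].
have phi0 x : 0 <= sup (S x) by exact: le_trans (a0 0%N x) (le_phi _ _).
exists (fun x => sup (S x)); split=> [x|x|x].
- apply/(cvgrPdist_le (fun x => sup (S x)) (F := nbhs x)) => e e0.
  have [N Ne] : exists N : nat, forall n y, (N <= n)%N -> a n y <= e.
    exists (Num.truncn e^-1) => n y Nn; rewrite (le_trans (an n y)) //.
    rewrite invf_ple ?posrE // ltW // (lt_le_trans (truncnS_gt _)) //.
    by rewrite ler_nat.
  have : \forall y \near x, forall n : 'I_N, `|a n x - a n y| <= e.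
    apply: filter_forall => n.
    apply: (@cvgr_dist_le _ _ _ _ _ (a n) (a n x)) => //.
    by apply: cvgM; [exact: fc|exact: cvg_cst].
  apply: filterS => y hy.
  have h n : a n x <= a n y + e /\ a n y <= a n x + e.
    have [nN|Nn] := ltnP n N.
      by have := hy (Ordinal nN); rewrite ler_norml /= => /andP[]; split; lra.
    by split; apply: ler_wpDl => //; exact: Ne.
  have h1 : sup (S y) <= sup (S x) + e.
    by apply: phi_le => n; rewrite (le_trans (h n).2) // lerD2r.
  have h2 : sup (S x) <= sup (S y) + e.
    by apply: phi_le => n; rewrite (le_trans (h n).1) // lerD2r.
  by rewrite ler_norml; apply/andP; split; lra.
- by rewrite phi0 phi_le.
split=> [px|[n fn]]; last first.
  by apply: lt_le_trans (le_phi n x); rewrite divr_gt0.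
apply: contrapT => nf; suff : sup (S x) <= 0 by rewrite leNgt px.
apply: phi_le => n; rewrite /a pmulr_lle0 ?invr_gt0 // leNgt; apply/negP => fn.
by apply: nf; exists n.
Qed.

(** By regularity [V] is a countable union of basic sets whose closures it contains; the Urysohn
    functions of these closures are combined into one. *)
Lemma open_cozero (V : set X) : open V -> exists phi : X -> R,
  [/\ continuous phi, forall x, 0 <= phi x <= 1 & forall x, (0 < phi x) <-> V x].
Proof.
move=> oV; have [B /countable_injP[k kinj] [oB Bnbhs]] := Xs.
(* The index [n] stands for the basic set with code [n]; if there is none with closure inside [V],
   then [f n] is zero. *)
have /choice[f fP] : forall n, exists f : X -> R,
    [/\ continuous f, forall x, 0 <= f x <= 1, forall x, ~ V x -> f x = 0 &
        forall b x, B b -> k b = n -> closure b `<=` V -> b x -> f x = 1].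
  move=> n; have [[b [Bb kb bV]]|nb] :=
      pselect (exists b, [/\ B b, k b = n & closure b `<=` V]); last first.
    exists (fun=> 0); split=> //; first by move=> x; exact: cvg_cst.
      by move=> x; rewrite lexx ler01.
    by move=> b x Bb kb bV; exfalso; apply: nb; exists b.
  have sep : @uniform_separator X (~` V) (closure b).
    apply: (@normal_separatorP R X).1; first exact: compact_normal.
    - exact: open_closedC.
    - exact: closed_closure.
    - by apply/disjoints_subset => x Vx /bV.
  exists (Urysohn (~` V) (closure b)); split.
  - exact: Urysohn_continuous.
  - move=> x.
    have : range (Urysohn (~` V) (closure b) : X -> R) (Urysohn (~` V) (closure b) x).
      by exists x.
    by move=> /Urysohn_range/=; rewrite in_itv.
  - by move=> x Vx; apply: (@Urysohn_sub0 _ R _ _ sep); exists x.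
  - move=> b' x Bb' kb' _ bx; apply: (@Urysohn_sub1 _ R _ _ sep); exists x => //.
    apply: subset_closure; rewrite (_ : b = b') //.
    by apply: kinj; rewrite ?inE // kb kb'.
have fc n : continuous (f n) by case: (fP n).
have f01 n x : 0 <= f n x <= 1 by case: (fP n) => _ h _ _; exact: h.
have [phi [phic phi01 phiP]] := continuous_weighted_sup fc f01.
exists phi; split=> // x; rewrite phiP; split=> [[n fn]|Vx].
  apply: contrapT => nV; have [_ _ f0 _] := fP n.
  by move: fn; rewrite f0 // ltxx.
have [C xC CV] : exists2 C, nbhs x C & closure C `<=` V.
  by apply: (@compact_regular X x setT Xh Xc filterT V); exact: open_nbhs_nbhs.
have [b /= [Bb bx] bC] := Bnbhs x C xC.
exists (k b); have [_ _ _ f1] := fP (k b).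
by rewrite (f1 b) //; apply: subset_trans CV; exact: closureS.
Qed.
End Cozero.

Lemma size_card_le (T : choiceType) (A : set T) (n : nat) (s : seq T) :
  (A #<= `I_n)%card -> uniq s -> (forall x, x \in s -> A x) -> (size s <= n)%N.
Proof.
move=> An us sA; apply: leq_trans (geq_card_fset_set An).
apply: uniq_leq_size => // x xs; rewrite in_fset_set ?inE; first exact: sA.
by apply/finite_set_leP; exists n.
Qed.

(* If more moments vanish than there are nonzero terms, evaluate them on a
   polynomial killing all nonzero terms but one. *)
Lemma vandermonde_support (F : fieldType) (I : eqType) (s : seq I) (c a : I -> F)
    (m : nat) : uniq s -> {in s &, injective c} ->
  (count (fun i => a i != 0%R) s <= m)%N ->
  (forall r, (r < m)%N -> \sum_(i <- s) c i ^+ r * a i = 0) ->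
  forall i, i \in s -> a i = 0.
Proof.
move=> us cinj am mom i0 i0s; apply/eqP/negPn/negP => ai0.
pose t := [seq i <- rem i0 s | a i != 0].
pose P := \prod_(j <- t) ('X - (c j)%:P).
have sP : (size P <= m)%N.
  rewrite size_prod_XsubC size_filter.
  have /permP/(_ (fun i => a i != 0)) /= := perm_to_rem i0s.
  by rewrite ai0 /= add1n => <-.
have : \sum_(i <- s) P.[c i] * a i = 0.
  under eq_bigr => i _ do rewrite (horner_coef_wide _ sP) mulr_suml.
  rewrite exchange_big big1 //= => r _.
  under eq_bigr => i _ do rewrite -mulrA.
  by rewrite -mulr_sumr mom ?mulr0.
rewrite (perm_big _ (perm_to_rem i0s)) big_cons /=.
have -> : \sum_(i <- rem i0 s) P.[c i] * a i = 0.
  rewrite big_seq big1 // => i ir; have [->|ai] := eqVneq (a i) 0.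
    by rewrite mulr0.
  have : i \in t by rewrite mem_filter ai.
  by move=> it; rewrite horner_prod (big_rem i it) /= hornerXsubC subrr !mul0r.
rewrite addr0 => /eqP; rewrite mulf_eq0 (negPf ai0) orbF horner_prod.
rewrite prodf_seq_eq0 => /hasP[j]; rewrite mem_filter => /andP[aj jr] /=.
rewrite hornerXsubC subr_eq0 => /eqP cij.
have ji : i0 = j := cinj _ _ i0s (mem_rem jr) cij.
by move: jr; rewrite -ji mem_rem_uniq // !inE eqxx.
Qed.

Lemma hausdorff_sep (T : topologicalType) (x y : T) : hausdorff_space T ->
  x <> y -> exists A B, [/\ open A, open B, A x, B y & forall z, A z -> ~ B z].
Proof.
rewrite open_hausdorff => + /eqP xy => /(_ _ _ xy)[[A B]] /=.
rewrite !inE => -[Ax By] [oA oB AB]; exists A, B; split=> // z Az Bz.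
by have : (A `&` B) z by []; rewrite AB.
Qed.

(** This expresses being fixed through orbits alone, so that it can be compared between maps with
    the same orbits. *)
Lemma iter_orbit_fixed (T : Type) (s : T -> T) (p : nat) (x : T) : (1 < p)%N ->
  [set iter k s x | k in `I_p] = [set x] <-> s x = x.
Proof.
move=> p1; split=> [sx|sx].
  have : [set iter k s x | k in `I_p] (s x) by exists 1%N.
  by rewrite sx.
apply/seteqP; split=> [_ [k _ <-]|_ ->].
  by elim: k => //= k ->.
by exists 0%N => //; exact: ltnW.
Qed.

(** * Free orbits of a map of prime period *)

Section PeriodicMap.
Variables (p : nat) (T : Type) (tau : T -> T).
Hypothesis p_prime : prime p.
Hypothesis tau_p : iter p tau =1 id.

Lemma iter_period_mul n x : iter (n * p) tau x = x.
Proof. by elim: n => // n IH; rewrite mulSn iterD IH tau_p. Qed.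

Lemma tau_inj : injective tau.
Proof.
move=> x y xy; rewrite -(tau_p x) -(tau_p y) -(prednK (prime_gt0 p_prime)).
by rewrite !iterSr xy.
Qed.

(** By Bezout some multiple of [k] is 1 modulo [p], so a point fixed by the [k]-th iterate is fixed
    by [tau]. *)
Lemma iter_free k x : tau x <> x -> (0 < k < p)%N -> iter k tau x <> x.
Proof.
move=> tx /andP[k0 kp] kx; apply: tx.
have kcop : gcdn k p = 1%N.
  apply/eqP; rewrite -/(coprime k p) coprime_sym prime_coprime //.
  by apply/negP => /(dvdn_leq k0); rewrite leqNgt kp.
have [km kn E _] := egcdnP p k0.
have kmx : iter (km * k) tau x = x.
  by elim: km {E} => // n IH; rewrite mulSn iterD IH kx.
by rewrite -{2}kmx E kcop addn1 /= iter_period_mul.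
Qed.

Lemma free_tau x : tau (tau x) <> tau x <-> tau x <> x.
Proof. by split=> h e; apply: h; [rewrite e|exact: tau_inj]. Qed.

Lemma free_iter k x : tau (iter k tau x) <> iter k tau x <-> tau x <> x.
Proof. by elim: k => //= k IH; rewrite free_tau. Qed.

Lemma orbit_sum_tau (V : nmodType) (f : T -> V) x :
  \sum_(k < p) f (iter k tau (tau x)) = \sum_(k < p) f (iter k tau x).
Proof.
case: p p_prime tau_p => // q _ tau_q.
rewrite big_ord_recr big_ord_recl /= addrC -iterSr tau_q; congr (_ + _).
by apply: eq_bigr => k _; rewrite /bump /= -iterSr.
Qed.

End PeriodicMap.

(** * Equivariant bumps on compact subsets of the free part *)

Section FreePart.
Variables (R : realType) (p : nat) (M : topologicalType) (tau : M -> M).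
Local Notation C := (complexes R).
Variable w : C.
Hypothesis p_prime : prime p.
Hypothesis Mc : compact [set: M].
Hypothesis Mh : hausdorff_space M.
Hypothesis Ms : @second_countable M.
Hypothesis Md : covering_dim_le M 2.
Hypothesis tau_c : continuous tau.
Hypothesis tau_p : iter p tau =1 id.
Hypothesis w_p : w ^+ p = 1.
Hypothesis w_unit : w * w^* = 1.

Local Notation M0 := [set x | tau x <> x].

Lemma iter_continuous k : continuous (iter k tau).
Proof.
elim: k => [|k IH] x; first exact: cvg_id.
rewrite (_ : iter k.+1 tau = tau \o iter k tau) //.
by apply: continuous_comp; [exact: IH|exact: tau_c].
Qed.

Lemma free_open : open M0.
Proof.
rewrite openE => x M0x; have [A [B [oA oB Ax Bx AB]]] := hausdorff_sep Mh M0x.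
apply: (@filterS _ _ _ (tau @^-1` A `&` B)).
  by move=> y [Ay By] ty; apply: (AB y) => //; rewrite -ty.
apply: filterI; last exact: open_nbhs_nbhs.
by apply: tau_c; exact: open_nbhs_nbhs.
Qed.

Definition wandering (V : set M) :=
  forall x k, (0 < k < p)%N -> V x -> ~ V (iter k tau x).

(** By [iter_free] the point differs from its first [p - 1] iterates; it is separated from each of
    them, and the finitely many conditions are intersected. *)
Lemma wandering_nbhd x : M0 x -> exists V, [/\ open V, V x & wandering V].
Proof.
move=> M0x.
have /choice[AB ABP] : forall k : 'I_p, exists AB : set M * set M, (0 < k)%N ->
    [/\ open AB.1, open AB.2, AB.1 x, AB.2 (iter k tau x) &
        forall y, AB.1 y -> ~ AB.2 y].
  move=> k; have [k0|k0] := posnP k; first by exists (setT, setT).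
  have xk : x <> iter k tau x.
    apply: nesym; apply: (iter_free p_prime tau_p) => //.
    by rewrite k0 ltn_ord.
  have [A [B h]] := hausdorff_sep Mh xk.
  by exists (A, B).
have : nbhs x [set y | forall k : 'I_p, (0 < k)%N ->
    (AB k).1 y /\ (AB k).2 (iter k tau y)].
  apply: filter_forall => k; have [->|k0] := posnP k.
    exact: filterE.
  have [oA oB Ax Bx _] := ABP k k0.
  apply: (@filterS _ _ _ ((AB k).1 `&` iter k tau @^-1` (AB k).2)) => [y [//]|].
  apply: filterI; first exact: open_nbhs_nbhs.
  by apply: iter_continuous; exact: open_nbhs_nbhs.
rewrite nbhsE => -[V [oV Vx] sV]; exists V; split=> // y k /andP[k0 kp] Vy Vk.
have [_ _ _ _ /(_ (iter k tau y))] := ABP (Ordinal kp) k0; apply.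
  by have [] := sV _ Vk (Ordinal kp) k0.
by have [] := sV _ Vy (Ordinal kp) k0.
Qed.

(** Up to the factor [p], the projection of [phi] to the eigenspace of composition with [tau] for
    the eigenvalue [w]. *)
Definition twist (phi : M -> R) x : C :=
  \sum_(k < p) (w^*) ^+ k * ofR (phi (iter k tau x)).

Lemma twist_tau phi x : twist phi (tau x) = w * twist phi x.
Proof.
rewrite /twist mulr_sumr; case: p p_prime tau_p w_p => // q _ tau_q w_q.
rewrite big_ord_recr [RHS]big_ord_recl /= addrC; congr (_ + _).
  rewrite -iterSr tau_q expr0 mul1r; congr (_ * _).
  have : (w^*) ^+ q.+1 = 1 by rewrite -rmorphXn /= w_q rmorph1.
  by rewrite exprS => h; rewrite -[LHS]mul1r -w_unit -mulrA h mulr1.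
apply: eq_bigr => k _; rewrite /bump /= -iterSr exprS.
by rewrite mulrA (mulrA w) w_unit mul1r.
Qed.

Lemma twist_continuous phi : continuous phi -> continuous (twist phi).
Proof.
move=> phic x; apply: cvg_bigsum => k _; apply: cvgM; first exact: cvg_cst.
apply: (@cvg_ofR _ _ x (phi \o iter k tau)).
by apply: continuous_comp; [exact: iter_continuous|exact: phic].
Qed.

(** The dimension bound yields a cover of order 3 that refines wandering sets near [K]. Twisting the
    cozero function of a wandering set causes no cancellation on that set, and costs a factor [p] in
    the order. *)
Lemma compact_twisted_bumps (K : set M) : compact K -> K `<=` M0 ->
  exists n (v : nat -> M -> C), [/\ forall i, continuous (v i),
    forall i x, v i (tau x) = w * v i x,
    forall x, K x -> exists2 i, (i < n)%N & v i x != 0 &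
    forall x, (count (fun i => v i x != 0%R) (iota 0 n) <= 3 * p)%N].
Proof.
move=> Kc KM0.
have /choice[V VP] : forall x, exists V, M0 x -> [/\ open V, V x & wandering V].
  move=> x; have [M0x|nM] := pselect (M0 x); last by exists setT => /nM.
  by have [V VP] := wandering_nbhd M0x; exists V.
have [x /KM0/VP[]//|x Kx|D KD cD] := compact_subcover Kc (D := K) (f := V).
  by exists x => //; have [] := VP x (KM0 _ Kx).
have {}KD x : x \in D -> K x by move=> /KD; rewrite inE.
(* The complement of [K] completes the finitely many wandering sets to a cover of [M]. *)
pose U := [set ~` K] `|` [set V x | x in [set` D]].
have oU : open_cover U.
  split=> [_ [->|[x xD <-]]|].
  - by apply: closed_openC; exact: compact_closed.
  - by have [] := VP x (KM0 _ (KD _ xD)).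
  rewrite -subTset => x _; have [Kx|nK] := pselect (K x).
    by have [y yD Vy] := cD _ Kx; exists (V y) => //; right; exists y.
  by exists (~` K) => //; left.
have fU : finite_set U.
  rewrite finite_setU; split; first exact: finite_set1.
  by apply: finite_image; exact: finite_fset.
have [W [[oW cW] /finite_seqP[s0 sE] WU Wd]] := Md oU fU.
pose s := undup s0.
have sW A : A \in s -> W A by rewrite mem_undup sE.
have Ws A : W A -> A \in s by rewrite mem_undup sE.
have /choice[phi phiP] : forall A, exists phi : M -> R, W A -> [/\ continuous phi,
    forall x, 0 <= phi x <= 1 & forall x, (0 < phi x) <-> A x].
  move=> A; have [WA|nW] := pselect (W A); last by exists (fun=> 0) => /nW.
  by have [phi h] := open_cozero R Mc Mh Ms (oW _ WA); exists phi.
pose s' := [seq A <- s | `[< wandering A >]].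
pose v i := twist (phi (nth set0 s' i)).
have s'W i : (i < size s')%N -> W (nth set0 s' i) /\ wandering (nth set0 s' i).
  move=> /(mem_nth set0); rewrite mem_filter => /andP[/asboolP ? /sW ?].
  by split.
have s'u : uniq s' by rewrite filter_uniq // undup_uniq.
pose n := size s'.
exists n, (fun i => if (i < n)%N then v i else fun=> 0); split.
- move=> i; case: ltnP => [/s'W[Wi _]|_]; last by move=> x; exact: cvg_cst.
  by apply: twist_continuous; case: (phiP _ Wi).
- by move=> i x; case: ltnP => _; [exact: twist_tau|rewrite mulr0].
- move=> x Kx; have : setT x by []; rewrite -cW => -[A WA Ax].
  (* A member meeting [K] is not inside the complement of [K], so it lies in some wandering
     [V y]. *)
  have Aw : wandering A.
    have [B [[->|[y yD <-]] AB]] := WU _ WA; first by have := AB _ Ax.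
    have [_ _ yw] := VP y (KM0 _ (KD _ yD)).
    by move=> z k kp Az Akz; apply: (yw z k kp); exact: AB.
  have As : A \in s' by rewrite mem_filter Ws // andbT; apply/asboolP.
  exists (index A s'); first by rewrite index_mem.
  rewrite index_mem As /v nth_index //.
  have [_ phi01 phi0] := phiP _ WA.
  (* On a wandering set only the term [k = 0] of the twist survives. *)
  rewrite /twist (bigD1 (Ordinal (prime_gt0 p_prime))) //= big1 ?addr0.
    by rewrite expr0 mul1r gt_eqF // ofR_lt phi0.
  move=> k k0; have -> : phi A (iter k tau x) = 0.
    apply/eqP; rewrite eq_le; have /andP[-> _] := phi01 (iter k tau x).
    rewrite andbT leNgt; apply/negP => /phi0; apply: Aw => //.
    by rewrite ltn_ord andbT lt0n; apply: contra k0 => /eqP k0; apply/eqP/val_inj.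
  by rewrite mulr0.
(* If [v i x] is nonzero, some iterate of [x] lies in the [i]-th set, and each of the [p] iterates
   lies in at most three sets. *)
move=> x; pose q k i := `[< nth set0 s' i (iter k tau x) >].
apply: (@leq_trans (\sum_(k < p) count (q k) (iota 0 n))); last first.
  have -> : (3 * p = \sum_(k < p) 3)%N by rewrite sum_nat_const card_ord mulnC.
  rewrite leq_sum // => k _.
  have -> : count (q k) (iota 0 n) =
      size [seq A <- s' | `[< A (iter k tau x) >]].
    rewrite size_filter -[X in _ = count _ X](mkseq_nth set0 s').
    by rewrite /mkseq count_map.
  apply: (size_card_le (Wd (iter k tau x))); first exact: filter_uniq.
  move=> A; rewrite !mem_filter => /andP[/asboolP Ax /andP[_ /sW WA]].
  by split.
rewrite -sum1_count big_mkcond /=.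
under [leqRHS]eq_bigr do rewrite -sum1_count big_mkcond /=.
rewrite exchange_big /= big_seq [leqRHS]big_seq leq_sum // => i.
rewrite mem_iota add0n => /andP[_ i_n]; rewrite i_n.
case: ifPn => // vi; have [k qk] : exists k : 'I_p, q k i.
  apply/existsP; apply: contraR vi; rewrite negb_exists => /forallP nq.
  rewrite /v /twist big1 // => k _; have := nq k; rewrite /q => /asboolPn nA.
  have [Wi _] := s'W _ i_n; have [_ phi01 phi0] := phiP _ Wi.
  have -> : phi (nth set0 s' i) (iter k tau x) = 0.
    apply/eqP; rewrite eq_le; have /andP[-> _] := phi01 (iter k tau x).
    by rewrite andbT leNgt; apply/negP => /phi0.
  by rewrite mulr0.
by rewrite (bigD1 k) //= qk.
Qed.

End FreePart.

Section NormalizeTuple.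
Variables (R : realType) (M : topologicalType) (m : nat).
Local Notation C := (complexes R).

Definition sqnorm (v : 'I_m -> C) : R := \sum_r (cRe (v r) ^+ 2 + cIm (v r) ^+ 2).

Lemma sqnormE v : \sum_r v r * (v r)^* = ofR (sqnorm v).
Proof.
rewrite /sqnorm (big_morph _ (@ofRD R) (_ : ofR 0 = 0)) //.
by apply: eq_bigr => r _; rewrite sqr_norm.
Qed.

Lemma sqnorm_ge0 v : 0 <= sqnorm v.
Proof. by apply: sumr_ge0 => r _; rewrite addr_ge0 ?sqr_ge0. Qed.

Lemma sqnorm_gt0 v r : v r != 0 -> 0 < sqnorm v.
Proof.
move=> vr; rewrite lt_neqAle sqnorm_ge0 andbT eq_sym; apply: contra vr.
rewrite psumr_eq0 => [/allP/(_ r)|i _]; last by rewrite addr_ge0 ?sqr_ge0.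
rewrite mem_index_enum => /(_ isT) /=; rewrite paddr_eq0 ?sqr_ge0 //.
by rewrite !sqrf_eq0 => /andP[/eqP a /eqP b]; apply/eqP; exact: complex_eq.
Qed.

Lemma sqnorm_cvg (v : 'I_m -> M -> C) x : (forall r, v r @ x --> v r x) ->
  (fun y => sqnorm (v^~ y)) @ x --> sqnorm (v^~ x).
Proof.
move=> vc; apply: (@cvg_bigsum R _ x _ _ _ (fun r y => cRe (v r y) ^+ 2 + cIm (v r y) ^+ 2)).
move=> r _; apply: cvgD.
  apply: (@continuous_comp _ _ _ (fun y => cRe (v r y)) (fun t : R => t ^+ 2)).
    by apply: cvg_cRe; exact: vc.
  exact: exprn_continuous.
apply: (@continuous_comp _ _ _ (fun y => cIm (v r y)) (fun t : R => t ^+ 2)).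
  by apply: cvg_cIm; exact: vc.
exact: exprn_continuous.
Qed.

Definition normalize (v : 'I_m -> C) r : C := v r / ofR (Num.sqrt (sqnorm v)).

Lemma normalizeE v : 0 < sqnorm v ->
  \sum_r normalize v r * (normalize v r)^* = 1.
Proof.
move=> v0; have s0 : ofR (Num.sqrt (sqnorm v)) != 0.
  by rewrite gt_eqF // ofR_lt sqrtr_gt0.
under eq_bigr => i _ do rewrite rmorphM fmorphV /= ofRJ mulrACA -invfM -ofRM -expr2
  sqr_sqrtr ?sqnorm_ge0 //.
rewrite -mulr_suml sqnormE divff //.
by rewrite gt_eqF // ofR_lt.
Qed.

Lemma normalize_cvg (v : 'I_m -> M -> C) x r : 0 < sqnorm (v^~ x) ->
  (forall r, v r @ x --> v r x) ->
  (fun y => normalize (v^~ y) r) @ x --> normalize (v^~ x) r.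
Proof.
move=> v0 vc; apply: cvgM; first exact: vc.
apply: cvgV; first by rewrite gt_eqF // ofR_lt sqrtr_gt0.
apply: (@cvg_ofR _ _ x (Num.sqrt \o (fun y => sqnorm (v^~ y)))).
by apply: continuous_comp; [exact: sqnorm_cvg|exact: sqrt_continuous].
Qed.

End NormalizeTuple.

(** * Finitely many equivariant functions without common zeros *)

Section FiniteType.
Variables (R : realType) (p : nat) (M : topologicalType) (tau : M -> M).
Local Notation C := (complexes R).
Variable w : C.
Hypothesis p_prime : prime p.
Hypothesis Mc : compact [set: M].
Hypothesis Mh : hausdorff_space M.
Hypothesis Ms : @second_countable M.
Hypothesis Md : covering_dim_le M 2.
Hypothesis tau_c : continuous tau.
Hypothesis tau_p : iter p tau =1 id.
Hypothesis w_p : w ^+ p = 1.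
Hypothesis w_unit : w * w^* = 1.

Local Notation M0 := [set x | tau x <> x].

(** The orbit average of a cozero function of the free part. Its superlevel sets form an invariant
    exhaustion of the free part by compact sets. *)
Lemma level_function : exists g : M -> R, [/\ continuous g,
  forall x, 0 <= g x <= 1, forall x, (0 < g x) <-> M0 x &
  forall x, g (tau x) = g x].
Proof.
have [phi [phic phi01 phiP]] := open_cozero R Mc Mh Ms (free_open Mh tau_c).
have p0 := prime_gt0 p_prime.
have p0R : 0 < p%:R :> R by rewrite ltr0n.
have phi0 x : 0 <= phi x by case/andP: (phi01 x).
exists (fun x => (\sum_(k < p) phi (iter k tau x)) / p%:R); split=> [x|x|x|x].
- apply: cvgM; last exact: cvg_cst.
  apply: (@cvg_bigsum R _ x _ _ _ (fun (k : 'I_p) y => phi (iter k tau y))) => k _.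
  apply: (@continuous_comp _ _ _ (iter k tau) phi x); last exact: phic.
  exact: iter_continuous.
- rewrite divr_ge0 ?sumr_ge0 ?ler0n //= ler_pdivrMr // mul1r.
  rewrite -[X in _ <= X%:R]card_ord -sumr_const ler_sum // => k _.
  by case/andP: (phi01 (iter k tau x)).
- rewrite pmulr_lgt0 ?invr_gt0 //; split=> [|M0x].
    apply: contraPP => nM; rewrite big1 ?ltxx // => k _.
    apply/eqP; rewrite eq_le phi0 andbT leNgt; apply/negP => /phiP /=.
    by rewrite (free_iter p_prime tau_p).
  rewrite (bigD1 (Ordinal p0)) //= ltr_wpDr ?sumr_ge0 //.
  exact/phiP.
by rewrite (orbit_sum_tau p_prime tau_p).
Qed.

(* At most 3p bumps of one annulus are nonzero at a given point, and a point lies in at most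
   two annuli, whence the 6p moments. *)
Lemma finite_type : exists v : 'I_(6 * p) -> M -> C, [/\
  forall r x, M0 x -> v r @ x --> v r x,
  forall r x, M0 x -> v r (tau x) = w * v r x &
  forall x, M0 x -> \sum_r v r x * (v r x)^* = 1].
Proof.
have [g [gc g01 gP g_tau]] := level_function.
pose K (j : nat) := [set x | j.+1%:R^-1 <= g x].
have KM0 j : K j `<=` M0 by move=> x Kx; apply/gP; rewrite (lt_le_trans _ Kx) // invr_gt0.
have Kc j : compact (K j).
  apply: (subclosed_compact _ Mc) => //.
  by apply: (@preimage_closed _ _ g [set y | j.+1%:R^-1 <= y]) => //; exact: closed_ge.
have /choice[nV nVP] : forall j, exists nV : nat * (nat -> M -> C), [/\
    forall i, continuous (nV.2 i), forall i x, nV.2 i (tau x) = w * nV.2 i x,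
    forall x, K j x -> exists2 i, (i < nV.1)%N & nV.2 i x != 0 &
    forall x, (count (fun i => nV.2 i x != 0%R) (iota 0 nV.1) <= 3 * p)%N].
  move=> j; have [n [v vP]] := compact_twisted_bumps p_prime Mc Mh Ms Md tau_c
    tau_p w_p w_unit (Kc j) (@KM0 j).
  by exists (n, v).
(* On the free part [t] grows without bound towards the fixed points, where the convention for
   [0^-1] gives it the value 0. The tents [al j] cut out the annuli where [t] is within 1 of [j]. *)
pose t x := (g x)^-1.
pose al (j : nat) x : R := Num.max 0 (1 - `|t x - j%:R|).
pose a (ji : nat * nat) x : C := ofR (al ji.1 x) * (nV ji.1).2 ji.2 x.
(* Distinct nodes for the Vandermonde argument. *)
pose c (ji : nat * nat) : C := (choice.pickle ji)%:R.
pose b r j x := \sum_(i <- iota 0 (nV j).1) c (j, i) ^+ r * a (j, i) x.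
pose S N r x := \sum_(j <- iota 0 N) b r j x.
(* The tents with [j >= N x] vanish at [x], so [W r x] is in effect the sum over all annuli. *)
pose N x := (Num.truncn (t x)).+2.
pose W r x := S (N x) r x.
have t0 x : 0 <= t x by rewrite invr_ge0; case/andP: (g01 x).
have tr_le x : (Num.truncn (t x))%:R <= t x by rewrite truncn_le.
have al0 x j : al j x != 0 -> t x - 1 < j%:R < t x + 1.
  rewrite /al; case: (leP (1 - `|t x - j%:R|) 0) => h; first by rewrite eqxx.
  move=> _; move: h; rewrite subr_gt0 ltr_norml => /andP[h1 h2].
  by apply/andP; split; lra.
have b0 r j x : (N x <= j)%N -> b r j x = 0.
  move=> Nj; rewrite /b big1 // => i _; rewrite /a /=.
  have -> : al j x = 0.
    apply/eqP; apply: contraLR Nj => /al0 /andP[_ jt]; rewrite -ltnNge.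
    have := truncnS_gt (t x); rewrite -(ltr_nat R) /N => h.
    by rewrite (lt_le_trans jt) // -[_.+2]addn1 natrD lerD2r ltW.
  by rewrite [ofR 0](_ : _ = 0) // mul0r mulr0.
have SE r x N' : (N x <= N')%N -> S N' r x = W r x.
  move=> NN; rewrite /W /S -(subnKC NN) iotaD big_cat /= [X in _ + X]big_seq.
  rewrite [X in _ + X]big1 ?addr0 // => j; rewrite mem_iota add0n => /andP[Nj _].
  exact: b0.
have tc x : M0 x -> t @ x --> t x.
  by move=> /gP gx; apply: cvgV; [rewrite gt_eqF|exact: gc].
have alc j x : M0 x -> al j @ x --> al j x.
  move=> M0x.
  apply: (@continuous_max R M (fun=> 0) (fun y => 1 - `|t y - j%:R|)).
    exact: cvg_cst.
  apply: cvgB; first exact: cvg_cst.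
  apply: cvg_norm; apply: cvgB; [exact: tc|exact: cvg_cst].
have Sc N' r x : M0 x -> S N' r @ x --> S N' r x.
  move=> M0x; apply: cvg_bigsum => j _; apply: cvg_bigsum => i _.
  apply: cvgM; first exact: cvg_cst.
  have [vc _ _ _] := nVP j.
  by apply: cvgM; [apply: cvg_ofR; exact: alc|exact: vc].
have Wc r x : M0 x -> W r @ x --> W r x.
  (* Where the level stays below [t x + 1], a single finite number of annuli suffices. *)
  move=> M0x; apply: (@cvg_eq_near _ _ x [set y | t y < t x + 1] _ (S (N x).+1 r)).
  - by apply: (@cvgr_lt _ _ _ _ t (t x)); [exact: tc|rewrite ltrDl].
  - move=> y ty; rewrite SE // /N !ltnS -ltnS -(ltr_nat R).
    rewrite (le_lt_trans (tr_le y)) // (lt_trans ty) //.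
    by rewrite -[_.+2]addn1 natrD ltrD2r truncnS_gt.
  exact: Sc.
have Wtau r x : W r (tau x) = w * W r x.
  have tt : t (tau x) = t x by rewrite /t g_tau.
  rewrite /W /N tt /S mulr_sumr; apply: eq_bigr => j _.
  rewrite /b mulr_sumr; apply: eq_bigr => i _.
  have [_ vt _ _] := nVP j.
  by rewrite /a /= vt /al tt; ring.
pose s N' := [seq (j, i) | j <- iota 0 N', i <- iota 0 (nV j).1].
have Ws r x : W r x = \sum_(ji <- s (N x)) c ji ^+ r * a ji x.
  by rewrite /W /S /b big_allpairs_dep.
have us N' : uniq (s N').
  apply: allpairs_uniq_dep; first exact: iota_uniq.
  - by move=> j _; exact: iota_uniq.
  - by move=> [j i] [j' i'] _ _ /= [-> ->].
have cinj : {in s _ &, injective c}.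
  by move=> N' u u' _ _ /eqP; rewrite eqr_nat => /eqP /(pcan_inj choice.pickleK).
have cnt x : (count (fun ji => a ji x != 0%R) (s (N x)) <= 6 * p)%N.
  rewrite -sum1_count big_mkcond /= big_allpairs_dep /=.
  apply: (@leq_trans (\sum_(j <- iota 0 (N x) | al j x != 0%R) 3 * p)).
    rewrite [leqRHS]big_mkcond leq_sum // => j _.
    rewrite -big_mkcond sum1_count; have [aj|aj] := eqVneq (al j x) 0.
      rewrite leqn0 eqn0Ngt -has_count; apply/hasPn => i _.
      by rewrite /a /= aj [ofR 0](_ : _ = 0) // mul0r eqxx.
    have [_ _ _ /(_ x)] := nVP j; apply: leq_trans; apply: sub_count => i /=.
    by rewrite /a /= mulf_eq0 negb_or => /andP[].
  rewrite big_const_seq iter_addn_0 mulnC (_ : 6 * p = 2 * (3 * p))%N; last by rewrite mulnA.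
  rewrite leq_mul2r; apply/orP; right.
  rewrite -size_filter.
  (* A tent nonzero at [x] is centred at an integer less than 1 away from [t x], which leaves these
     two. *)
  apply: (@uniq_leq_size _ _ [:: Num.truncn (t x); (Num.truncn (t x)).+1]).
    by rewrite filter_uniq // iota_uniq.
  move=> j; rewrite mem_filter => /andP[/al0 /andP[h1 h2] _].
  have h3 := tr_le x; have h4 := truncnS_gt (t x).
  have k1 : (j < (Num.truncn (t x)).+2)%N.
    by rewrite -(ltr_nat R) -[_.+2]addn1 natrD; lra.
  have k2 : (Num.truncn (t x) < j.+1)%N.
    by rewrite -(ltr_nat R) -[j.+1]addn1 natrD; lra.
  rewrite !inE; clear -k1 k2; lia.
pose Wt x (r : 'I_(6 * p)) := W r x.
have Wpos x : M0 x -> 0 < sqnorm (Wt x).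
  move=> M0x; have [r Wr] : exists r, Wt x r != 0.
    apply/existsP; apply: contraT; rewrite negb_exists => /forallP W0.
    (* For this [j], [x] lies in [K j] and [al j x] is positive. So some [a (j, i) x] is nonzero,
       against the vanishing of all [6 * p] moments. *)
    pose j := Num.truncn (t x).
    have h3 := tr_le x; have h4 := truncnS_gt (t x).
    have [_ _ /(_ x)[]] := nVP j.
      have g0 : 0 < g x by apply/gP.
      by rewrite /K /= invf_ple ?posrE // -/(t x) ltW.
    move=> i iN Vi; have : a (j, i) x = 0.
      apply: (vandermonde_support (us (N x)) (cinj _) (cnt x)).
        by move=> r rm; rewrite -Ws; apply/eqP; have := W0 (Ordinal rm); rewrite negbK.
      apply: allpairs_f_dep; first by rewrite mem_iota add0n ltnS leqnSn.
      by rewrite mem_iota.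
    move/eqP; rewrite /a /= mulf_eq0 (negPf Vi) orbF => /eqP [].
    rewrite /al ger0_norm ?subr_ge0 // => hm.
    suff : 0 < Num.max 0 (1 - (t x - j%:R)) by rewrite hm ltxx.
    rewrite lt_max; apply/orP; right; move: h4; rewrite -[_.+1]addn1 natrD -/j; lra.
  exact: sqnorm_gt0 Wr.
exists (fun r x => normalize (Wt x) r); split=> [r x M0x|r x M0x|x M0x].
- apply: (@normalize_cvg R M (6 * p) (fun r y => W r y) x r (Wpos x M0x)).
  by move=> k; exact: Wc.
- rewrite /normalize mulrA; congr (_ / ofR (Num.sqrt _)); first exact: Wtau.
  suff [] : ofR (sqnorm (Wt (tau x))) = ofR (sqnorm (Wt x)) by [].
  rewrite -!sqnormE; apply: eq_bigr => k _.
  by rewrite /Wt Wtau rmorphM mulrACA w_unit mul1r.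
exact/normalizeE/Wpos.
Qed.

End FiniteType.

(** * The Stone-Cech corona *)

Section SetType.
Variables (T : topologicalType) (A : set T).

Lemma nbhs_set_type (x : set_type A) (N : set (set_type A)) :
  nbhs x N -> exists O : set T, [/\ open O, O (set_val x) & set_val @^-1` O `<=` N].
Proof.
rewrite nbhsE => -[U [[O oO OU] Ux] UN]; exists O; split=> //.
  by move: Ux; rewrite -OU.
by rewrite OU.
Qed.

Lemma set_val_continuous : continuous (@set_val T A).
Proof. exact: initial_continuous. Qed.

Lemma set_type_compact (K : set T) : K `<=` A -> compact K ->
  compact (@set_val T A @^-1` K).
Proof.
move=> KA Kc F FF FK.
have [x [Kx xF]] := Kc (set_val @ F) _ FK.
exists (exist _ x (mem_set (KA _ Kx))); split=> //.
move=> B N FB /nbhs_set_type[O [oO Ox ON]].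
have [||y [[z Bz <-] Oz]] := xF (set_val @` B) O.
- by apply: (@filterS _ F _ B) => //; exact: preimage_image.
- exact: open_nbhs_nbhs.
by exists z; split=> //; exact: ON.
Qed.

Lemma set_type_hausdorff : hausdorff_space T -> hausdorff_space (set_type A).
Proof.
move=> hT x y xy; apply: val_inj; apply: hT => B D Bx Dy.
have [] := xy (set_val @^-1` B) (set_val @^-1` D).
- by apply: set_val_continuous.
- by apply: set_val_continuous.
by move=> z [Bz Dz]; exists (set_val z).
Qed.

End SetType.

Section StoneCech.
Variables (R : realType) (X : topologicalType).
Local Notation C := (complexes R).
Local Notation bX := (stone_cech R X).
Local Notation eta := (@to_stone_cech R X).

Lemma stone_cech_hausdorff : hausdorff_space bX.
Proof.
apply: set_type_hausdorff.
apply: (@hausdorff_product _ (fun _ => R)) => i; exact: Rhausdorff.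
Qed.

Lemma stone_cech_compact : compact [set: bX].
Proof.
pose B : set (cube R X) := [set f | forall i, `[0, 1]%classic (f i)].
have cB : compact B.
  by apply: (@tychonoff _ (fun _ => R) (fun _ => `[0, 1]%classic)) => i; exact: segment_compact.
have hcube : hausdorff_space (cube R X).
  apply: (@hausdorff_product _ (fun _ => R)) => i; exact: Rhausdorff.
have sub : closure (range (@cube_eval R X)) `<=` B.
  apply: (@subset_trans _ (closure B)).
    apply: closureS => _ [x _ <-] f; have [_ f01] := set_valP f.
    by rewrite /= in_itv; exact: f01.
  by rewrite -((closure_id B).1 (compact_closed hcube cB)).
rewrite (_ : setT = set_val @^-1` closure (range (@cube_eval R X))).
  apply: set_type_compact => //; apply: subclosed_compact sub => //.
  exact: closed_closure.
by apply/seteqP; split=> // x _; exact: set_valP.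
Qed.

Lemma stone_cech_dense (z : bX) (N : set bX) : nbhs z N -> exists x, N (eta x).
Proof.
move=> /nbhs_set_type[O [oO Oz ON]].
have zc : closure (range (@cube_eval R X)) (set_val z) by exact: set_valP.
have [_ [[x _ <-] Ox]] := zc O (open_nbhs_nbhs (conj oO Oz)).
by exists x; exact: ON.
Qed.

Lemma eta_continuous : continuous eta.
Proof.
apply: continuous_comp_initial => x.
apply/cvg_sup => f.
have fc : continuous ((fun h : cube R X => h f) \o (@cube_eval R X)).
  by have [fc _] := set_valP f; exact: fc.
have h := @continuous_comp_initial _ _ _ (fun h : cube R X => h f) (@cube_eval R X) fc.
exact: (h x).
Qed.

(** Such an [f] is one of the coordinates of the cube, and the projection to this coordinate extends
    it. *)
Lemma stone_cech_extend (f : X -> R) : continuous f -> (forall x, 0 <= f x <= 1) ->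
  exists F : bX -> R, continuous F /\ forall x, F (eta x) = f x.
Proof.
move=> fc f01.
have fU : f \in @unit_fun R X by rewrite inE.
exists (fun z : bX => (set_val z : cube R X) (exist _ f fU)); split=> // z.
apply: (@continuous_comp _ _ _ (@set_val _ _ : bX -> cube R X)
   (fun h : cube R X => h (exist _ f fU)) z).
  exact: set_val_continuous.
exact: (@proj_continuous _ (fun _ => R)).
Qed.

End StoneCech.

(** * Extending projections to a compactification and sections from its corona *)

Section Compactification.
Variables (R : realType) (X B : topologicalType) (eta : X -> B).
Local Notation C := (complexes R).
Hypothesis B_compact : compact [set: B].
Hypothesis B_hausdorff : hausdorff_space B.
Hypothesis eta_continuous : continuous eta.
Hypothesis eta_dense : forall (z : B) (N : set B), nbhs z N -> exists x, N (eta x).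
Hypothesis eta_extend : forall f : X -> R, continuous f -> (forall x, 0 <= f x <= 1) ->
  exists F : B -> R, continuous F /\ forall x, F (eta x) = f x.

Lemma dense_eq (T : topologicalType) (f g : B -> T) : hausdorff_space T ->
  continuous f -> continuous g -> (forall x, f (eta x) = g (eta x)) -> f =1 g.
Proof.
move=> hT fc gc fg z; apply: contrapT => fgz.
have [A [D [oA oD Az Dz AD]]] := hausdorff_sep hT fgz.
have [|x [Ax Dx]] := @eta_dense z (f @^-1` A `&` g @^-1` D).
  by apply: filterI; [apply: fc|apply: gc]; exact: open_nbhs_nbhs.
by apply: (AD (f (eta x))) => //; rewrite fg.
Qed.

Lemma extend_complex (f : X -> C) : continuous f -> (forall x, `|f x| <= 1) ->
  exists F : B -> C, continuous F /\ forall x, F (eta x) = f x.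
Proof.
move=> fc f1.
have ext (h : X -> R) : continuous h -> (forall x, `|h x| <= 1) ->
    exists F : B -> R, continuous F /\ forall x, F (eta x) = h x.
  move=> hc h1; have [||F [Fc FE]] := @eta_extend (fun x => (h x + 1) / 2).
  - move=> x; apply: cvgM; last exact: cvg_cst.
    by apply: cvgD; [exact: hc|exact: cvg_cst].
  - by move=> x; have := h1 x; rewrite ler_norml; lra.
  exists (fun z => 2 * F z - 1); split=> [z|x]; last by rewrite FE; lra.
  apply: cvgB; last exact: cvg_cst.
  by apply: cvgM; [exact: cvg_cst|exact: Fc].
have [|x|A [Ac AE]] := ext (fun x => cRe (f x)).
- by move=> x; apply: cvg_cRe; exact: fc.
- by rewrite -ofR_le (le_trans (norm_cRe _)).
have [|x|D [Dc DE]] := ext (fun x => cIm (f x)).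
- by move=> x; apply: cvg_cIm; exact: fc.
- by rewrite -ofR_le (le_trans (norm_cIm _)).
exists (fun z => ofR (A z) + ofR (D z) * (0 +i* 1)%C); split=> [z|x].
  apply: cvgD; first by apply: cvg_ofR; exact: Ac.
  by apply: cvgM; [apply: cvg_ofR; exact: Dc|exact: cvg_cst].
rewrite AE DE; apply: complex_eq; rewrite ?(cReD, cImD, cReM, cImM) /cRe/cIm/=; ring.
Qed.

(** The squared modulus of [P r s] is [P r r * P s s], and diagonal entries lie between 0 and 1. *)
Lemma rank_one_le1 (m : nat) (P : 'I_m -> 'I_m -> X -> C) r s x :
  rank_one P -> `|P r s x| <= 1.
Proof.
move=> [_ PJ PP P1].
have P0 t : 0 <= P t t x.
  rewrite -[leRHS]mulr1 -(P1 x) mulr_sumr sumr_ge0 // => k _.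
  by rewrite PP -PJ mulrC mul_conjC_ge0.
have Pl t : P t t x <= 1.
  by rewrite -(P1 x) (bigD1 t) //= lerDl sumr_ge0.
rewrite -(@expr_le1 _ 2) // normCK PJ PP.
by rewrite -[leRHS]mulr1 ler_pM.
Qed.

Lemma hausdorffC : hausdorff_space C.
Proof. exact: norm_hausdorff. Qed.

Lemma rank_one_extend (m : nat) (P : 'I_m -> 'I_m -> X -> C) : rank_one P ->
  exists Q : 'I_m -> 'I_m -> B -> C, rank_one Q /\
    forall r s x, Q r s (eta x) = P r s x.
Proof.
move=> rkP; have [Pc PJ PP P1] := rkP.
have /choice[Q QP] : forall rs : 'I_m * 'I_m, exists F : B -> C,
    continuous F /\ forall x, F (eta x) = P rs.1 rs.2 x.
  move=> [r s] /=; apply: extend_complex => // x; exact: rank_one_le1.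
have Qc r s : continuous (Q (r, s)) by case: (QP (r, s)).
have QE r s x : Q (r, s) (eta x) = P r s x by case: (QP (r, s)).
exists (fun r s => Q (r, s)); split=> //; split=> //.
- move=> r s; apply: dense_eq; first exact: hausdorffC.
  + by move=> z; apply: cvg_conj; exact: Qc.
  + exact: Qc.
  + by move=> x; rewrite !QE.
- move=> r s t u; apply: dense_eq; first exact: hausdorffC.
  + by move=> z; apply: cvgM; exact: Qc.
  + by move=> z; apply: cvgM; exact: Qc.
  + by move=> x; rewrite !QE.
apply: dense_eq; first exact: hausdorffC.
+ by move=> z; apply: cvg_bigsum => r _; exact: Qc.
+ by move=> z; exact: cvg_cst.
+ by move=> x; rewrite -(P1 x); apply: eq_bigr => r _; rewrite QE.
Qed.

Section Proper.
Variable g : X -> R.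
Hypothesis gc : continuous g.
Hypothesis g01 : forall x, 0 < g x <= 1.
Hypothesis gK : forall e, 0 < e -> compact [set x | e <= g x].

(** If [G z > 0], then [z] is a limit of image points with [g >= G z / 2]. These form a compact,
    hence closed, subset of the image of [eta], which therefore contains [z]. *)
Lemma corona_zero_set : exists G : B -> R,
  continuous G /\ ~` range eta = [set z | G z = 0] /\ forall x, G (eta x) = g x.
Proof.
have [||G [Gc GE]] := @eta_extend g => //.
  by move=> x; have /andP[/ltW -> ->] := g01 x.
exists G; split=> //; split=> //; apply/seteqP; split=> [z nz|z /= Gz [x _ xz]]; last first.
  by have /andP[] := g01 x; rewrite -GE xz Gz ltxx.
apply/eqP; rewrite -[_ == _]negbK; apply/negP => Gz0.
have Gz : 0 < G z.
  rewrite lt_neqAle eq_sym Gz0 /= leNgt; apply/negP => Gz.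
  have [|x] := @eta_dense z [set y | G y < 0].
    by apply: (@cvgr_lt _ _ _ _ G (G z)); first exact: Gc.
  by rewrite /= GE => gx; have /andP[/lt_trans/(_ gx)] := g01 x; rewrite ltxx.
have Kc : compact (eta @` [set x | G z / 2 <= g x]).
  apply: continuous_compact; last by apply: gK; rewrite divr_gt0.
  by apply: continuous_subspaceT; exact: eta_continuous.
have Kcl : closed (eta @` [set x | G z / 2 <= g x]).
  by apply: compact_closed => //; exact: B_hausdorff.
have [|x [/= Gx nK]] := @eta_dense z
    ([set y | G z / 2 < G y] `&` ~` (eta @` [set x | G z / 2 <= g x])).
  apply: filterI.
    by apply: (@cvgr_gt _ _ _ _ G (G z)); [exact: Gc|rewrite ltr_pdivrMr // ltr_pMr // ltr1n].
  apply: open_nbhs_nbhs; split; first exact: closed_openC.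
  by move=> [x _ xz]; apply: nz; exists x.
by apply: nK; exists x => //=; rewrite -GE ltW.
Qed.

Lemma corona_closed : closed (~` range eta).
Proof.
have [G [Gc [-> _]]] := corona_zero_set.
by apply: (@preimage_closed _ _ G [set 0]) => //; exact: closed_eq.
Qed.

(* If [P = v v^*], the double sum is the square of the modulus of the scalar product of [v]
   and [xi]. *)
Lemma rank_one_section_at_infinity (m : nat) (P : 'I_m -> 'I_m -> X -> C) :
  (forall c : cech_cohomology (set_type (~` range eta)) 2, c = 0) -> rank_one P ->
  exists (xi : 'I_m -> X -> C) (e : R), [/\ 0 < e, forall r, continuous (xi r) &
    forall x, g x < e -> \sum_r \sum_s P r s x * (xi r x)^* * xi s x != 0].
Proof.
move=> H2 rkP; have [Q [rkQ QE]] := rank_one_extend rkP.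
have [Qc QJ QQ Q1] := rkQ.
have cc : compact [set: set_type (~` range eta)].
  rewrite (_ : setT = set_val @^-1` (~` range eta)).
    apply: set_type_compact => //; apply: subclosed_compact B_compact _ => //.
    exact: corona_closed.
  by apply/seteqP; split=> // x _; exact: set_valP.
have hc : hausdorff_space (set_type (~` range eta)).
  by apply: set_type_hausdorff; exact: B_hausdorff.
pose Qr r s (z : set_type (~` range eta)) := Q r s (set_val z).
have rkQr : rank_one Qr.
  split=> [r s z|r s z|r s t u z|z]; rewrite /Qr //.
  by apply: continuous_comp; [exact: set_val_continuous|exact: Qc].
have [f fF] := rank_one_section rkQr cc hc H2.
have ext (h : set_type (~` range eta) -> R) : continuous h -> (forall z, `|h z| <= 1) ->
    exists F : B -> R, continuous F /\ forall z, F (set_val z) = h z.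
  move=> hcont h1.
  (* [valL_ 0 h] extends [h] by 0; Tietze's theorem uses only its values on the corona. *)
  have valE y : valL_ 0 h (set_val y) = h y.
    exact: (congr1 (@^~ y) (@valLK _ _ 0 (~` range eta) h)).
  have [||F [FE Fc _]] := @continuous_bounded_extension B R
      (compact_normal B_hausdorff B_compact) (~` range eta)
      corona_closed (valL_ 0 h) 1 ltr01.
  - exact/subspace_valL_continuousP'.
  - by move=> z nz; have := h1 (exist _ z (mem_set nz)); rewrite -valE.
  exists F; split=> // z; rewrite -valE -FE // inE; exact: set_valP.
have f1 r z : `|f r z| <= 1 by exact: (frame_le1 rkQr r fF).
have /choice[F FP] : forall r, exists F : B -> C,
    continuous F /\ forall z, F (set_val z) = f r z.
  move=> r; have fc : continuous (f r) by move=> z; exact: fF.1.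
  have [|z|A [Ac AE]] := ext (fun z => cRe (f r z)).
  - by move=> z; apply: cvg_cRe; exact: fc.
  - by rewrite -ofR_le (le_trans (norm_cRe _)).
  have [|z|D [Dc DE]] := ext (fun z => cIm (f r z)).
  - by move=> z; apply: cvg_cIm; exact: fc.
  - by rewrite -ofR_le (le_trans (norm_cIm _)).
  exists (fun z => ofR (A z) + ofR (D z) * (0 +i* 1)%C); split=> [z|z].
    apply: cvgD; first by apply: cvg_ofR; exact: Ac.
    by apply: cvgM; [apply: cvg_ofR; exact: Dc|exact: cvg_cst].
  rewrite AE DE; apply: complex_eq; rewrite ?(cReD, cImD, cReM, cImM) /cRe/cIm/=; ring.
have Fc r : continuous (F r) by case: (FP r).
(* The squared length of the projection of [F] to the range of [Q]; it is 1 on the corona because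
   [F] restricts there to a unit section. *)
pose q z := cRe (\sum_r \sum_s Q r s z * (F r z)^* * F s z).
have qc : continuous q.
  move=> z; apply: cvg_cRe; apply: cvg_bigsum => r _; apply: cvg_bigsum => s _.
  apply: cvgM; last exact: Fc.
  by apply: cvgM; [exact: Qc|apply: cvg_conj; exact: Fc].
have q1 z : (~` range eta) z -> q z = 1.
  move=> nz; pose z' : set_type (~` range eta) := exist _ z (mem_set nz).
  rewrite /q (_ : \sum_r _ = 1) //.
  have -> : z = set_val z' by [].
  transitivity (\sum_r \sum_s Qr r r z' * Qr s s z').
    apply: eq_bigr => r _; apply: eq_bigr => s _.
    rewrite !(FP _).2 -mulrA [_^* * _]mulrC (fF.2 s r z' I).
    by rewrite -/(Qr r s z'); have [_ _ -> _] := rkQr.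
  have [_ _ _ h1] := rkQr.
  under eq_bigr do rewrite -mulr_sumr h1 mulr1.
  exact: h1.
have [G [Gc [GE Gg]]] := corona_zero_set.
(* The set where [q <= 1/2] is compact and misses the zero set of [G], so [G] is bounded below on
   it; this yields [e]. *)
have Bc : compact (G @` [set z | q z <= 1/2]).
  apply: continuous_compact; first exact: continuous_subspaceT.
  apply: subclosed_compact B_compact _ => //.
  by apply: (@preimage_closed _ _ q [set y | y <= 1/2]) => //; exact: closed_le.
have : nbhs (0 : R) (~` (G @` [set z | q z <= 1/2])).
  apply: open_nbhs_nbhs; split.
    by apply: closed_openC; apply: compact_closed => //; exact: Rhausdorff.
  move=> [z qz Gz]; have : q z = 1 by apply: q1; rewrite GE.
  by move=> q1z; move: qz; rewrite /= q1z; lra.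
move=> /nbhs_ballP[e /= e0 He].
exists (fun r x => F r (eta x)), e; split=> // [r x|x gx].
  by apply: (@continuous_comp _ _ _ eta (F r) x); [exact: eta_continuous|exact: Fc].
apply/eqP => S0; apply: (He (g x)).
  rewrite /ball /= sub0r normrN ger0_norm //.
  by have /andP[/ltW] := g01 x.
exists (eta x) => //=; rewrite /q.
under eq_bigr do under eq_bigr do rewrite QE.
by rewrite S0 /cRe/=; lra.
Qed.

End Proper.

End Compactification.

(** * The orbit space *)

Section OrbitSpace.
Local Open Scope quotient_scope.
Variables (p : nat) (M : Zp_space p).
Local Notation Y := (orbit_space M).
Local Notation orbit := (@Defs.orbit p M).
Local Notation Yp := (one_point_compactification Y).

Definition orbit_point (x : M) : Yp :=
  if pselect (free_part M x) is left h
  then Some (\pi_Y (exist _ x (mem_set h) : free_part M)) else None.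

Lemma orbit_pointE (z : free_part M) : orbit_point (set_val z) = Some (\pi_Y z).
Proof.
rewrite /orbit_point; case: pselect => [h|]; last by move=> []; exact: set_valP.
by congr (Some (\pi_Y _)); apply: val_inj.
Qed.

Lemma pi_orbit (z z' : free_part M) :
  \pi_Y z = \pi_Y z' <-> orbit (set_val z) = orbit (set_val z').
Proof.
split=> [/eqquotP/asboolP //|h]; apply/eqquotP; exact/asboolP.
Qed.

Lemma free_orbit_point x : free_part M x -> exists z : free_part M,
  set_val z = x /\ orbit_point x = Some (\pi_Y z).
Proof.
move=> Mx; pose z : free_part M := exist _ x (mem_set Mx).
by exists z; split=> //; rewrite -orbit_pointE.
Qed.

Lemma pi_orbit_continuous : continuous (fun z : free_part M => \pi_Y z : Y).
Proof. exact: (@pi_continuous _ {eq_quot (orbit_equiv M)}). Qed.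

Lemma orbit_point_cvg x : free_part M x -> open (free_part M) ->
  orbit_point @ x --> orbit_point x.
Proof.
move=> Mx oM; have [z [zx ->]] := free_orbit_point Mx => N /= NN.
have /nbhs_set_type[O [oO Oz ON]] : nbhs z (\pi_Y @^-1` (Some @^-1` N)).
  by apply: pi_orbit_continuous; exact: NN.
have : nbhs x (O `&` free_part M).
  apply: filterI; last exact: open_nbhs_nbhs.
  by apply: open_nbhs_nbhs; rewrite -zx.
apply: filterS => y [Oy My]; have [z' [z'y /= ->]] := free_orbit_point My.
by apply: ON; rewrite /= z'y.
Qed.

Definition descend (T : Type) (f : M -> T) (y : Y) : T := f (set_val (repr y)).

Definition orbit_invariant (T : Type) (f : M -> T) :=
  forall x x', free_part M x -> free_part M x' -> orbit x = orbit x' -> f x = f x'.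

Lemma descendE (T : Type) (f : M -> T) z : orbit_invariant f ->
  descend f (\pi_Y z) = f (set_val z).
Proof.
move=> fi; apply: fi; try exact: set_valP.
by apply/pi_orbit; rewrite reprK.
Qed.

Lemma descend_continuous (T : topologicalType) (f : M -> T) : orbit_invariant f ->
  (forall x, free_part M x -> f @ x --> f x) -> continuous (descend f).
Proof.
move=> fi fc; apply/quotient_continuous.
have -> : descend f \o \pi_Y = f \o set_val.
  by apply/funext => z /=; rewrite descendE.
move=> z; apply: continuous_comp; first exact: set_val_continuous.
by apply: fc; exact: set_valP.
Qed.

End OrbitSpace.

(** * Trivializing the flat line bundle over the orbit space *)

Section EquivariantUnit.
Local Open Scope quotient_scope.
Variables (R : realType) (p : nat) (M : Zp_space p) (tau : M -> M).
Local Notation C := (complexes R).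
Local Notation Y := (orbit_space M).
Local Notation orbit := (@Defs.orbit p M).
Local Notation Yp := (one_point_compactification Y).
Variable w : C.
Hypothesis Md : covering_dim_le M 2.
Hypothesis tau_c : continuous tau.
Hypothesis tau_p : iter p tau =1 id.
Hypothesis tau_orbit : forall x, [set iter k tau x | k in `I_p] = orbit x.
Hypothesis w_p : w ^+ p = 1.
Hypothesis w_unit : w * w^* = 1.
Hypothesis H2p : forall c : cech_cohomology Yp 2, c = 0.
Hypothesis H2c : forall c : cech_cohomology (corona R Y) 2, c = 0.

Let pp : prime p := zp_prime M.
Let Mc : compact [set: M] := @zp_compact p M.
Let Mh : hausdorff_space M := @zp_hausdorff p M.
Let Ms : @second_countable M := @zp_separable p M.

Lemma free_partE : free_part M = [set x | tau x <> x].
Proof.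
have fixedE s x := @iter_orbit_fixed M s p x (prime_gt1 pp).
apply/seteqP; split=> x /= h sx; apply: h.
  by apply/fixedE; rewrite -/(orbit x) -tau_orbit; exact/fixedE.
by apply/fixedE; rewrite tau_orbit; exact/fixedE.
Qed.

Lemma free_part_open : open (free_part M).
Proof. by rewrite free_partE; exact: free_open. Qed.

Lemma free_part_tau x : free_part M x -> free_part M (tau x).
Proof. by rewrite free_partE /= => Mx; apply/(free_tau pp tau_p). Qed.

Lemma orbit_tau x : orbit (tau x) = orbit x.
Proof.
have p0 := prime_gt0 pp.
have sub z : orbit (tau z) `<=` orbit z.
  rewrite -!tau_orbit => _ [k kp <-]; rewrite -iterSr.
  have [kp'|] := ltnP k.+1 p; first by exists k.+1.
  rewrite leq_eqVlt => /predU1P[pk|]; last by rewrite ltnS leqNgt kp.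
  by exists 0%N; [exact: p0|rewrite -pk tau_p].
apply/seteqP; split; first exact: sub.
have xE : x = iter p.-1 tau (tau x) by rewrite -iterSr prednK // tau_p.
rewrite {1}xE; elim: p.-1 => [|k IH]; first by [].
by apply: subset_trans IH; rewrite iterS; exact: sub.
Qed.

Lemma tau_orbit_invariant (T : Type) (f : M -> T) :
  (forall x, free_part M x -> f (tau x) = f x) -> orbit_invariant f.
Proof.
move=> ft x x' Mx _ xx'.
have : orbit x x'.
  by rewrite xx' -tau_orbit; exists 0%N => //; exact: prime_gt0.
rewrite -tau_orbit => -[k _ <-].
suff : f (iter k tau x) = f x /\ free_part M (iter k tau x) by case.
elim: k => [//|k [IH Mk]] /=; split; first by rewrite ft.
exact: free_part_tau.
Qed.

Lemma orbit_point_tau x : free_part M x -> orbit_point (tau x) = orbit_point x.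
Proof.
move=> Mx; have [z [zx ->]] := free_orbit_point Mx.
have [z' [z'x ->]] := free_orbit_point (free_part_tau Mx).
by congr Some; apply/pi_orbit; rewrite z'x zx orbit_tau.
Qed.

(** The orbit of [x'] is finite, hence closed; a function positive exactly off this orbit is summed
    over orbits of [tau]. *)
Lemma orbit_separation x x' : free_part M x -> free_part M x' ->
  orbit x <> orbit x' -> exists f : M -> R, [/\ continuous f, orbit_invariant f,
    0 < f x & f x' = 0].
Proof.
move=> Mx Mx' xx'.
have oc : closed (orbit x').
  apply: compact_closed => //; apply: finite_compact.
  by rewrite -tau_orbit; apply: finite_image; exact: finite_II.
have [phi [phic phi01 phiP]] := open_cozero R Mc Mh Ms (closed_openC oc).
have phi0 z : 0 <= phi z by case/andP: (phi01 z).
have orb_iter k z : orbit (iter k tau z) = orbit z.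
  by elim: k => //= k IH; rewrite orbit_tau.
have orb_refl z : orbit z z by rewrite -tau_orbit; exists 0%N => //; exact: prime_gt0 pp.
exists (fun z => \sum_(k < p) phi (iter k tau z)); split.
- move=> z.
  apply: (@cvg_bigsum R _ z _ _ _ (fun (k : 'I_p) y => phi (iter k tau y))) => k _.
  apply: (@continuous_comp _ _ _ (iter k tau) phi z); last exact: phic.
  exact: iter_continuous.
- by apply: tau_orbit_invariant => z _; rewrite (orbit_sum_tau pp tau_p).
- rewrite (bigD1 (Ordinal (prime_gt0 pp))) //= ltr_wpDr ?sumr_ge0 //.
  apply/phiP => x'x; apply: xx'.
  by move: x'x; rewrite -tau_orbit => -[k _ <-]; rewrite orb_iter.
rewrite big1 // => k _; apply/eqP; rewrite eq_le phi0 andbT leNgt.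
apply/negP => /phiP; apply; rewrite -(orb_iter k x'); exact: orb_refl.
Qed.

Lemma orbit_space_hausdorff : hausdorff_space Y.
Proof.
move=> y y' yy'; apply: contrapT => ne.
have Mr (z : Y) : free_part M (set_val (repr z)) := set_valP (repr z).
have [|f [fc fi fy fy']] := orbit_separation (Mr y) (Mr y').
  by move=> /pi_orbit; rewrite !reprK.
have Fc : continuous (descend f : Y -> R).
  by apply: descend_continuous => // x _; exact: fc.
have c0 : 0 < descend f y by [].
have c1 : descend f y' = 0 by [].
have h1 : descend f @ y --> descend f y by exact: Fc.
have h2 : descend f @ y' --> descend f y' by exact: Fc.
have [||z []] := yy' [set z | descend f y / 2 < descend f z]
    [set z | descend f z < descend f y / 2].
- apply: (@cvgr_gt R Y (nbhs y) _ (descend f) (descend f y) h1).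
  by rewrite ltr_pdivrMr // ltr_pMr // ltr1n.
- apply: (@cvgr_lt R Y (nbhs y') _ (descend f) (descend f y') h2).
  by rewrite c1 divr_gt0.
by move=> /= /lt_trans /[apply]; rewrite ltxx.
Qed.

Lemma orbit_space_level : exists g : M -> R, [/\ continuous g, orbit_invariant g,
  forall x, free_part M x -> 0 < g x <= 1, forall x, g (tau x) = g x &
  forall e, 0 < e -> compact [set y | e <= descend g y]].
Proof.
have [g [gc g01 gP gt]] := level_function R pp Mc Mh Ms tau_c tau_p.
have gi : orbit_invariant g by apply: tau_orbit_invariant => x _; exact: gt.
exists g; split=> // [x|e e0].
  by rewrite free_partE => /gP ->; case/andP: (g01 x).
have Kc : compact [set x | e <= g x].
  apply: subclosed_compact Mc _ => //.
  by apply: (@preimage_closed _ _ g [set y | e <= y]) => //; exact: closed_ge.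
have KM : [set x | e <= g x] `<=` free_part M.
  by rewrite free_partE => x /(lt_le_trans e0) /gP.
(* The superlevel set in [Y] is the image of the one in [M], which is compact and contains no fixed
   points. *)
rewrite (_ : [set y | _] = \pi_Y @` (@set_val _ (free_part M) @^-1` [set x | e <= g x])).
  apply: continuous_compact; last exact: set_type_compact.
  by apply: continuous_subspaceT; exact: pi_orbit_continuous.
apply/seteqP; split=> [y /= ey|_ [z ez <-]]; last by rewrite /= descendE.
by exists (repr y); rewrite ?reprK.
Qed.

Lemma orbit_space_locally_compact : locally_compact [set: Y].
Proof.
have [g [gc gi g01 gt gK]] := orbit_space_level.
have gYc : continuous (descend g : Y -> R).
  by apply: descend_continuous => // x _; exact: gc.
move=> y _; have gy : 0 < descend g y.
  by have /andP[] := g01 (set_val (repr y)) (set_valP (repr y)).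
exists [set z | descend g y / 2 <= descend g z].
  rewrite withinET.
  apply: (@filterS _ _ _ [set z | descend g y / 2 < descend g z]) => [z /ltW //|].
  have gyy : descend g @ y --> descend g y by exact: gYc.
  apply: (@cvgr_gt R Y (nbhs y) _ (descend g) (descend g y) gyy).
  by rewrite ltr_pdivrMr // ltr_pMr // ltr1n.
split; first by apply: gK; rewrite divr_gt0.
by apply: (@preimage_closed _ _ (descend g) [set t | descend g y / 2 <= t]) => //; exact: closed_ge.
Qed.

Lemma orbit_compactification_hausdorff : hausdorff_space Yp.
Proof.
apply: one_point_compactification_hausdorff; first exact: orbit_space_locally_compact.
exact: orbit_space_hausdorff.
Qed.

(** These are the sections of the flat line bundle over [Y]; values at fixed points are left
    arbitrary. *)
Definition equivariant (u : M -> C) :=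
  (forall x, free_part M x -> u @ x --> u x) /\
  (forall x, free_part M x -> u (tau x) = w * u x).

Lemma equivariant_mulJ u v : equivariant u -> equivariant v ->
  orbit_invariant (fun x => u x * (v x)^*) /\
  forall x, free_part M x -> (fun x => u x * (v x)^*) @ x --> u x * (v x)^*.
Proof.
move=> [uc ut] [vc vt]; split=> [|x Mx].
  apply: tau_orbit_invariant => x Mx.
  by rewrite ut // vt // rmorphM mulrACA w_unit mul1r.
by apply: cvgM; [exact: uc|apply: cvg_conj; exact: vc].
Qed.

Lemma equivariant_mulr u (h : Yp -> C) : equivariant u ->
  (forall y : Y, {for Some y, continuous h}) ->
  equivariant (fun x => u x * h (orbit_point x)).
Proof.
move=> [uc ut] hc; split=> x Mx; last by rewrite ut // orbit_point_tau // mulrA.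
apply: cvgM; first exact: uc.
apply: (@continuous_comp _ _ _ (@orbit_point p M) h x).
  exact: orbit_point_cvg Mx free_part_open.
by have [z [_ ->]] := free_orbit_point Mx; exact: hc.
Qed.

Lemma equivariant_sum (I : Type) (s : seq I) (u : I -> M -> C) :
  (forall i, equivariant (u i)) -> equivariant (fun x => \sum_(i <- s) u i x).
Proof.
move=> ui; split=> x Mx; first by apply: cvg_bigsum => i _; exact: (ui i).1.
by rewrite mulr_sumr; apply: eq_bigr => i _; exact: (ui i).2.
Qed.

Lemma equivariant_rank_one m (v : 'I_m -> M -> C) : (forall r, equivariant (v r)) ->
  (forall x, free_part M x -> \sum_r v r x * (v r x)^* = 1) ->
  rank_one (fun r s => descend (fun x => v r x * (v s x)^*) : Y -> C).
Proof.
move=> ve v1; split=> [r s|r s y|r s t u y|y].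
- by have [? ?] := equivariant_mulJ (ve r) (ve s); exact: descend_continuous.
- by rewrite /descend rmorphM /= conjCK mulrC.
- by rewrite /descend mulrACA [_^* * _^*]mulrC -mulrACA.
- exact: v1 (set_valP (repr y)).
Qed.

(** Here [u] is the scalar product of [v] with the vector [xi] obtained from the corona, and its
    squared modulus is the double sum of [rank_one_section_at_infinity]. *)
Lemma equivariant_almost_unit : exists (m : nat) (v : 'I_m -> M -> C) (u : M -> C)
    (g : M -> R) (e : R), [/\ 
  (forall r, equivariant (v r)) /\
    (forall x, free_part M x -> \sum_r v r x * (v r x)^* = 1),
  equivariant u,
  [/\ continuous g, orbit_invariant g & forall x, g (tau x) = g x],
  forall e, 0 < e -> compact [set y : Y | e <= descend g y] & 
  0 < e /\ forall x, free_part M x -> g x < e -> u x != 0].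
Proof.
have [v [vc vt v1]] := finite_type pp Mc Mh Ms Md tau_c tau_p w_p w_unit.
rewrite -free_partE in vc vt v1.
have ve r : equivariant (v r) by split=> x Mx; [exact: vc|exact: vt].
have [g [gc gi g01 gt gK]] := orbit_space_level.
have gYc : continuous (descend g : Y -> R).
  by apply: descend_continuous => // x _; exact: gc.
have gY01 y : 0 < descend g y <= 1 by exact: g01 (set_valP (repr y)).
have rkP := equivariant_rank_one ve v1.
have [xi [e [e0 xic xiP]]] := @rank_one_section_at_infinity R Y (stone_cech R Y)
  (@to_stone_cech R Y) (@stone_cech_compact R Y) (@stone_cech_hausdorff R Y)
  (@eta_continuous R Y) (@stone_cech_dense R Y) (@stone_cech_extend R Y)
  (descend g) gYc gY01 gK _ _ H2c rkP.
(* The value at infinity is a default; continuity is used at the points of [Y] only. *)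
pose h r (o : Yp) : C := if o is Some y then (xi r y)^* else 0.
have hc r (y : Y) : {for Some y, continuous (h r)}.
  by move=> N /= hN; apply: (cvg_conj (xic r y)).
exists _, v, (fun x => \sum_r v r x * h r (orbit_point x)), g, e; split=> //.
  by apply: equivariant_sum => r; apply: equivariant_mulr => //.
split=> // x Mx gx; have [z [zx zp]] := free_orbit_point Mx.
apply/eqP => u0; have := xiP (\pi_Y z); rewrite descendE // zx => /(_ gx)/eqP; apply.
transitivity ((\sum_r v r x * h r (orbit_point x)) * (\sum_r v r x * h r (orbit_point x))^*).
  rewrite mulr_suml; apply: eq_bigr => r _.
  rewrite rmorph_sum mulr_sumr; apply: eq_bigr => s _.
  have [Pi _] := equivariant_mulJ (ve r) (ve s).
  by rewrite descendE // zx zp /h rmorphM /= conjCK; ring.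
by rewrite u0 mul0r.
Qed.

(** Joining [u1] to the tuple damped by [rho] gives a normalized tuple [V] whose projection extends
    to the one-point compactification. A unit section [f] of the extension spans the same line as
    [V], so their scalar product is an equivariant unit. *)
Theorem equivariant_unit : exists2 u : M -> C, equivariant u &
  forall x, free_part M x -> u x * (u x)^* = 1.
Proof.
have [m [v [u1 [g [e [[ve v1] u1e [gc gi gt] gK [e0 u1P]]]]]]] := equivariant_almost_unit.
have e2 : 0 < e / 2 by rewrite divr_gt0.
(* [rho] vanishes near infinity, where the projection is then constant. *)
pose rho x : R := Num.max 0 (g x - e / 2).
pose W (r : 'I_m.+1) x : C :=
  if unlift ord_max r is Some j then v j x * ofR (rho x) else u1 x.
have We r : equivariant (W r).
  rewrite /W; case: unliftP => [j _|_] //; split=> x Mx.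
    apply: cvgM; first exact: (ve j).1.
    apply: cvg_ofR; apply: (@continuous_max R M (fun=> 0) (fun y => g y - e / 2)).
      exact: cvg_cst.
    by apply: cvgB; [exact: gc|exact: cvg_cst].
  by rewrite (ve j).2 // /rho gt mulrA.
(* Where [g < e] the last coordinate is nonzero; elsewhere [rho] is at least [e / 2] and some [v j]
   is nonzero. *)
have Wpos x : free_part M x -> 0 < sqnorm (W^~ x).
  move=> Mx; have [ge|ge] := ltP (g x) e.
    by apply: (@sqnorm_gt0 _ _ _ ord_max); rewrite /W unlift_none; exact: u1P.
  have [j vj] : exists j, v j x != 0.
    apply/existsP; apply: contraT; rewrite negb_exists => /forallP v0.
    have := v1 x Mx; rewrite big1 => [/eqP|j _]; first by rewrite eq_sym oner_eq0.
    by have := v0 j; rewrite negbK => /eqP ->; rewrite mul0r.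
  apply: (@sqnorm_gt0 _ _ _ (lift ord_max j)); rewrite /W liftK mulf_neq0 //.
  by rewrite gt_eqF // ofR_lt /rho lt_max; apply/orP; right; lra.
pose V r x := normalize (W^~ x) r.
have V1 x : free_part M x -> \sum_r V r x * (V r x)^* = 1.
  by move=> Mx; exact/normalizeE/Wpos.
have Ve r : equivariant (V r).
  split=> x Mx.
    by apply: normalize_cvg; [exact: Wpos|move=> k; exact: (We k).1].
  rewrite /V /normalize (We r).2 // mulrA; congr (_ / ofR (Num.sqrt _)).
  suff [] : ofR (sqnorm (W^~ (tau x))) = ofR (sqnorm (W^~ x)) by [].
  rewrite -!sqnormE; apply: eq_bigr => k _.
  by rewrite (We k).2 // rmorphM mulrACA w_unit mul1r.
(* Here only the last coordinate of [V] survives, so the projection is a constant matrix unit. *)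
have V0 x r s : free_part M x -> g x < e / 2 ->
    V r x * (V s x)^* = ((r == ord_max) && (s == ord_max))%:R.
  move=> Mx gx; have Vj k : k != ord_max -> V k x = 0.
    rewrite /V /normalize /W; case: unliftP => [j _ _|->]; last by rewrite eqxx.
    have -> : rho x = 0 by rewrite /rho max_l // subr_le0 ltW.
    by rewrite [ofR 0](_ : _ = 0) // mulr0 mul0r.
  have [->|/Vj ->] := eqVneq r ord_max; last by rewrite mul0r.
  have [->|/Vj ->] := eqVneq s ord_max; last by rewrite rmorph0 mulr0.
  have := V1 x Mx; rewrite (bigD1 ord_max) //= big1 ?addr0 // => k /Vj ->.
  by rewrite mul0r.
pose P r s (o : Yp) : C := if o is Some y then descend (fun x => V r x * (V s x)^*) y
  else ((r == ord_max) && (s == ord_max))%:R.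
have rkV := equivariant_rank_one Ve V1.
have [Vc VJ VV VS] := rkV.
have Pnone r s : P r s @ (None : Yp) --> P r s None.
  pose K := [set y : Y | e / 2 <= descend g y].
  have nK : nbhs (None : Yp) ((Some @` ~` K) `|` [set None]).
    exists K => //; split; first exact: gK.
    by apply: compact_closed; [exact: orbit_space_hausdorff|exact: gK].
  apply: (@cvg_eq_near Yp C None _ (P r s) (fun=> ((r == ord_max) && (s == ord_max))%:R) nK).
    move=> _ [[y /negP Ky <-]|->] //=; apply: V0; first exact: set_valP.
    by rewrite ltNge.
  exact: (@cst_continuous Yp C _ None).
have rkP : rank_one P.
  split=> [r s [y|]|r s [y|]|r s t u [y|]|[y|]].
  - exact: Vc.
  - exact: Pnone.
  - exact: VJ.
  - by rewrite rmorph_nat andbC.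
  - exact: VV.
  - by rewrite -!natrM !mulnb; congr (nat_of_bool _)%:R; do 4!case: (_ == _).
  - exact: VS.
  rewrite (bigD1 ord_max) //= eqxx big1 ?addr0 // => k /negPf ->.
  by [].
have [f fF] := rank_one_section rkP one_point_compactification_compact
  orbit_compactification_hausdorff H2p.
exists (fun x => \sum_r V r x * (f r (orbit_point x))^*).
  apply: equivariant_sum => r.
  apply: (@equivariant_mulr (V r) (fun o => (f r o)^*)) => // y.
  by apply: cvg_conj; exact: fF.1.
move=> x Mx; have [z [zx zp]] := free_orbit_point Mx.
have [_ _ PP P1] := rkP.
(* Expanding the squared modulus gives the sum of [P r s * P s r]; exchanging indices makes it the
   square of the trace. *)
transitivity (\sum_r \sum_s P r r (orbit_point x) * P s s (orbit_point x)).
  rewrite mulr_suml; apply: eq_bigr => r _.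
  rewrite rmorph_sum mulr_sumr; apply: eq_bigr => s _.
  have [Pi _] := equivariant_mulJ (Ve r) (Ve s).
  rewrite -PP -(fF.2 s r) // rmorphM /= conjCK [P r s _](_ : _ = V r x * (V s x)^*); last first.
    by rewrite zp /P descendE // zx.
  by rewrite /=; ring.
under eq_bigr do rewrite -mulr_sumr P1 mulr1.
exact: P1.
Qed.

End EquivariantUnit.

(** * Crossed products *)

Section Adjoint.
Variables (C : numClosedFieldType) (n : nat).
Implicit Types (A B : 'M[C]_n) (z : 'I_n -> C).

Definition adjmx A : 'M[C]_n := \matrix_(i, j) (A j i)^*.

Lemma adjmxM A B : adjmx (A *m B) = adjmx B *m adjmx A.
Proof.
apply/matrixP => i j; rewrite !mxE rmorph_sum; apply: eq_bigr => k _.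
by rewrite !mxE rmorphM mulrC.
Qed.

(** For entries of modulus one this is conjugation by a diagonal unitary. *)
Definition dconj z A : 'M[C]_n := \matrix_(i, j) (z i * A i j * (z j)^*).

Lemma dconj_linear z (c : C) A B : dconj z (c *: A + B) = c *: dconj z A + dconj z B.
Proof. by apply/matrixP => i j; rewrite !mxE; ring. Qed.

Lemma dconj_adj z A : dconj z (adjmx A) = adjmx (dconj z A).
Proof. by apply/matrixP => i j; rewrite !mxE !rmorphM /= conjCK; ring. Qed.

Section Unit.
Variable z : 'I_n -> C.
Hypothesis z1 : forall i, z i * (z i)^* = 1.

Lemma dconj1 : dconj z 1%:M = 1%:M.
Proof.
apply/matrixP => i j; rewrite !mxE; case: eqVneq => [->|_].
  by rewrite mulr1 z1.
by rewrite mulr0 mul0r.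
Qed.

Lemma dconjM A B : dconj z (A *m B) = dconj z A *m dconj z B.
Proof.
apply/matrixP => i j; rewrite !mxE mulr_sumr mulr_suml; apply: eq_bigr => k _.
rewrite !mxE.
rewrite [RHS](_ : _ = z i * A i k * B k j * (z j)^* * (z k * (z k)^*)); last by ring.
by rewrite z1; ring.
Qed.

Lemma dconjK A : dconj (fun i => (z i)^*) (dconj z A) = A.
Proof.
apply/matrixP => i j; rewrite !mxE conjCK.
rewrite [LHS](_ : _ = A i j * (z i * (z i)^*) * (z j * (z j)^*)); last by ring.
by rewrite !z1 !mulr1.
Qed.

End Unit.
End Adjoint.

(** * Characters of the cyclic group and the Fourier matrix *)

Section Character.
Variables (C : numClosedFieldType) (p : nat) (w : C).
Hypothesis p_prime : prime p.
Hypothesis w_p : w ^+ p = 1.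
Hypothesis w_unit : w * w^* = 1.
Hypothesis w_neq1 : w != 1.
Implicit Types k l : 'Z_p.

Definition chi k : C := w ^+ k.

Lemma chiD k l : chi (k + l) = chi k * chi l.
Proof.
have wq : w ^+ (Zp_trunc p).+2 = 1 by rewrite Zp_cast // prime_gt1.
rewrite /chi (_ : nat_of_ord (k + l) = ((k + l) %% (Zp_trunc p).+2)%N) //.
by rewrite expr_mod // exprD.
Qed.

Lemma chiM k l : chi (k * l) = chi l ^+ k.
Proof.
have wq : w ^+ (Zp_trunc p).+2 = 1 by rewrite Zp_cast // prime_gt1.
rewrite /chi (_ : nat_of_ord (k * l) = ((k * l) %% (Zp_trunc p).+2)%N) //.
by rewrite expr_mod // mulnC exprM.
Qed.

Lemma chi0 : chi 0 = 1. Proof. by []. Qed.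

Lemma chi_unit k : chi k * (chi k)^* = 1.
Proof. by rewrite /chi rmorphXn -exprMn w_unit expr1n. Qed.

Lemma chiN k : chi (- k) = (chi k)^*.
Proof.
by rewrite -[LHS]mulr1 -(chi_unit k) mulrA -chiD addNr mul1r.
Qed.

Lemma chi_neq1 k : k != 0 -> chi k != 1.
Proof.
move=> k0; apply/eqP => k1; move/eqP: w_neq1; apply.
have k_gt0 : (0 < k)%N by rewrite lt0n; apply: contra k0 => /eqP k0; apply/eqP/val_inj.
have kp : (k < p)%N by rewrite -[X in (_ < X)%N](Zp_cast (prime_gt1 p_prime)) ltn_ord.
have kcop : gcdn k p = 1%N.
  apply/eqP; rewrite -/(coprime k p) coprime_sym prime_coprime //.
  by apply/negP => /(dvdn_leq k_gt0); rewrite leqNgt kp.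
have [km kn E _] := egcdnP p k_gt0.
have : w ^+ (km * k) = 1 by rewrite mulnC exprM -/(chi k) k1 expr1n.
by rewrite E kcop addn1 exprS mulnC exprM w_p expr1n mulr1.
Qed.

(** Translating the index by 1 multiplies the sum by [chi l], which differs from 1 unless
    [l = 0]. *)
Lemma chi_sum l : \sum_k chi (k * l) = (if l == 0 then p%:R else 0).
Proof.
case: eqVneq => [->|l0].
  under eq_bigr do rewrite mulr0 chi0.
  by rewrite sumr_const card_ord Zp_cast // prime_gt1.
set S := \sum_k _; have : S = chi l * S.
  rewrite {1}/S (reindex_inj (addrI 1)) mulr_sumr; apply: eq_bigr => k _.
  by rewrite mulrDl mul1r chiD.
move=> /eqP; rewrite -subr_eq0 -{1}[S]mul1r -mulrBl mulf_eq0 subr_eq0 eq_sym.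
by rewrite (negPf (chi_neq1 l0)) => /eqP.
Qed.

Definition fourier : 'M[C]_((Zp_trunc p).+2) := \matrix_(i, j) chi (i * j : 'Z_p).

Lemma p_neq0 : p%:R != 0 :> C.
Proof. by rewrite pnatr_eq0 -lt0n prime_gt0. Qed.

Lemma fourierK : adjmx fourier *m fourier = p%:R%:M.
Proof.
apply/matrixP => i j; rewrite !mxE.
under eq_bigr => k _ do rewrite !mxE -chiN -chiD -mulrN -mulrDr.
by rewrite chi_sum addrC subr_eq0 eq_sym -mulr_natr; case: eqP => _; rewrite ?mulr0n ?mulr1n.
Qed.

Lemma fourierK' : fourier *m adjmx fourier = p%:R%:M.
Proof.
apply/matrixP => i j; rewrite !mxE.
under eq_bigr => k _ do rewrite !mxE -chiN -chiD -mulNr -mulrDl mulrC.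
by rewrite chi_sum subr_eq0; case: eqP => _; rewrite ?mulr0n ?mulr1n.
Qed.

(** Since [fourier] is [p^(1/2)] times a unitary matrix, the factor makes this a unitary
    conjugation. *)
Definition fconj (A : 'M[C]_((Zp_trunc p).+2)) := p%:R^-1 *: (adjmx fourier *m A *m fourier).
Definition fconj_inv (A : 'M[C]_((Zp_trunc p).+2)) := p%:R^-1 *: (fourier *m A *m adjmx fourier).

Lemma fconjK : cancel fconj fconj_inv.
Proof.
move=> A; rewrite /fconj_inv /fconj -scalemxAr -scalemxAl scalerA !mulmxA fourierK'.
rewrite -[_ *m fourier *m _]mulmxA fourierK' mul_mx_scalar mul_scalar_mx !scalerA.
by rewrite -[RHS]scale1r; congr (_ *: _); field; exact: p_neq0.
Qed.

Lemma fconj_invK : cancel fconj_inv fconj.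
Proof.
move=> A; rewrite /fconj_inv /fconj -scalemxAr -scalemxAl scalerA !mulmxA fourierK.
rewrite -[_ *m _ *m fourier]mulmxA fourierK mul_mx_scalar mul_scalar_mx !scalerA.
by rewrite -[RHS]scale1r; congr (_ *: _); field; exact: p_neq0.
Qed.

Lemma fconjM A B : fconj (A *m B) = fconj A *m fconj B.
Proof.
have -> : fconj A *m fconj B = (p%:R^-1 * p%:R^-1) *:
    (adjmx fourier *m A *m (fourier *m adjmx fourier) *m B *m fourier).
  by rewrite /fconj -scalemxAl -scalemxAr scalerA !mulmxA.
rewrite fourierK' mul_mx_scalar -!scalemxAl scalerA -mulrA mulVf ?mulr1 ?p_neq0 //.
by rewrite /fconj !mulmxA.
Qed.

Lemma fconj1 : fconj 1%:M = 1%:M.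
Proof.
rewrite /fconj mulmx1 fourierK scale_scalar_mx mulVf //; exact: p_neq0.
Qed.

Lemma fconj_linear c A B : fconj (c *: A + B) = c *: fconj A + fconj B.
Proof.
rewrite /fconj mulmxDr mulmxDl scalerDr -scalemxAr -scalemxAl !scalerA mulrC.
by [].
Qed.

Lemma fconj_adj A : fconj (adjmx A) = adjmx (fconj A).
Proof.
have adjK B : adjmx (adjmx B) = B by apply/matrixP => i j; rewrite !mxE conjCK.
have adjZ (c : C) B : adjmx (c *: B) = c^* *: adjmx B.
  by apply/matrixP => i j; rewrite !mxE rmorphM.
by rewrite /fconj adjZ !adjmxM adjK fmorphV rmorph_nat mulmxA.
Qed.

End Character.

(** * Elements of the crossed product as matrix functions *)

Section Transform.
Variables (R : realType) (p : nat) (M : Zp_space p).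
Local Notation C := (complexes R).
Local Notation th := (@zp_act p M).
Variable w : C.
Hypothesis w_p : w ^+ p = 1.
Hypothesis w_unit : w * w^* = 1.
Hypothesis w_neq1 : w != 1.
Implicit Types (a b : crossed_product R M) (x : M) (i j k l : 'Z_p).

Let pp : prime p := zp_prime M.

(* The matrix of [a] acting on l^2 of the orbit of [x], indexed by Z_p (for a fixed point,
   on l^2 of Z_p). *)
Definition regular a x : 'M[C]_((Zp_trunc p).+2) :=
  \matrix_(i, j) cfun_val (a (j - i : 'Z_p)) (iter (i : 'Z_p) th x).

Lemma cfun_val_sum (I : Type) (r : seq I) (P : pred I) (F : I -> cfun R M) x :
  cfun_val (\sum_(i <- r | P i) F i) x = \sum_(i <- r | P i) cfun_val (F i) x.
Proof. exact: (big_morph (fun f : cfun R M => cfun_val f x)). Qed.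

Lemma regularM a b x : regular (a * b) x = regular a x *m regular b x.
Proof.
apply/matrixP => i j; rewrite !mxE ffunE cfun_val_sum.
rewrite (reindex_inj (addIr (- (i : 'Z_p)))); apply: eq_bigr => k _.
rewrite -[LHS]/(cfun_val (a (k - i)) (iter (i : 'Z_p) th x) *
  cfun_val (b (j - i - ((k : 'Z_p) - i))) (iter ((k : 'Z_p) - i)%R th (iter (i : 'Z_p) th x))).
by rewrite !mxE -zp_act_iterD subrK opprB addrA subrK.
Qed.

Lemma regular1 x : regular 1 x = 1%:M.
Proof.
apply/matrixP => i j; rewrite !mxE ffunE subr_eq0 eq_sym.
by case: eqP.
Qed.

Lemma regular_linear c a b x :
  regular (c *: a + b) x = c *: regular a x + regular b x.
Proof. by apply/matrixP => i j; rewrite !mxE !ffunE. Qed.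

Lemma regular_star a x : regular (cp_star a) x = adjmx (regular a x).
Proof.
apply/matrixP => i j; rewrite !mxE ffunE.
rewrite -[LHS]/((cfun_val (a (- ((j : 'Z_p) - i)))
  (iter ((j : 'Z_p) - i)%R th (iter (i : 'Z_p) th x)))^*).
by rewrite -zp_act_iterD subrK opprB.
Qed.

Definition transform a x := fconj w (regular a x).

Lemma transformM a b x : transform (a * b) x = transform a x *m transform b x.
Proof. by rewrite /transform regularM (fconjM pp). Qed.

Lemma transform1 x : transform 1 x = 1%:M.
Proof. by rewrite /transform regular1 (fconj1 pp). Qed.

Lemma transform_linear c a b x :
  transform (c *: a + b) x = c *: transform a x + transform b x.
Proof. by rewrite /transform regular_linear fconj_linear. Qed.

Lemma transform_star a x : transform (cp_star a) x = adjmx (transform a x).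
Proof. by rewrite /transform regular_star fconj_adj. Qed.

Lemma transform_inj a b : (forall x, transform a x = transform b x) -> a = b.
Proof.
move=> ab; apply/ffunP => k; apply: cfunP => x.
have : regular a x = regular b x.
  by rewrite -[LHS](fconjK pp w_p w_unit w_neq1) -/(transform a x) ab fconjK.
(* Row 0 of the regular matrix lists the values of all coefficients at [x]. *)
by move=> /matrixP/(_ 0 k); rewrite !mxE subr0.
Qed.

Lemma transformE a x j l : transform a x j l = p%:R^-1 *
  \sum_i \sum_k chi w (- (i * j)) * cfun_val (a (k - i)) (iter i th x) * chi w (k * l).
Proof.
rewrite !mxE; congr (_ * _); rewrite exchange_big; apply: eq_bigr => k _.
rewrite !mxE mulr_suml; apply: eq_bigr => i _.
by rewrite !mxE (chiN pp).
Qed.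

Lemma transform_cvg a j l : continuous (fun x => transform a x j l).
Proof.
move=> x; rewrite (_ : (fun y => _) = (fun y => p%:R^-1 * \sum_i \sum_k
  chi w (- (i * j)) * cfun_val (a (k - i)) (iter i th y) * chi w (k * l))).
  apply: cvgM; first exact: cvg_cst.
  apply: cvg_bigsum => i _; apply: cvg_bigsum => k _.
  apply: cvgM; last exact: cvg_cst.
  apply: cvgM; first exact: cvg_cst.
  have /continuous_predP cs := valP (cfun_shift i (a (k - i))).
  exact: cs.
by apply/funext => y; rewrite transformE.
Qed.

Lemma iter_act k x : iter k th (th x) = iter (k + 1)%R th x.
Proof. by rewrite zp_act_iterD. Qed.

(** Moving the base point along its orbit shifts both indices of the regular matrix by 1, which the
    Fourier transform turns into a character. *)
Lemma transform_act a x j l : transform a (th x) j l = chi w (j - l) * transform a x j l.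
Proof.
apply: etrans (transformE a (th x) j l) _.
apply: etrans (congr1 ( *%R (chi w (j - l))) (esym (transformE a x j l))).
rewrite [RHS]mulrCA.
apply: (congr1 ( *%R p%:R^-1)); rewrite mulr_sumr.
rewrite [RHS](reindex_inj (addIr 1)); apply: eq_bigr => i _.
rewrite mulr_sumr [RHS](reindex_inj (addIr 1)); apply: eq_bigr => k _.
rewrite iter_act (_ : k + 1 - (i + 1) = k - i); last by ring.
have E : chi w (- (i * j)) * chi w (k * l) =
    chi w (j - l) * (chi w (- ((i + 1) * j)) * chi w ((k + 1) * l)).
  by rewrite -!(chiD pp w_p); congr (chi w _); ring.
by rewrite [LHS]mulrAC E -[LHS]mulrA; congr (_ * _); exact: mulrAC.
Qed.

(** The coefficients [f k] are row 0 of the inverse Fourier conjugate of [S]; the condition along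
    orbits determines the other rows. *)
Lemma transform_surj (S : M -> 'M[C]_((Zp_trunc p).+2)) :
  (forall j l, continuous (fun x => S x j l)) ->
  (forall x j l, S (th x) j l = chi w (j - l) * S x j l) ->
  exists a, forall x, transform a x = S x.
Proof.
move=> Sc Sth.
pose f (k : 'Z_p) x : C := p%:R^-1 * \sum_j \sum_l S x j l * chi w (- (k * l)).
have fc k : f k \in @continuous_pred R M.
  apply/continuous_predP => x; apply: cvgM; first exact: cvg_cst.
  apply: cvg_bigsum => j _; apply: cvg_bigsum => l _.
  by apply: cvgM; [exact: Sc|exact: cvg_cst].
have Siter (i : nat) x j l : S (iter i th x) j l = chi w (j - l) ^+ i * S x j l.
  elim: i => [|i IH]; first by rewrite mul1r.
  by rewrite iterS Sth IH exprS mulrA.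
exists [ffun k => CFun (fc k)] => x.
rewrite -[RHS](fconj_invK pp w_p w_unit w_neq1); congr (fconj _ _).
apply/matrixP => i k; rewrite !mxE ffunE /=; congr (_ * _).
rewrite exchange_big; apply: eq_bigr => l _.
rewrite !mxE mulr_suml; apply: eq_bigr => j _.
rewrite !mxE Siter -(chiM pp w_p) -(chiN pp w_p w_unit).
rewrite [LHS]mulrAC [RHS]mulrAC -!(chiD pp w_p); congr (chi w _ * _).
by ring.
Qed.

End Transform.

(** The action on [M'] pulled back to [M] has the orbits of the given action, but may run through
    each of them in another order. *)
Lemma conjugate_action (p : nat) (M M' : Zp_space p) (F : M -> M') (G : M' -> M) :
  continuous F -> continuous G -> cancel F G -> cancel G F ->
  (forall x, F @` Defs.orbit x = Defs.orbit (F x)) ->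
  let tau := G \o @zp_act p M' \o F in
  [/\ continuous tau, iter p tau =1 id &
      forall x, [set iter k tau x | k in `I_p] = Defs.orbit x].
Proof.
move=> Fc Gc FK GK orb tau.
have tauE k x : iter k tau x = G (iter k (@zp_act p M') (F x)).
  by elim: k => [|k IH] /=; rewrite ?FK // IH /tau /= GK.
split=> [x|x|x].
- apply: continuous_comp; first exact: Fc.
  by apply: continuous_comp; [exact: zp_act_continuous|exact: Gc].
- by rewrite tauE zp_iter FK.
transitivity (G @` (F @` Defs.orbit x)).
  rewrite orb; apply/seteqP; split=> [_ [k kp <-]|_ [_ [k kp <-] <-]].
    by exists (iter k (@zp_act p M') (F x)); [exists k|rewrite tauE].
  by exists k => //; rewrite tauE.
rewrite image_comp; apply/seteqP; split=> [_ [y yx <-]|y yx] /=.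
  by rewrite FK.
by exists y; rewrite //= FK.
Qed.

Lemma untwist_unit (C : numClosedFieldType) (w v t t' : C) (j l : nat) :
  w * w^* = 1 -> t' = w ^+ j * (w^*) ^+ l * t ->
  (w * v)^* ^+ j * (w * v) ^+ l * t' = v^* ^+ j * v ^+ l * t.
Proof.
move=> w1 ->; rewrite rmorphM !exprMn /=.
transitivity ((w * w^*) ^+ j * (w * w^*) ^+ l * (v^* ^+ j * v ^+ l * t)).
  by rewrite !exprMn; ring.
by rewrite w1 !expr1n !mul1r.
Qed.

(** * Transport along the orbit equivalence *)

Section Transport.
Variables (R : realType) (p : nat) (M M' : Zp_space p).
Variables (F : M -> M') (G : M' -> M).
Local Notation C := (complexes R).
Variables (w : C) (u u' : M -> C).
Hypothesis Fc : continuous F.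
Hypothesis Gc : continuous G.
Hypothesis FK : cancel F G.
Hypothesis GK : cancel G F.
Hypothesis orb : forall x, F @` Defs.orbit x = Defs.orbit (F x).
Hypothesis w_p : w ^+ p = 1.
Hypothesis w_unit : w * w^* = 1.
Hypothesis w_neq1 : w != 1.
Local Notation tau := (G \o @zp_act p M' \o F).
Hypothesis ue : equivariant (@zp_act p M) w u.
Hypothesis u1 : forall x, free_part M x -> u x * (u x)^* = 1.
Hypothesis u'e : equivariant tau w u'.
Hypothesis u'1 : forall x, free_part M x -> u' x * (u' x)^* = 1.

Let pp : prime p := zp_prime M.

(* At a fixed point the value 1 is arbitrary, since [transform] is diagonal there. *)
Definition twist_unit (x : M) (j : 'Z_p) : C :=
  if `[< free_part M x >] then (u' x * (u x)^*) ^+ j else 1.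

Lemma twist_unit1 x j : twist_unit x j * (twist_unit x j)^* = 1.
Proof.
rewrite /twist_unit; case: asboolP => [Mx|_]; last by rewrite rmorph1 mulr1.
rewrite rmorphXn -exprMn rmorphM /= conjCK mulrACA u'1 // mul1r mulrC.
by rewrite u1 // expr1n.
Qed.

Variable a : crossed_product R M.
Let T := transform w a.

Definition twisted (x : M) (j l : 'Z_p) : C :=
  twist_unit x j * T x j l * (twist_unit x l)^*.

Lemma zp_act_iter : iter p (@zp_act p M) =1 id.
Proof. by rewrite zp_iter. Qed.

Lemma zp_act_fixed x : ~ free_part M x -> zp_act x = x.
Proof. by move=> h; apply: contrapT. Qed.

(** At a fixed point [transform_act] says that the entry equals [chi w (j - l)] times itself, and
    this factor is not 1. *)
Lemma T_fixed x j l : ~ free_part M x -> j != l -> T x j l = 0.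
Proof.
move=> nMx jl; have := transform_act w_p w_unit a x j l; rewrite zp_act_fixed // -/(T x j l).
move=> /eqP; rewrite -subr_eq0 -{1}[T x j l]mul1r -mulrBl mulf_eq0.
rewrite subr_eq0 eq_sym (negPf (chi_neq1 pp w_p w_neq1 _)) ?subr_eq0 //=.
by move/eqP.
Qed.

Lemma T_cvg x j l : (fun y => T y j l) @ x --> T x j l.
Proof. exact: transform_cvg. Qed.

(** Near a fixed point the units may oscillate. The diagonal entries are unaffected, and the others
    tend to 0 because the multipliers have modulus one. *)
Lemma twisted_cvg j l : continuous (fun x => twisted x j l).
Proof.
move=> x; have [Mx|nMx] := pselect (free_part M x).
  have Mo : open (free_part M).
    exact: (free_part_open (@zp_act_continuous p M) (fun=> erefl)).
  pose s y : C := (u' y * (u y)^*) ^+ j * T y j l * ((u' y * (u y)^*) ^+ l)^*.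
  pose A y : C := u' y * (u y)^*.
  have Ac : A @ x --> A x by apply: cvgM; [exact: u'e.1|apply: cvg_conj; exact: ue.1].
  have AcX (k : nat) : (fun y => A y ^+ k) @ x --> A x ^+ k.
    elim: k => [|k IH]; first exact: cvg_cst.
    have -> : (fun y => A y ^+ k.+1) = (fun y => A y * A y ^+ k).
      by apply/funext => y; rewrite exprS.
    by rewrite [A x ^+ _]exprS; apply: cvgM; [exact: Ac|exact: IH].
  apply: (@cvg_eq_near _ _ x (free_part M) _ s).
  - by apply: open_nbhs_nbhs.
  - by move=> y My; rewrite /twisted /twist_unit; case: asboolP.
  apply: cvgM; last by apply: cvg_conj; exact: AcX.
  by apply: cvgM; [exact: AcX|exact: T_cvg].
have [->|jl] := eqVneq j l.
  rewrite (_ : (fun y => _) = fun y => T y l l); first exact: T_cvg.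
  apply/funext => y; rewrite /twisted mulrAC mulrC.
  by rewrite twist_unit1 mulr1.
rewrite /continuous_at {2}/twisted T_fixed // mulr0 mul0r.
apply: norm_cvg0.
have nt y k : `|twist_unit y k| = 1.
  apply/eqP; rewrite -(@pexpr_eq1 _ _ 2) // normCK; exact/eqP/twist_unit1.
rewrite (_ : (fun y => _) = fun y => `|T y j l|).
  rewrite -(@normr0 _ C) -(T_fixed nMx jl); apply: cvg_norm; exact: T_cvg.
apply/funext => y; rewrite /twisted !normrM norm_conjC.
by rewrite [X in X * _ * _]nt [X in _ * X]nt mul1r mulr1.
Qed.

Lemma twisted_tau x j l : twisted (tau x) j l = chi w (j - l) * twisted x j l.
Proof.
have [tc tp torb] := conjugate_action Fc Gc FK GK orb.
have [Mx|nMx] := pselect (free_part M x); last first.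
  have tx : tau x = x.
    by apply: contrapT => h; apply: nMx; rewrite (free_partE torb).
  rewrite tx; have [->|jl] := eqVneq j l; first by rewrite subrr mul1r.
  by rewrite /twisted T_fixed // !(mulr0, mul0r).
have Mtx : free_part M (tau x) by exact: (free_part_tau tp torb).
(* The powers of [u] cancel the character of the given action, so [K] depends only on the orbit and
   is also invariant under [tau]; the powers of [u'] then bring in the character of [tau]. *)
pose K y : C := ((u y)^*) ^+ j * u y ^+ l * T y j l.
have chiE : chi w (j - l) = w ^+ j * (w^*) ^+ l.
  by rewrite (chiD pp w_p) (chiN pp w_p w_unit) /chi rmorphXn.
have Ki : orbit_invariant K.
  apply: (tau_orbit_invariant zp_act_iter (fun=> erefl)) => y My.
  have tE : T (zp_act y) j l = w ^+ j * (w^*) ^+ l * T y j l.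
    by rewrite -chiE; exact: transform_act.
  rewrite /K (ue.2 _ My); exact: untwist_unit tE.
have sE y : free_part M y -> twisted y j l = u' y ^+ j * ((u' y)^*) ^+ l * K y.
  move=> My; rewrite /twisted /twist_unit; case: asboolP => // _.
  by rewrite /K rmorphXn rmorphM /= conjCK !exprMn; ring.
rewrite !sE // u'e.2 // rmorphM !exprMn chiE.
rewrite (Ki (tau x) x Mtx Mx (orbit_tau tp torb x)) /=.
by ring.
Qed.

(** Read on [M'] through [G], the map [tau] becomes the action of [M'], so [twisted_tau] is the
    condition in [transform_surj]. *)
Lemma transport : exists b : crossed_product R M',
  forall x, transform w b (F x) = dconj (twist_unit x) (T x).
Proof.
have [||b bE] := @transform_surj R p M' w w_p w_unit w_neq1
  (fun y => dconj (twist_unit (G y)) (T (G y))).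
- move=> j l y; rewrite (_ : (fun y => _) = (fun x => twisted x j l) \o G).
    by apply: continuous_comp; [exact: Gc|exact: twisted_cvg].
  by apply/funext => z /=; rewrite mxE.
- move=> y j l; have := twisted_tau (G y) j l; rewrite /= GK => h.
  by rewrite [LHS]mxE; apply: etrans h _; rewrite [X in _ = _ * X]mxE.
by exists b => x; rewrite bE FK.
Qed.

End Transport.

Lemma root_of_unity (R : realType) (p : nat) : prime p ->
  exists w : complexes R, [/\ w ^+ p = 1, w * w^* = 1 & w != 1].
Proof.
move=> pp; have p0 : (p%:R : R) != 0 by rewrite pnatr_eq0 -lt0n prime_gt0.
have T0 : (pi *+ 2 : R) != 0 by rewrite mulrn_eq0 /= gt_eqF // pi_gt0.
exists (cis (pi *+ 2 / p%:R)); split; last 1 first.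
- apply/eqP => /cis_eq1[n] E.
  have : (n * p)%:~R = (1%:~R : R).
    apply: (mulIf T0); rewrite intrM mulrAC -E mul1r -mulrA.
    by rewrite -[p%:~R]/(p%:R) mulVf // mulr1.
  move=> /intr_inj /(congr1 absz); rewrite abszM /= => /eqP.
  rewrite muln_eq1 => /andP[_ /eqP p1]; move: pp.
  by rewrite (_ : p = 1%N).
- have cisX (k : nat) (t : R) : cis t ^+ k = cis (k%:R * t).
    elim: k => [|k IH]; first by rewrite expr0 mul0r -(cis_int R 0) mulr0z mul0r.
    by rewrite exprS IH -cisD -natr1 mulrDl mul1r addrC.
  by rewrite cisX mulrC divfK // -(cis_int R 1) mul1r.
exact: cis_unit.
Qed.

(** The transforms at all points together are faithful and respect the algebra operations and the
    adjoint, so [Phi] can be tested on matrices, where it is a unitary conjugation. *)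
Lemma star_isomorphic_of_transforms (R : realType) (p : nat) (M M' : Zp_space p)
    (F : M -> M') (w : complexes R) (z : M -> 'Z_p -> complexes R)
    (Phi : crossed_product R M -> crossed_product R M') :
  w ^+ p = 1 -> w * w^* = 1 -> w != 1 ->
  (forall x j, z x j * (z x j)^* = 1) -> (forall y, exists x, F x = y) ->
  bijective Phi ->
  (forall a x, transform w (Phi a) (F x) = dconj (z x) (transform w a x)) ->
  star_isomorphic R M M'.
Proof.
move=> w_p w_unit w_neq1 z1 Fs bPhi PhiE.
have inj b b' : (forall x, transform w b (F x) = transform w b' (F x)) -> b = b'.
  move=> bb; apply: (transform_inj w_p w_unit w_neq1) => y.
  by have [x <-] := Fs y.
have lin : linear Phi.
  move=> c a b; apply: inj => x.
  by rewrite PhiE !transform_linear !PhiE dconj_linear.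
have mon : monoid_morphism Phi.
  split=> [|a b]; apply: inj => x; rewrite PhiE.
    by rewrite !(transform1 w_p) // dconj1.
  by rewrite !(transformM w_p) // dconjM // !PhiE.
pose lPhi : {lrmorphism crossed_product R M -> crossed_product R M'} :=
  HB.pack Phi (GRing.isLinear.Build _ _ _ _ Phi lin) (GRing.isMonoidMorphism.Build _ _ Phi mon).
exists lPhi => // a; apply: inj => x.
by rewrite /= PhiE !transform_star // !PhiE dconj_adj.
Qed.

Theorem corollary3p7 (R : realType) (p : nat) (p_prime : prime p)
    (M M' : Zp_space p) :
  covering_dim_le M 2 ->
  closure (free_part M) = [set: M] ->
  (forall c : cech_cohomology (one_point_compactification (orbit_space M)) 2,
    c = 0) ->
  (forall c : cech_cohomology (corona R (orbit_space M)) 2, c = 0) ->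
  orbit_equivalent M M' ->
  star_isomorphic R M M'.
Proof.
move=> Md _ H2p H2c [F [Fc [G [Gc FK GK]]] orb].
have [w [w_p w_unit w_neq1]] := root_of_unity R p_prime.
have [tc tp torb] := conjugate_action Fc Gc FK GK orb.
(* Both units live on [M]: [u] for its own action, [u'] for the action of [M'] pulled back by
   [F]. *)
have [u ue u1] := equivariant_unit Md (@zp_act_continuous p M) (@zp_act_iter p M)
  (fun=> erefl) w_p w_unit H2p H2c.
have [u' u'e u'1] := equivariant_unit Md tc tp torb w_p w_unit H2p H2c.
have orb' y : G @` Defs.orbit y = Defs.orbit (G y).
  rewrite -[in LHS](GK y) -orb image_comp; apply/seteqP; split=> [_ [x xy <-]|x xy] /=.
    by rewrite FK.
  by exists x; rewrite //= FK.
have freeG y : free_part M' y <-> free_part M (G y).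
  have fixE (N : Zp_space p) (x : N) : Defs.orbit x = [set x] <-> zp_act x = x.
    exact: iter_orbit_fixed (prime_gt1 p_prime).
  split=> yf /fixE e; apply: yf; apply/fixE.
    by rewrite -[in LHS](GK y) -orb e image_set1 GK.
  by rewrite -orb' e image_set1.
have Gcvg (f : M -> complexes R) y : f @ G y --> f (G y) ->
    (f \o G) @ y --> (f \o G) y.
  by move=> h; apply: continuous_comp => //; exact: Gc.
(* For the inverse map the units exchange roles: on [M'], [u' \o G] belongs to its own action and
   [u \o G] to the transported one. *)
have ue' : equivariant (F \o @zp_act p M \o G) w (u \o G).
  split=> y /freeG My; first by apply: Gcvg; exact: ue.1.
  by rewrite /= FK ue.2.
have u'e' : equivariant (@zp_act p M') w (u' \o G).
  split=> y /freeG My; first by apply: Gcvg; exact: u'e.1.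
  by rewrite /= -u'e.2 //= GK.
have u1' y : free_part M' y -> (u \o G) y * ((u \o G) y)^* = 1.
  by move=> /freeG; exact: u1.
have u'1' y : free_part M' y -> (u' \o G) y * ((u' \o G) y)^* = 1.
  by move=> /freeG; exact: u'1.
have /choice[Phi PhiE] := transport Fc Gc FK GK orb w_p w_unit w_neq1 ue u1 u'e u'1.
have /choice[Psi PsiE] := transport Gc Fc GK FK orb' w_p w_unit w_neq1 u'e' u'1' ue' u1'.
(* The diagonal matrices of the two directions are inverse to each other, which makes [Phi] and
   [Psi] inverse. *)
have zz x : twist_unit (u' \o G) (u \o G) (F x) =
    fun j => (twist_unit u u' x j)^*.
  apply/funext => j; rewrite /twist_unit /= FK.
  have -> : `[< free_part M' (F x) >] = `[< free_part M x >].
    by apply/asbool_equiv_eq; rewrite freeG FK.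
  case: asboolP => _; last by rewrite rmorph1.
  by rewrite rmorphXn rmorphM /= conjCK mulrC.
have z1 := twist_unit1 u1 u'1.
apply: (star_isomorphic_of_transforms w_p w_unit w_neq1 z1 _ _ PhiE).
  by move=> y; exists (G y).
exists Psi => [a|b].
  apply: (transform_inj w_p w_unit w_neq1) => x.
  by rewrite -{1}(FK x) PsiE PhiE zz dconjK.
apply: (transform_inj w_p w_unit w_neq1) => y.
rewrite -[in LHS](GK y) PhiE PsiE.
have -> : twist_unit u u' (G y) = fun j => (twist_unit (u' \o G) (u \o G) y j)^*.
  by apply/funext => j; rewrite -{2}(GK y) zz conjCK.
by rewrite (dconjK (twist_unit1 u'1' u1' y)).
Qed.
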